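(* Every $3$-uniform family with $50$ distinct members contains a $4$-sunflower. Consequently, $f(3,4)\le49$.
   Context: A family is $3$-uniform if all its members are $3$-element sets (the ground set is an arbitrary finite set). A $k$-sunflower is a collection of $k$ distinct sets $A_1,\dots,A_k$ for which there is a set $C$ (the core, possibly empty) with $A_i\cap A_j=C$ for all $i\ne j$. $f(w,k)$ denotes the maximum size of a finite family of distinct $w$-element sets containing no $k$-sunflower. *)

(* Defs.v *)
From mathcomp Require Import all_boot.
From Stdlib Require Import ClassicalEpsilon.

Set Implicit Arguments.
Unset Strict Implicit.
Unset Printing Implicit Defensive.

Definition uniform (w : nat) (T : finType) (F : {set {set T}}) : Prop :=
  forall A : {set T}, A \in F -> #|A| = w.

Definition is_sunflower (k : nat) (T : finType) (S : {set {set T}}) : Prop :=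
  #|S| = k /\
  exists C : {set T}, forall A B : {set T},
    A \in S -> B \in S -> A != B -> A :&: B = C.

Definition has_sunflower (k : nat) (T : finType) (F : {set {set T}}) : Prop :=
  exists S : {set {set T}}, S \subset F /\ is_sunflower k S.

Definition max_sunflower_free (w k m : nat) : Prop :=
  (exists (T : finType) (F : {set {set T}}),
      [/\ uniform w F, ~ has_sunflower k F & #|F| = m]) /\
  (forall (T : finType) (F : {set {set T}}),
      uniform w F -> ~ has_sunflower k F -> #|F| <= m).

(* This maximum exists for every k > 0: see sunflower_fP. For k = 0 every      *)
(* family contains the empty sunflower and the value is unspecified.          *)
Definition sunflower_f (w k : nat) : nat :=
  epsilon (inhabits 0) (max_sunflower_free w k).

(* Erdos-Rado; it makes the maximum defining sunflower_f finite. *)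
Lemma erdos_rado (w k : nat) (T : finType) (F : {set {set T}}) :
  uniform w F -> ~ has_sunflower k.+1 F -> #|F| <= w`! * k ^ w.
Proof.
elim: w F => [|w IHw] F uF nF.
  have <- : #|[set set0 : {set T}]| = 0`! * k ^ 0 by rewrite cards1.
  apply: subset_leq_card.
  by apply/subsetP => A /uF/eqP; rewrite cards_eq0 inE.
pose P (D : {set {set T}}) := (D \subset F) && trivIset D.
have P0 : P set0.
  by rewrite /P sub0set; apply/trivIsetP => A B; rewrite inE.
have [D /maxsetP [/andP [DF tD] maxD] _] := maxset_exists P0.
have leD : #|D| <= k.
  rewrite leqNgt; apply/negP => ltkD; apply: nF.
  have := card_geqP ltkD; case=> s [us ss sD].
  exists [set A in s]; split.
    by apply/subsetP => A; rewrite inE => /sD; exact: (subsetP DF).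
  split; first by rewrite cardsE (card_uniqP us).
  exists set0 => A B; rewrite !inE => /sD AD /sD BD neAB.
  by apply/eqP; rewrite setI_eq0; apply: (trivIsetP tD).
have leU : #|cover D| <= k * w.+1.
  apply: leq_trans (leq_card_cover D) _.
  rewrite (eq_bigr (fun _ => w.+1)); last by move=> A /(subsetP DF)/uF.
  by rewrite sum_nat_const leq_mul2r leD orbT.
pose Fx x := [set A in F | x \in A].
have FU : F \subset \bigcup_(x in cover D) Fx x.
  apply/subsetP => A AF.
  have [dA|] := boolP [disjoint A & cover D]; last first.
    case/pred0Pn => x /= /andP [xA xU].
    by apply/bigcupP; exists x => //; rewrite inE AF.
  have AnD B : B \in D -> [disjoint A & B].
    move=> BD; apply: disjointWr dA; exact: bigcup_sup.
  have PA : P (A |: D).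
    rewrite /P subUset sub1set AF DF /=.
    apply/trivIsetP => B C; rewrite !inE.
    case/orP => [/eqP->|BD]; case/orP => [/eqP->|CD]; rewrite ?eqxx // => ne.
    - exact: AnD.
    - by rewrite disjoint_sym AnD.
    - exact: (trivIsetP tD).
  have AD : A \in D by rewrite -(maxD _ PA (subsetUr _ _)) setU11.
  have := AnD _ AD; rewrite -setI_eq0 setIid -cards_eq0.
  by rewrite (uF _ AF).
have leFx x : #|Fx x| <= w`! * k ^ w.
  have injx : {in Fx x &, injective (fun A => A :\ x)}.
    move=> A B; rewrite !inE => /andP [_ xA] /andP [_ xB] eAB.
    by rewrite -(setD1K xA) eAB setD1K.
  rewrite -(card_in_imset injx); apply: IHw.
    move=> _ /imsetP [A + ->]; rewrite inE => /andP [/uF cA xA].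
    by apply/eqP; rewrite -eqSS -cA (cardsD1 x A) xA.
  case=> S [SF [cS [C SC]]]; apply: nF.
  have SP A : A \in S -> x |: A \in F /\ x \notin A.
    move/(subsetP SF)/imsetP => [B + ->]; rewrite inE => /andP [BF xB].
    by rewrite setD1K // !inE eqxx.
  exists [set x |: A | A in S]; split.
    by apply/subsetP => _ /imsetP [A /SP [AF _] ->].
  split.
    rewrite card_in_imset // => A B /SP [_ xA] /SP [_ xB] eAB.
    by rewrite -(setU1K xA) eAB setU1K.
  exists (x |: C) => _ _ /imsetP [A AS ->] /imsetP [B BS ->] ne.
  rewrite -setUIr (SC A B) //.
  by apply: contraNneq ne => ->.
apply: leq_trans (subset_leq_card FU) _.
have leUF : #|\bigcup_(x in cover D) Fx x| <= \sum_(x in cover D) #|Fx x|.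
  elim/big_rec2: _ => [|x n B _ leB]; first by rewrite cards0.
  by apply: leq_trans (leq_card_setU _ _) _; rewrite leq_add2l.
apply: leq_trans leUF _.
have leS : \sum_(x in cover D) #|Fx x| <= #|cover D| * (w`! * k ^ w).
  by rewrite -sum_nat_const; apply: leq_sum => x _.
apply: leq_trans leS _; apply: leq_trans (leq_mul leU (leqnn _)) _.
by rewrite factS expnS [k * w.+1]mulnC mulnACA leqnn.
Qed.

Lemma sunflower_fP (w k : nat) :
  0 < k -> max_sunflower_free w k (sunflower_f w k).
Proof.
case: k => // k _; apply: epsilon_spec.
pose Q n := exists (T : finType) (F : {set {set T}}),
  [/\ uniform w F, ~ has_sunflower k.+1 F & #|F| = n].
pose q n : bool := excluded_middle_informative (Q n).
have qP n : reflect (Q n) (q n) by apply: sumboolP.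
have exq : exists n, q n.
  exists 0; apply/qP; exists unit, set0; split; rewrite ?cards0 //.
    by move=> A; rewrite inE.
  case=> S [+ [cS _]]; rewrite subset0 => /eqP S0.
  by move: cS; rewrite S0 cards0.
have bq n : q n -> n <= w`! * k ^ w.
  by move=> /qP [T [F [uF nF <-]]]; exact: erdos_rado.
case: (ex_maxnP exq bq) => m /qP Qm maxm; exists m; split=> // T F uF nF.
by apply: maxm; apply/qP; exists T, F.
Qed.

(* Main.v *)
(** Let d be the degree and c the codegree in a 3-uniform family F without
    4-sunflower. Links of vertices are graphs of maximal degree at most 3 without
    4 disjoint edges, so d <= 10 by a bound obtained from Gallai's lemma on maximum
    matchings; moreover c <= 3, and for v in A the edges meeting A exactly in v
    form a graph without 3 disjoint edges (A itself can be added), hence there are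
    at most 7 of them, with equality only for a graph on 5 vertices.
    If p edges meet A in two points, N(A), the number of edges meeting A, is at
    most 22 + p and at most 28 - p, so N(A) <= 25.

    Let |F| = 50. There are three disjoint edges A1, A2, A3; choose them with
    N(A1) + N(A2) + N(A3) minimal. Every edge meets one of them, so with n_i the
    number of edges disjoint from the other two and r the number of edges meeting
    all three, 2|F| = sum N(A_i) + sum n_i - r. The n_i edges form an intersecting
    family, over which A_i minimises N; a case analysis of intersecting families
    gives n_i <= 10 and N(A_i) + n_i <= 33, except when N(A_i) = 24 and the n_i = 10
    edges are all the edges through one vertex x. In the exceptional case the link
    of x has a monochromatic edge {p, q} for the colouring of vertices u by whether
    at most two edges through u meet A3 but not A2 (i = 1). Replacing A1 by
    {x, p, q} keeps the triple minimal, the counts force r = 0, and the edges at p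
    and at q, each forming a graph with 7 edges on 5 points, are then too unevenly
    distributed between A2 and A3. Otherwise 100 <= 3 * 33, a contradiction. *)

Require Import Defs.
From mathcomp Require Import all_boot zify.
From Stdlib Require Import Classical.

Set Implicit Arguments.
Unset Strict Implicit.
Unset Printing Implicit Defensive.

(** * Matchings in graphs *)

Section Graphs.

Variable T : finType.
Implicit Types (E M N X Y : {set {set T}}) (e f A B C : {set T}) (u v w x y : T).

(** Taken separately, N <= 25 and n_i <= 10 only bound the double count by 105, so they must be
    traded against each other; 33 is the target because 3 * 33 < 100. Only N = 25 with n_i >= 9 and
    N = 24 with n_i = 10 exceed it. The minimal choice of the triple links the two numbers: it makes
    N(A_i) a lower bound for N on all the n_i edges. An edge with N >= 24 is almost rigid: its three
    codegrees sum to at most 7, and one of its vertices has 7 private edges (meeting the edge only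
    there), which as a graph on 5 points have degrees 3, 3, 3, 3, 2. The vertex of degree 2, written
    [o], is the handle in most cases. Ten edges through one vertex escape this: 10 is just the
    degree bound, and such edges intersect for free. Hence the global argument for stars, which
    rests on the fact that when 7 pairs on 5 points are divided by two disjoint sets so that each
    pair meets exactly one of them, one set receives at most two pairs. *)

Definition deg E v := #|[set e in E | v \in e]|.

Definition edges_off E v := [set e in E | v \notin e].

Definition matching_le E k :=
  [forall M : {set {set T}}, (M \subset E) && trivIset M ==> (#|M| <= k)].

Lemma matching_leP E k :
  reflect (forall M, M \subset E -> trivIset M -> #|M| <= k) (matching_le E k).
Proof.
apply: (iffP forallP) => [h M sM tM | h M].
  by move: (h M); rewrite sM tM.
by apply/implyP => /andP [sM tM]; exact: h.
Qed.

Lemma uniformS k E X : X \subset E -> uniform k E -> uniform k X.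
Proof. by move=> sXE uE A /(subsetP sXE); exact: uE. Qed.

Lemma degS E X v : X \subset E -> deg X v <= deg E v.
Proof.
move=> sXE; apply/subset_leq_card/subsetP => e; rewrite !inE.
by case/andP => /(subsetP sXE) -> ->.
Qed.

Lemma card_edges_off E v : #|E| = deg E v + #|edges_off E v|.
Proof.
rewrite -(cardsID [set e : {set T} | v \in e] E); congr addn.
  by apply: eq_card => e; rewrite !inE.
by apply: eq_card => e; rewrite !inE andbC.
Qed.

Lemma in_edges_off E v e : (e \in edges_off E v) = (e \in E) && (v \notin e).
Proof. by rewrite inE. Qed.

Lemma edges_off_sub E v : edges_off E v \subset E.
Proof. by apply/subsetP => e; rewrite inE => /andP []. Qed.

Lemma sum_deg E C : \sum_(v in C) deg E v = \sum_(e in E) #|e :&: C|.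
Proof.
transitivity (\sum_(v in C) \sum_(e in E) (v \in e : nat)).
  apply: eq_bigr => v _; rewrite /deg -sum1_card big_mkcond [RHS]big_mkcond /=.
  by apply: eq_bigr => e _; rewrite !inE; case: (e \in E); case: (v \in e).
rewrite exchange_big /=; apply: eq_bigr => e _.
rewrite -sum1_card big_mkcond [RHS]big_mkcond /=.
by apply: eq_bigr => v _; rewrite !inE; case: (v \in C); case: (v \in e).
Qed.

Lemma mem_cover E e v : e \in E -> v \in e -> v \in cover E.
Proof. by move=> eE ve; apply/bigcupP; exists e. Qed.

Lemma sum_deg_cover k E : uniform k E -> \sum_(v in cover E) deg E v = k * #|E|.
Proof.
move=> uE; rewrite sum_deg mulnC -sum_nat_const; apply: eq_bigr => e eE.
rewrite (setIidPl _) ?uE //; apply/subsetP => v; exact: mem_cover.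
Qed.

Lemma deg_cover E v : (0 < deg E v) = (v \in cover E).
Proof.
apply/card_gt0P/bigcupP => [[e] | [e eE ve]].
  by rewrite inE => /andP [eE ve]; exists e.
by exists e; rewrite inE eE.
Qed.

Lemma card_matching k M : uniform k M -> trivIset M -> #|cover M| = k * #|M|.
Proof.
move=> uM /eqP <-; rewrite (eq_bigr (fun=> k)) => [|e eM]; last exact: uM.
by rewrite sum_nat_const mulnC.
Qed.

Lemma trivIset_add M e :
  trivIset M -> [disjoint e & cover M] -> trivIset (e |: M).
Proof. by move=> tM de; apply: trivIsetU; rewrite ?trivIset1 ?cover1. Qed.

Lemma notin_cover M e x : x \in e -> x \notin cover M -> e \notin M.
Proof. by move=> xe; apply: contra => eM; exact: mem_cover xe. Qed.

Lemma edge_split E e x : uniform 2 E -> e \in E -> x \in e ->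
  exists2 y, y != x & e = [set x; y].
Proof.
move=> uE eE xe; have /eqP/cards2P [a [b [nab eab]]] := uE _ eE.
move: xe; rewrite eab !inE => /orP [] /eqP ->.
  by exists b; rewrite // eq_sym.
by exists a; rewrite // setUC.
Qed.

(** Maximality comes from a hypothesis [matching_le E k] that accompanies the uses. *)
Definition max_matching E k M := [&& M \subset E, trivIset M & #|M| == k].

Lemma max_matching_adj E k M x y : matching_le E k -> max_matching E k M ->
  [set x; y] \in E -> (x \in cover M) || (y \in cover M).
Proof.
move=> /matching_leP hE /and3P [sM tM /eqP cM] xyE.
apply/negPn/negP; rewrite negb_or => /andP [xM yM].
have eM : [set x; y] \notin M by apply: notin_cover xM; rewrite !inE eqxx.
have := hE ([set x; y] |: M); rewrite cardsU1 eM cM add1n ltnn => h.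
suff: false by []; apply: h; first by rewrite subUset sub1set xyE.
apply: trivIset_add => //; apply/pred0P => z /=; rewrite !inE.
by apply/andP => -[/orP [] /eqP ->]; apply/negP.
Qed.

(* Gallai: a maximum matching M avoiding u and v is compared with a maximum   *)
(* matching N avoiding w that has the most edges in common with M.            *)
Lemma gallai_trans E k u v w : uniform 2 E -> matching_le E k ->
  (exists2 N, max_matching E k N & w \notin cover N) ->
  (forall M, max_matching E k M -> (u \in cover M) || (w \in cover M)) ->
  (forall M, max_matching E k M -> (v \in cover M) || (w \in cover M)) ->
  u != v ->
  forall M, max_matching E k M -> (u \in cover M) || (v \in cover M).
Proof.
move=> uE hE [N0 N0m wN0] huw hvw nuv M Mm.
apply/negPn/negP; rewrite negb_or => /andP [uM vM].
have wM : w \in cover M by have := huw M Mm; rewrite (negbTE uM).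
pose Q N := max_matching E k N && (w \notin cover N).
have Q0 : Q N0 by rewrite /Q N0m.
case: (arg_maxnP (fun N : {set {set T}} => #|M :&: N|) Q0) => N /andP [Nm wN] maxN.
have uN : u \in cover N by have := huw N Nm; rewrite (negbTE wN) orbF.
have vN : v \in cover N by have := hvw N Nm; rewrite (negbTE wN) orbF.
have /and3P [sM tM /eqP cM] := Mm; have /and3P [sN tN /eqP cN] := Nm.
have kM := card_matching (uniformS sM uE) tM.
have kN := card_matching (uniformS sN uE) tN.
have c2 : 1 < #|cover N :\: cover M|.
  have <- : #|[set u; v]| = 2 by rewrite cards2 nuv.
  apply/subset_leq_card/subsetP => z; rewrite !inE => /orP [] /eqP ->;
  by rewrite ?uN ?vN ?uM ?vM.
have c1 : 0 < #|(cover M :\: cover N) :\ w|.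
  have := cardsID (cover N) (cover M); have := cardsID (cover M) (cover N).
  rewrite (setIC (cover N)); have := cardsD1 w (cover M :\: cover N).
  by rewrite !inE wM wN /= kM kN cM cN; move: c2; clear; lia.
(* Since [N] is maximum, the edge [e] of [M] at [x] has its other end [y] on an edge [f] of [N].
   Exchanging [f] for [e] keeps [w] uncovered and gains an edge in common with [M]. *)
have /card_gt0P [x] := c1; rewrite !inE => /and3P [nxw xN /bigcupP [e eM xe]].
have eE := subsetP sM _ eM.
have [y nyx ee] := edge_split uE eE xe.
have xyE : [set x; y] \in E by rewrite -ee.
have yN : y \in cover N.
  by have := max_matching_adj hE Nm xyE; rewrite (negbTE xN).
have /bigcupP [f fN yf] := yN.
have neN : e \notin N by exact: notin_cover xN.
have nfM : f \notin M.
  apply/negP => fM; have nef : f != e by apply: contraNneq neN => <-.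
  have /pred0P/(_ y)/= := trivIsetP tM _ _ fM eM nef.
  by rewrite yf ee !inE eqxx orbT.
have neNf : e \notin N :\ f by rewrite !inE (negbTE neN) andbF.
have N'm : max_matching E k (e |: N :\ f).
  apply/and3P; split.
  - by rewrite subUset sub1set eE (subset_trans (subsetDl _ _) sN).
  - apply: trivIset_add; first exact: trivIsetD.
    rewrite (coverD1 tN fN) ee; apply/pred0P => z /=; rewrite !inE.
    apply/negP => /andP [/orP [] /eqP ->]; first by rewrite (negbTE xN) andbF.
    by rewrite yf.
  - by rewrite cardsU1 neNf; have := cardsD1 f N; rewrite fN cN => ->.
have wN' : w \notin cover (e |: N :\ f).
  apply/bigcupP => -[g]; rewrite !inE => /orP [/eqP -> | /andP [_ gN] wg].
    rewrite ee !inE eq_sym (negbTE nxw) /= => /eqP wy.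
    by rewrite wy yN in wN.
  by rewrite (mem_cover gN wg) in wN.
have := maxN (e |: N :\ f); rewrite /Q N'm wN' => /(_ isT).
have -> : M :&: (e |: N :\ f) = e |: M :&: N.
  apply/setP => g; rewrite !inE; have [->|_] /= := eqVneq g e; first by rewrite eM.
  by have [->|] := eqVneq g f; rewrite //= (negbTE nfM).
by rewrite cardsU1 !inE (negbTE neN) andbF /= add1n ltnn.
Qed.

(** If a vertex is covered by every matching of k + 1 edges, deleting it lowers the bound.
    Otherwise, being equal or never missed together by such a matching is an equivalence relation by
    [gallai_trans], and it contains adjacency. With a single class a maximum matching misses at most
    one vertex; otherwise a class [C] separates the edges. *)
Lemma matching_structure E k : uniform 2 E -> matching_le E k.+1 ->
  [\/ exists v, matching_le (edges_off E v) k,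
      #|cover E| <= (2 * k.+1).+1 |
      exists C, [/\ forall e, e \in E -> (e \subset C) || [disjoint e & C],
        exists2 e, e \in E & e \subset C &
        exists2 e, e \in E & [disjoint e & C]]].
Proof.
move=> uE hE.
have [/existsP h|] := boolP [exists v, matching_le (edges_off E v) k].
  by constructor 1.
rewrite negb_exists => /forallP ness.
have miss v : exists2 M, max_matching E k.+1 M & v \notin cover M.
  have := ness v; rewrite negb_forall => /existsP [M].
  rewrite negb_imply -ltnNge => /andP [/andP [sM tM] cM].
  have sME := subset_trans sM (edges_off_sub E v).
  exists M; first by rewrite /max_matching sME tM eqn_leq cM (matching_leP _ _ hE).
  apply/bigcupP => -[e /(subsetP sM)]; rewrite inE => /andP [_ ve].
  by rewrite (negbTE ve).
pose R u v := (u == v) || [forall M : {set {set T}}, max_matching E k.+1 M ==>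
                ((u \in cover M) || (v \in cover M))].
have Rsym u v : R u v -> R v u.
  rewrite /R eq_sym; case: eqP => //= _ /forallP h.
  by apply/forallP => M; move: (h M); rewrite orbC.
have Rtr u v w : R u w -> R v w -> R u v.
  rewrite /R; have [-> // | nuv] /= := eqVneq u v.
  have [euw _ | nuw] /= := eqVneq u w.
    rewrite -euw eq_sym (negbTE nuv) /= => /forallP h; apply/forallP => M.
    by move: (h M); rewrite orbC.
  have [-> // | nvw] /= := eqVneq v w.
  move=> /forallP huw /forallP hvw; apply/forallP => M; apply/implyP => Mm.
  apply: (gallai_trans uE hE (miss w) _ _ nuv) Mm => N Nm.
    by move: (huw N); rewrite Nm.
  by move: (hvw N); rewrite Nm.
have Radj x y : [set x; y] \in E -> R x y.
  move=> xyE; rewrite /R; apply/orP; right; apply/forallP => M; apply/implyP => Mm.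
  exact: max_matching_adj hE Mm xyE.
have [/existsP [a /existsP [b /and3P [aE bE nab]]] | ] :=
  boolP [exists a, exists b, [&& a \in cover E, b \in cover E & ~~ R a b]].
  constructor 3; pose C := [set u | R a u].
  have Raa u : R u u by rewrite /R eqxx.
  have Cclosed e u : e \in E -> u \in e -> u \in C -> e \subset C.
    move=> eE ue uC; have [y _ ee] := edge_split uE eE ue.
    have Ruy : R u y by apply: Radj; rewrite -ee.
    apply/subsetP => z; rewrite ee !inE => /orP [] /eqP ->; first by rewrite inE in uC.
    by apply: (Rtr _ _ u); [rewrite inE in uC | exact: Rsym].
  have alt e : e \in E -> (e \subset C) || [disjoint e & C].
    move=> eE; rewrite orbC -implyNb; apply/implyP => /pred0Pn [u /= /andP [ue uC]].
    exact: Cclosed ue uC.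
  have /bigcupP [e eE ae] := aE; have /bigcupP [f fE bf] := bE.
  exists C; split=> //; [exists e | exists f] => //.
    by apply: Cclosed ae _; rewrite // inE.
  have /orP [/subsetP/(_ _ bf)|//] := alt _ fE.
  by rewrite inE (negbTE nab).
rewrite negb_exists => /forallP h; constructor 2.
have [E0 | /set0Pn [a aE]] := eqVneq (cover E) set0; first by rewrite E0 cards0.
have [M Mm aM] := miss a; have /and3P [sM tM /eqP cM] := Mm.
have kM := card_matching (uniformS sM uE) tM.
have := cardsID (cover M) (cover E).
have -> : cover E :&: cover M = cover M.
  by apply/setIidPr/bigcupsP => e /(subsetP sM) eE; exact: bigcup_sup.
rewrite kM cM => <-.
suff : #|cover E :\: cover M| <= 1 by clear; lia.
apply/card_le1_eqP => u v; rewrite !inE => /andP [uM uE'] /andP [vM vE'].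
move: (h u); rewrite negb_exists => /forallP /(_ v).
rewrite uE' vE' /= negbK /R => /orP [/eqP // | /forallP /(_ M)].
by rewrite Mm /= (negbTE uM) (negbTE vM).
Qed.

End Graphs.

(** * Edge bounds and 2-colourings for graphs of maximal degree 3 *)

Section Subcubic.

Variable T : finType.
Implicit Types (E M N X Y : {set {set T}}) (e f A B C : {set T}) (u v w x y : T).
Implicit Types (c : T -> bool).

Definition inner E C := [set e in E | e \subset C].
Definition outer E C := [set e in E | [disjoint e & C]].

Lemma inner_sub E C : inner E C \subset E.
Proof. by apply/subsetP => e; rewrite inE => /andP []. Qed.

Lemma outer_sub E C : outer E C \subset E.
Proof. by apply/subsetP => e; rewrite inE => /andP []. Qed.

Lemma card_inner_outer k E C : uniform k.+1 E ->
  (forall e, e \in E -> (e \subset C) || [disjoint e & C]) ->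
  #|E| = #|inner E C| + #|outer E C|.
Proof.
move=> uE alt; rewrite -(cardsID [set e : {set T} | e \subset C] E); congr addn.
  by apply: eq_card => e; rewrite !inE.
apply: eq_card => e; rewrite !inE andbC; have [eE|//] := boolP (e \in E).
have := alt _ eE; case: (boolP (e \subset C)) => //= eC _.
apply/esym/negP => /pred0P d; have := uE _ eE.
have /set0Pn [x xe] : e != set0 by apply/eqP => e0; have := uE _ eE; rewrite e0 cards0.
by have := d x; rewrite /= xe (subsetP eC).
Qed.

Lemma matching_union E C M N : M \subset inner E C -> N \subset outer E C ->
  uniform 2 E -> trivIset M -> trivIset N ->
  [/\ M :|: N \subset E, trivIset (M :|: N) & #|M :|: N| = #|M| + #|N|].
Proof.
move=> sM sN uE tM tN.
have dMN : [disjoint cover N & cover M].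
  apply/pred0P => x /=; apply/negP => /andP [/bigcupP [e eN xe] /bigcupP [f fM xf]].
  move: (subsetP sN _ eN) (subsetP sM _ fM); rewrite !inE => /andP [_ /pred0P/(_ x)/=].
  by rewrite xe /= => xC /andP [_ /subsetP/(_ x xf)]; rewrite xC.
split.
- by rewrite subUset (subset_trans sM (inner_sub E C)) (subset_trans sN (outer_sub E C)).
- by apply: trivIsetU; rewrite // disjoint_sym.
rewrite cardsU (_ : M :&: N = set0) ?cards0 ?subn0 //.
apply/eqP; rewrite setI_eq0; apply/pred0P => e /=; apply/negP => /andP [eM eN].
have eE := subsetP (subset_trans sM (inner_sub E C)) _ eM.
have /set0Pn [x xe] : e != set0 by apply/eqP => e0; have := uE _ eE; rewrite e0 cards0.
by have /pred0P/(_ x)/= := dMN; rewrite !(mem_cover _ xe).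
Qed.

(** Matchings inside and outside [C] combine, so more than [k] edges on one side leave fewer than
    [l] for the other. *)
Lemma matching_inner E C k l : uniform 2 E -> matching_le E (k + l) ->
  ~~ matching_le (inner E C) k -> matching_le (outer E C) l.-1.
Proof.
move=> uE /matching_leP hE; rewrite negb_forall => /existsP [M].
rewrite negb_imply -ltnNge => /andP [/andP [sM tM] cM].
apply/matching_leP => N sN tN.
have [sU tU cU] := matching_union sM sN uE tM tN.
by have := hE _ sU tU; rewrite cU; move: cM; clear; lia.
Qed.

Lemma matching_outer E C k l : uniform 2 E -> matching_le E (k + l) ->
  ~~ matching_le (outer E C) k -> matching_le (inner E C) l.-1.
Proof.
move=> uE /matching_leP hE; rewrite negb_forall => /existsP [N].
rewrite negb_imply -ltnNge => /andP [/andP [sN tN] cN].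
apply/matching_leP => M sM tM.
have [sU tU cU] := matching_union sM sN uE tM tN.
by have := hE _ sU tU; rewrite cU; move: cN; clear; lia.
Qed.

Lemma matching_le0 E : matching_le E 0 -> E = set0.
Proof.
move=> /matching_leP hE; apply/eqP/set0Pn => -[e eE].
by have := hE [set e]; rewrite sub1set eE trivIset1 cards1 => /(_ isT isT).
Qed.

Lemma inner_nempty E C : (exists2 e, e \in E & e \subset C) -> ~~ matching_le (inner E C) 0.
Proof.
by case=> e eE eC; apply/negP => /matching_le0/setP/(_ e); rewrite !inE eE eC.
Qed.

Lemma outer_nempty E C : (exists2 e, e \in E & [disjoint e & C]) ->
  ~~ matching_le (outer E C) 0.
Proof.
by case=> e eE eC; apply/negP => /matching_le0/setP/(_ e); rewrite !inE eE eC.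
Qed.

Definition subcubic E := forall v, deg E v <= 3.

Lemma subcubicS E X : X \subset E -> subcubic E -> subcubic X.
Proof. by move=> sXE sE v; exact: leq_trans (degS v sXE) (sE v). Qed.

Lemma subcubic_edges E : uniform 2 E -> subcubic E -> 2 * #|E| <= 3 * #|cover E|.
Proof.
move=> uE sE; rewrite -(sum_deg_cover uE) mulnC -sum_nat_const.
by apply: leq_sum => v _; exact: sE.
Qed.

(** The alternatives are a star, a graph on 3 vertices, and two separated edges, which is
    impossible. *)
Lemma matching1_edges E : uniform 2 E -> subcubic E -> matching_le E 1 -> #|E| <= 3.
Proof.
move=> uE sE hE; have [[v hv]|cE|[C [alt hi ho]]] := matching_structure uE hE.
- by rewrite (card_edges_off E v) (matching_le0 hv) cards0 addn0.
- have sub : E \subset [set e : {set T} | (e \subset cover E) && (#|e| == 2)].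
    by apply/subsetP => e eE; rewrite inE bigcup_sup //= uE.
  apply: leq_trans (subset_leq_card sub) _; rewrite cards_draws.
  exact: leq_trans (leq_bin2l _ cE) _.
have := matching_inner (k := 0) uE hE (inner_nempty hi).
by rewrite (negbTE (outer_nempty ho)).
Qed.

(** A deleted vertex and a separation both give 3 + 3; only 5 vertices allow 7, the integer part of
    15 / 2. *)
Lemma matching2_edges E : uniform 2 E -> subcubic E -> matching_le E 2 ->
  #|E| <= 7 /\ (#|E| = 7 -> #|cover E| = 5).
Proof.
move=> uE sE hE.
have b2 := subcubic_edges uE sE.
have bE X : X \subset E -> matching_le X 1 -> #|X| <= 3.
  by move=> sX; apply: matching1_edges; [exact: uniformS uE | exact: subcubicS sE].
have [[v hv]|cE|[C [alt hi ho]]] := matching_structure uE hE.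
- have := bE _ (edges_off_sub E v) hv; have := sE v.
  by rewrite (card_edges_off E v); clear; lia.
- by split; [|move=> E7]; move: cE b2; rewrite ?E7; clear; lia.
have h1 := matching_inner (k := 0) uE hE (inner_nempty hi).
have h2 := matching_outer (k := 0) uE hE (outer_nempty ho).
have := bE _ (inner_sub E C) h2; have := bE _ (outer_sub E C) h1.
by rewrite (card_inner_outer uE alt); clear; lia.
Qed.

(** All three alternatives give 10: 3 + 7 for a deleted vertex, the integer part of 21 / 2 for 7
    vertices, 3 + 7 for a separation. *)
Lemma matching3_edges E : uniform 2 E -> subcubic E -> matching_le E 3 -> #|E| <= 10.
Proof.
move=> uE sE hE; have b2 := subcubic_edges uE sE.
have b1E X : X \subset E -> matching_le X 1 -> #|X| <= 3.
  by move=> sX; apply: matching1_edges; [exact: uniformS uE | exact: subcubicS sE].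
have b2E X : X \subset E -> matching_le X 2 -> #|X| <= 7.
  move=> sX hX; apply: (proj1 (matching2_edges _ _ hX)).
    exact: uniformS uE. 
  exact: subcubicS sE.
have [[v hv]|cE|[C [alt hi ho]]] := matching_structure uE hE.
- have := b2E _ (edges_off_sub E v) hv; have := sE v.
  by rewrite (card_edges_off E v); clear; lia.
- by move: cE b2; clear; lia.
have h1 := matching_inner (k := 0) uE hE (inner_nempty hi).
have h2 := matching_outer (k := 0) uE hE (outer_nempty ho).
rewrite (card_inner_outer uE alt).
have := b2E _ (inner_sub E C) h2; have := b2E _ (outer_sub E C) h1.
have [i1 | /(matching_inner (k := 1) uE hE) o1] := boolP (matching_le (inner E C) 1).
  by have := b1E _ (inner_sub E C) i1; clear; lia.
by have := b1E _ (outer_sub E C) o1; clear; lia.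
Qed.

(** The degree sum 14 is one less than 3 * 5. *)
Lemma seven_edges_degrees E : uniform 2 E -> subcubic E -> #|E| = 7 -> #|cover E| = 5 ->
  (forall v, v \in cover E -> 1 < deg E v) /\
  exists o, [/\ o \in cover E, deg E o = 2 &
    forall v, v \in cover E -> v != o -> deg E v = 3].
Proof.
move=> uE sE E7 V5; have := sum_deg_cover uE; rewrite E7 => sum14.
have dec v : v \in cover E -> 14 = deg E v + \sum_(u in cover E | u != v) deg E u.
  by move=> vE; rewrite -(bigD1 v).
have cardD v : v \in cover E -> \sum_(u in cover E | u != v) 3 = 12.
  move=> vE; rewrite sum_nat_const.
  have -> : #|[pred u in cover E | u != v]| = #|cover E :\ v|.
    by apply: eq_card => u; rewrite !inE andbC.
  by have := cardsD1 v (cover E); rewrite vE V5 add1n => -[<-].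
have ge2 v : v \in cover E -> 1 < deg E v.
  move=> vE; have := dec _ vE.
  have : \sum_(u in cover E | u != v) deg E u <= \sum_(u in cover E | u != v) 3.
    by apply: leq_sum => u _; exact: sE.
  by rewrite cardD //; clear; lia.
split=> //.
have [/existsP [o /andP [oE dgo]] | ] := boolP [exists o, (o \in cover E) && (deg E o == 2)].
  exists o; split=> // [|v vE nvo]; first exact/eqP.
  have := dec _ oE; rewrite (eqP dgo) (bigD1 v) ?vE //=.
  have vD : \sum_(i in cover E | (i != o) && (i != v)) deg E i <=
            \sum_(i in cover E | (i != o) && (i != v)) 3.
    by apply: leq_sum => u _; exact: sE.
  have := cardD _ oE; rewrite (bigD1 v) ?vE //=.
  under eq_bigl do rewrite -andbA.
  under [in X in _ -> X]eq_bigl do rewrite -andbA.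
  by have := sE v; move: vD; clear; lia.
rewrite negb_exists => /forallP h3.
have: \sum_(v in cover E) deg E v = \sum_(v in cover E) 3.
  apply: eq_bigr => v vE; move: (h3 v) (ge2 _ vE) (sE v); rewrite vE /=; clear; lia.
by rewrite sum14 sum_nat_const V5.
Qed.

Definition bichromatic (c : T -> bool) E :=
  forall x y, [set x; y] \in E -> x != y -> c x != c y.

Lemma bichromatic_card c E (V : {set T}) : uniform 2 E -> bichromatic c E ->
  cover E \subset V -> #|E| <= #|[set v in V | c v]| * #|[set v in V | ~~ c v]|.
Proof.
move=> uE bE /subsetP sV; rewrite -cardsX.
apply: leq_trans (leq_imset_card (fun p => [set p.1; p.2]) _).
apply/subset_leq_card/subsetP => e eE.
have /eqP/cards2P [x [y [nxy exy]]] := uE _ eE.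
have xyE : [set x; y] \in E by rewrite -exy.
have xV : x \in V by apply/sV/(mem_cover eE); rewrite exy !inE eqxx.
have yV : y \in V by apply/sV/(mem_cover eE); rewrite exy !inE eqxx orbT.
have := bE _ _ xyE nxy; have [cx|ncx] := boolP (c x) => cy.
  by apply/imsetP; exists (x, y); rewrite // !inE xV yV cx; case: (c y) cy.
apply/imsetP; exists (y, x); rewrite /= ?exy 1?setUC //.
by rewrite !inE xV yV ncx andbT; case: (c y) cy.
Qed.

(** Deleting the vertex of degree 2 leaves 5 edges on the 4 vertices of degree 3, while a properly
    2-coloured graph on 4 vertices has at most 4 edges. *)
Lemma monochromatic_edge7 c E : uniform 2 E -> subcubic E -> matching_le E 2 -> 6 < #|E| ->
  exists x y, [/\ x != y, [set x; y] \in E, c x = c y, deg E x = 3 & deg E y = 3].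
Proof.
move=> uE sE hE E7; have [leE cV] := matching2_edges uE sE hE.
have {leE}E7 : #|E| = 7 by apply/eqP; rewrite eqn_leq leE.
have {}cV := cV E7; have [_ [o [oE do3 d3]]] := seven_edges_degrees uE sE E7 cV.
have [/existsP [x /existsP [y /and5P [nxy xyE cxy dx dy]]] | ] :=
  boolP [exists x, exists y, [&& x != y, [set x; y] \in E, c x == c y,
     deg E x == 3 & deg E y == 3]].
  by exists x, y; split=> //; apply/eqP.
rewrite negb_exists => /forallP h.
pose V := cover E :\ o; pose X := edges_off E o.
have X5 : #|X| = 5 by have := card_edges_off E o; rewrite E7 do3 => -[].
have uX := uniformS (edges_off_sub E o) uE.
have sXV : cover X \subset V.
  apply/bigcupsP => e; rewrite inE => /andP [eE oe]; apply/subsetP => x xe.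
  rewrite !inE (mem_cover eE xe) andbT; by apply: contraNneq oe => <-.
have bX : bichromatic c X.
  move=> x y xyX nxy; move: (h x); rewrite negb_exists => /forallP /(_ y).
  have /(subsetP sXV)/[!inE]/andP [nxo xE] : x \in cover X.
    by apply: (mem_cover xyX); rewrite !inE eqxx.
  have /(subsetP sXV)/[!inE]/andP [nyo yE] : y \in cover X.
    by apply: (mem_cover xyX); rewrite !inE eqxx orbT.
  by rewrite nxy (subsetP (edges_off_sub E o) _ xyX) !d3 //= !andbT.
have := bichromatic_card uX bX sXV; rewrite X5.
have V4 : #|V| = 4 by have := cardsD1 o (cover E); rewrite oE cV add1n => -[].
have : #|[set v in V | c v]| + #|[set v in V | ~~ c v]| = 4.
  rewrite -V4 -[in RHS](cardsID [set v | c v] V); congr addn.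
    by apply: eq_card => v; rewrite !inE.
  by apply: eq_card => v; rewrite !inE andbC.
by clear; nia.
Qed.

(** Every edge has exactly one end in the colour class. *)
Lemma bichromatic_sum c E : uniform 2 E -> bichromatic c E ->
  \sum_(v in [set v in cover E | c v]) deg E v = #|E|.
Proof.
move=> uE bE; rewrite sum_deg -sum1_card; apply: eq_bigr => e eE.
have /eqP/cards2P [x [y [nxy exy]]] := uE _ eE.
have xE : x \in cover E by apply: (mem_cover eE); rewrite exy !inE eqxx.
have yE : y \in cover E by apply: (mem_cover eE); rewrite exy !inE eqxx orbT.
have := bE x y; rewrite -exy => /(_ eE nxy) cxy.
apply/eqP/cards1P; exists (if c x then x else y); apply/setP => z; rewrite exy !inE.
have [->|nzx] /= := eqVneq z x; first by rewrite xE /=; case: (c x); rewrite ?eqxx ?(negbTE nxy).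
have [->|nzy] /= := eqVneq z y.
  by rewrite yE /=; case: (c x) cxy; case: (c y); rewrite ?eqxx // [y == x]eq_sym (negbTE nxy).
by case: (c x); rewrite ?(negbTE nzx) ?(negbTE nzy).
Qed.

(* In the critical case there are 7 vertices and only one has degree 2, so in *)
(* a proper 2-colouring the 10 edges would all start in a class of cubic      *)
(* vertices.                                                                  *)
Lemma monochromatic_edge10 c E : uniform 2 E -> subcubic E -> matching_le E 3 -> #|E| = 10 ->
  exists x y, [/\ x != y, [set x; y] \in E, c x = c y, deg E y = 3 &
    deg E x = 3 \/ deg E x = 2 /\
      forall z, z != x -> [set x; z] \in E -> deg E z = 3].
Proof.
move=> uE sE hE E10.
(* Degree 3 in a subgraph is degree 3 in [E], so a 7-edge subgraph with matching number at most 2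
   suffices. *)
have sub7 X : X \subset E -> matching_le X 2 -> 6 < #|X| ->
    exists x y, [/\ x != y, [set x; y] \in E, c x = c y, deg E y = 3 &
    deg E x = 3 \/ deg E x = 2 /\
      forall z, z != x -> [set x; z] \in E -> deg E z = 3].
  move=> sX hX X7; have [x [y [nxy xyX cxy dx dy]]] :=
    monochromatic_edge7 c (uniformS sX uE) (subcubicS sX sE) hX X7.
  exists x, y; split=> //; first exact: (subsetP sX).
    by apply/eqP; rewrite eqn_leq sE -dy degS.
  by left; apply/eqP; rewrite eqn_leq sE -dx degS.
have [[v hv]|cE|[C [alt hi ho]]] := matching_structure uE hE.
- apply: (sub7 _ (edges_off_sub E v) hv).
  by have := card_edges_off E v; have := sE v; rewrite E10; clear; lia.
- have sum20 := sum_deg_cover uE; rewrite E10 in sum20.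
  have V7 : #|cover E| = 7.
    by have := subcubic_edges uE sE; rewrite E10; move: cE; clear; lia.
  (* The total deficiency is 3 * 7 - 20. *)
  have sum1 : \sum_(v in cover E) (3 - deg E v) = 1.
    have : \sum_(v in cover E) (3 - deg E v) + \sum_(v in cover E) deg E v = 21.
      rewrite -big_split /= (eq_bigr (fun=> 3)) ?sum_nat_const ?V7 // => v _.
      by rewrite subnK.
    by rewrite sum20; clear; lia.
  have [o [oE do2 d3]] : exists o, [/\ o \in cover E, deg E o = 2 &
     forall v, v \in cover E -> v != o -> deg E v = 3].
    have [/existsP [o /andP [oE dgo]] | ] :=
      boolP [exists o, (o \in cover E) && (deg E o != 3)].
      move: sum1; rewrite (bigD1 o) //= => sum1.
      exists o; split=> //; first by move: sum1 dgo (sE o); clear; lia.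
      move=> v vE nvo; move: sum1; rewrite (bigD1 v) ?vE //=.
      by move: (sE v) (sE o) dgo; clear; lia.
    rewrite negb_exists => /forallP h; move: sum1; rewrite big1 // => v vE.
    by move: (h v); rewrite vE /= negbK => /eqP ->.
  have [/existsP [x /existsP [y /and3P [nxy xyE cxy]]] | ] :=
    boolP [exists x, exists y, [&& x != y, [set x; y] \in E & c x == c y]].
    have xV : x \in cover E by apply: (mem_cover xyE); rewrite !inE eqxx.
    have yV : y \in cover E by apply: (mem_cover xyE); rewrite !inE eqxx orbT.
    have main a b : a != b -> [set a; b] \in E -> c a = c b -> b \in cover E ->
        b != o -> a \in cover E -> exists x y, [/\ x != y, [set x; y] \in E, c x = c y, deg E y = 3 &
          deg E x = 3 \/ deg E x = 2 /\
          forall z, z != x -> [set x; z] \in E -> deg E z = 3].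
      move=> nab abE cab bV nbo aV; exists a, b; split=> //; first exact: d3.
      have [eao|nao] := eqVneq a o; last by left; exact: d3.
      right; rewrite eao do2; split=> // z nzo ozE; apply: d3 nzo.
      by apply: (mem_cover ozE); rewrite !inE eqxx orbT.
    have [eyo|nyo] := eqVneq y o; last by apply: (main x y) => //; exact/eqP.
    apply: (main y x) => //; first by rewrite eq_sym.
    - by rewrite setUC.
    - by apply/esym/eqP.
    - by rewrite -eyo.
  rewrite negb_exists => /forallP h.
  have bE : bichromatic c E.
    move=> x y xyE nxy; move: (h x); rewrite negb_exists => /forallP /(_ y).
    by rewrite nxy xyE.
  have bE' : bichromatic (fun v => ~~ c v) E.
    by move=> x y xyE nxy; have := bE _ _ xyE nxy; case: (c x); case: (c y).
  (* A class avoiding [o] would have degree sum 10, not a multiple of 3. *)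
  have all3 (d : T -> bool) : bichromatic d E -> ~~ d o -> False.
    move=> bd ndo; have := bichromatic_sum uE bd; rewrite E10.
    rewrite (eq_bigr (fun=> 3)) ?sum_nat_const; first by clear; lia.
    move=> v; rewrite inE => /andP [vE dv]; apply: d3 => //.
    by apply: contraNneq ndo => <-.
  have [co|nco] := boolP (c o); last by have := all3 c bE nco.
  by have := all3 _ bE'; rewrite co => /(_ isT).
have h1 := matching_inner (k := 0) uE hE (inner_nempty hi).
have h2 := matching_outer (k := 0) uE hE (outer_nempty ho).
have b1E X : X \subset E -> matching_le X 1 -> #|X| <= 3.
  by move=> sX; apply: matching1_edges; [exact: uniformS uE | exact: subcubicS sE].
have := card_inner_outer uE alt; rewrite E10.
have [i1 | /(matching_inner (k := 1) uE hE) o1] := boolP (matching_le (inner E C) 1).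
  move=> sum10; apply: (sub7 _ (outer_sub E C) h1).
  by have := b1E _ (inner_sub E C) i1; move: sum10; clear; lia.
move=> sum10; apply: (sub7 _ (inner_sub E C) h2).
by have := b1E _ (outer_sub E C) o1; move: sum10; clear; lia.
Qed.

End Subcubic.

(** * Cross-intersecting graphs *)

Section CrossIntersecting.

Variable T : finType.
Implicit Types (E X Y : {set {set T}}) (e f : {set T}) (a b c d : T).

Definition cross X Y := forall e f, e \in X -> f \in Y -> ~~ [disjoint e & f].

Lemma card_sub4 (U : finType) (S : {set U}) (p q r s : U) :
  S \subset [set p; q; r; s] ->
  #|S| <= (p \in S) + (q \in S) + (r \in S) + (s \in S).
Proof.
move=> sS; rewrite (cardsD1 p S) (cardsD1 q (S :\ p)) (cardsD1 r (S :\ p :\ q)).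
rewrite (cardsD1 s (S :\ p :\ q :\ r)).
have -> : S :\ p :\ q :\ r :\ s = set0.
  apply/setP => x; rewrite !inE; have [xS|] := boolP (x \in S); rewrite ?andbF //.
  by have := subsetP sS _ xS; rewrite !inE; do 4!case: (_ == _).
rewrite cards0 !inE; do 4!case: (_ \in S); do ?case: (_ == _) => //=.
Qed.

Lemma meet_two_pairs a b c d e : #|e| = 2 ->
  a != c -> a != d -> b != c -> b != d ->
  ~~ [disjoint [set a; b] & e] -> ~~ [disjoint [set c; d] & e] ->
  e \in [set [set a; c]; [set b; d]; [set a; d]; [set b; c]].
Proof.
move=> e2 nac nad nbc nbd.
have eq2 x y : x != y -> x \in e -> y \in e -> e = [set x; y].
  move=> nxy xe ye; apply/esym/eqP; rewrite eqEcard cards2 nxy e2 andbT.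
  by apply/subsetP => z; rewrite !inE => /orP [] /eqP ->.
move=> /pred0Pn [x /= /andP [+ xe]] /pred0Pn [y /= /andP [+ ye]].
rewrite !inE => /orP [] /eqP ex /orP [] /eqP ey; rewrite {}ex in xe; rewrite {}ey in ye.
- by rewrite (eq2 _ _ nac xe ye) eqxx.
- by rewrite (eq2 _ _ nad xe ye) eqxx !orbT.
- by rewrite (eq2 _ _ nbc xe ye) eqxx !orbT.
- by rewrite (eq2 _ _ nbd xe ye) eqxx !orbT.
Qed.

Lemma disjoint_pairs a b c d : a != c -> a != d -> b != c -> b != d ->
  [disjoint [set a; b] & [set c; d]].
Proof.
move=> nac nad nbc nbd; apply/pred0P => z /=; rewrite !inE.
apply/negP => /andP [/orP [] /eqP ->]; by rewrite (negbTE nac, negbTE nbc) (negbTE nad, negbTE nbd).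
Qed.

Lemma crossC X Y : cross X Y -> cross Y X.
Proof. by move=> h e f eY fX; rewrite disjoint_sym h. Qed.

(** Both graphs live on the four points. The sides of the square account for 2 + 2 edges; a diagonal
    in one graph excludes the opposite diagonal from the other, which leaves at most two more. *)
Lemma cross_square X Y a b c d : uniform 2 X -> uniform 2 Y -> cross X Y ->
  a != b -> c != d -> a != c -> a != d -> b != c -> b != d ->
  [set a; b] \in X -> [set c; d] \in X -> [set a; c] \in Y -> [set b; d] \in Y ->
  #|X| + #|Y| <= 6.
Proof.
move=> uX uY cXY nab ncd nac nad nbc nbd abX cdX acY bdY.
have nba : b != a by rewrite eq_sym.
have ndc : d != c by rewrite eq_sym.
have nca : c != a by rewrite eq_sym.
have nda : d != a by rewrite eq_sym.
have ncb : c != b by rewrite eq_sym.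
have ndb : d != b by rewrite eq_sym.
have sX : X \subset [set [set a; b]; [set c; d]; [set a; d]; [set c; b]].
  apply/subsetP => e eX; apply: meet_two_pairs; rewrite ?uX //.
  - by rewrite disjoint_sym cXY.
  - by rewrite disjoint_sym cXY.
have sY : Y \subset [set [set a; c]; [set b; d]; [set a; d]; [set b; c]].
  by apply/subsetP => e eY; apply: meet_two_pairs; rewrite ?uY // cXY.
have := card_sub4 sX; have := card_sub4 sY.
have h1 : ~~ (([set a; d] \in X) && ([set b; c] \in Y)).
  by apply/negP => /andP [h1 h2]; have := cXY _ _ h1 h2; rewrite disjoint_pairs.
have h2 : ~~ (([set c; b] \in X) && ([set a; d] \in Y)).
  by apply/negP => /andP [h2 h3]; have := cXY _ _ h2 h3; rewrite disjoint_pairs.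
by move: h1 h2; do 8!case: (_ \in _) => //=; clear; lia.
Qed.

(** If [Y] also has two disjoint edges, [cross_square] applies. Otherwise [Y] consists of two edges
    {p, q} and {p, r}; an edge of [X] avoiding [p] can only be {q, r}, so [X] has at most 3 + 1
    edges. *)
Lemma cross_nonintersecting X Y a b c d : uniform 2 X -> uniform 2 Y -> subcubic X ->
  cross X Y -> 1 < #|Y| -> a != b -> c != d -> [disjoint [set a; b] & [set c; d]] ->
  [set a; b] \in X -> [set c; d] \in X -> #|X| + #|Y| <= 6.
Proof.
move=> uX uY sX cXY Y2 nab ncd /pred0P dis abX cdX.
have nac : a != c by apply: contraFneq (dis a) => /= ->; rewrite !inE eqxx ?orbT.
have nad : a != d by apply: contraFneq (dis a) => /= ->; rewrite !inE eqxx ?orbT.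
have nbc : b != c by apply: contraFneq (dis b) => /= ->; rewrite !inE eqxx ?orbT.
have nbd : b != d by apply: contraFneq (dis b) => /= ->; rewrite !inE eqxx ?orbT.
have [/andP [acY bdY] | n1] := boolP (([set a; c] \in Y) && ([set b; d] \in Y)).
  exact: (cross_square uX uY cXY nab ncd).
have [/andP [adY bcY] | n2] := boolP (([set a; d] \in Y) && ([set b; c] \in Y)).
  apply: (cross_square uX uY cXY nab _ nad nac nbd nbc) => //; first by rewrite eq_sym.
  by rewrite setUC.
have sY : Y \subset [set [set a; c]; [set b; d]; [set a; d]; [set b; c]].
  by apply/subsetP => e eY; apply: meet_two_pairs; rewrite ?uY // cXY.
have {}Y2 : #|Y| = 2.
  apply/eqP; rewrite eqn_leq Y2 andbT; apply: leq_trans (card_sub4 sY) _.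
  by move: n1 n2; do 4!case: (_ \in _).
suff : #|X| <= 4 by rewrite Y2; clear; lia.
have /eqP/cards2P [f [g [nfg Yfg]]] := Y2.
have fY : f \in Y by rewrite Yfg !inE eqxx.
have gY : g \in Y by rewrite Yfg !inE eqxx orbT.
have : ~~ [disjoint f & g].
  move: (subsetP sY _ fY) (subsetP sY _ gY) n1 n2 nfg (fY) (gY); rewrite !inE -!orbA.
  have in1 (x y z : T) : ~~ [disjoint [set x; y] & [set x; z]].
    by apply/pred0Pn; exists x; rewrite /= !inE eqxx.
  have in2 (x y z : T) : ~~ [disjoint [set y; x] & [set z; x]].
    by apply/pred0Pn; exists x; rewrite /= !inE eqxx !orbT.
  have in3 (x y z : T) : ~~ [disjoint [set x; y] & [set z; x]].
    by apply/pred0Pn; exists x; rewrite /= !inE eqxx !orbT.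
  have in4 (x y z : T) : ~~ [disjoint [set y; x] & [set x; z]].
    by apply/pred0Pn; exists x; rewrite /= !inE eqxx !orbT.
  by case/or4P => /eqP ->; case/or4P => /eqP -> h1 h2; rewrite ?eqxx // => _ k1 k2;
    rewrite ?in1 ?in2 ?in3 ?in4 //; move: h1 h2; rewrite k1 k2.
move=> /pred0Pn [p /= /andP [pf pg]].
have [q nqp ef] := edge_split uY fY pf; have [r nrp eg] := edge_split uY gY pg.
have nqr : q != r by apply: contraNneq nfg => qr; rewrite ef eg qr.
rewrite (card_edges_off X p) -[4]/(3 + 1); apply: leq_add; first exact: sX.
apply/card_le1_eqP.
have only e : e \in edges_off X p -> e = [set q; r].
  rewrite inE => /andP [eX pe].
  have qe : q \in e.
    have := cXY _ _ eX fY; rewrite ef => /pred0Pn [z /= /andP [ze]].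
    by rewrite !inE => /orP [] /eqP zE; rewrite zE in ze; rewrite ?ze in pe *.
  have re : r \in e.
    have := cXY _ _ eX gY; rewrite eg => /pred0Pn [z /= /andP [ze]].
    by rewrite !inE => /orP [] /eqP zE; rewrite zE in ze; rewrite ?ze in pe *.
  apply/esym/eqP; rewrite eqEcard cards2 nqr uX // andbT.
  by apply/subsetP => z; rewrite !inE => /orP [] /eqP ->.
by move=> e g0 /only -> /only ->.
Qed.

Lemma not_matching1 X : uniform 2 X -> ~~ matching_le X 1 ->
  exists a b c d, [/\ a != b, c != d, [disjoint [set a; b] & [set c; d]],
    [set a; b] \in X & [set c; d] \in X].
Proof.
move=> uX; rewrite negb_forall => /existsP [M].
rewrite negb_imply -ltnNge => /andP [/andP [sM tM] /card_gt1P [e [f [eM fM nef]]]].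
have /eqP/cards2P [a [b [nab ee]]] := uX _ (subsetP sM _ eM).
have /eqP/cards2P [c [d [ncd ef]]] := uX _ (subsetP sM _ fM).
exists a, b, c, d; split=> //; rewrite -?ee -?ef.
- exact: (trivIsetP tM).
- exact: (subsetP sM).
- exact: (subsetP sM).
Qed.

(** Two graphs without disjoint edges have 3 edges each at most. *)
Lemma cross_le6 X Y : uniform 2 X -> uniform 2 Y -> subcubic X -> subcubic Y ->
  cross X Y -> 1 < #|X| -> 1 < #|Y| -> #|X| + #|Y| <= 6.
Proof.
move=> uX uY sX sY cXY X2 Y2.
have [mX | /(not_matching1 uX) [a [b [c [d []]]]]] := boolP (matching_le X 1).
  have [mY | /(not_matching1 uY) [a [b [c [d []]]]]] := boolP (matching_le Y 1).
    exact: (leq_add (matching1_edges uX sX mX) (matching1_edges uY sY mY)).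
  rewrite addnC; exact: cross_nonintersecting uY uX sY (crossC cXY) X2.
exact: cross_nonintersecting uX uY sX cXY Y2.
Qed.

Lemma cross1_le X Y u w : cross X Y -> [set u; w] \in Y -> #|X| <= deg X u + deg X w.
Proof.
move=> cXY uwY; apply: leq_trans (leq_card_setU _ _).
apply/subset_leq_card/subsetP => e eX; rewrite !inE eX /=.
have /pred0Pn [z /= /andP [ze]] := cXY _ _ eX uwY.
by rewrite !inE => /orP [] /eqP <-; rewrite ze ?orbT.
Qed.

(** The value 7 needs a graph with a single edge, against which the other may have 3 edges at each
    of its two ends. *)
Lemma cross_le7 X Y : uniform 2 X -> uniform 2 Y -> subcubic X -> subcubic Y ->
  cross X Y -> 0 < #|X| -> 0 < #|Y| -> #|X| + #|Y| <= 7.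
Proof.
move=> uX uY sX sY cXY X1 Y1.
have one V W : uniform 2 W -> subcubic V -> cross V W -> #|W| = 1 -> #|V| <= 6.
  move=> uW sV cVW /eqP/cards1P [f ef].
  have fW : f \in W by rewrite ef inE.
  have /eqP/cards2P [u [w [_ fuw]]] := uW _ fW; rewrite fuw in fW.
  exact: leq_trans (cross1_le cVW fW) (leq_add (sV u) (sV w)).
have [Y2|Y2] := ltnP 1 #|Y|; last first.
  have {}Y1 : #|Y| = 1 by apply/eqP; rewrite eqn_leq Y2.
  by have := one X Y uY sX cXY Y1; rewrite Y1 addn1.
have [X2|X2] := ltnP 1 #|X|; first exact: leq_trans (cross_le6 _ _ _ _ cXY X2 Y2) _.
have {}X1 : #|X| = 1 by apply/eqP; rewrite eqn_leq X2.
by have := one Y X uX sY (crossC cXY) X1; rewrite X1 add1n.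
Qed.

End CrossIntersecting.

(** * Links and neighbourhoods of edges *)

Section SetOfThree.

Variable T : finType.
Implicit Types (A B : {set T}) (x y z : T).

Lemma set3C12 x y z : [set x; y; z] = [set y; x; z].
Proof. by rewrite (setUC [set x]). Qed.

Lemma set3C23 x y z : [set x; y; z] = [set x; z; y].
Proof. by rewrite -!setUA (setUC [set y]). Qed.

Lemma set3_rot x y z : [set x; y; z] = [set y; z; x].
Proof. by rewrite set3C12 set3C23. Qed.

Lemma cards3 x y z : x != y -> x != z -> y != z -> #|[set x; y; z]| = 3.
Proof.
move=> nxy nxz nyz; rewrite setUC cardsU1 cards2 nxy !inE negb_or.
by rewrite [z == x]eq_sym [z == y]eq_sym nxz nyz.
Qed.

Lemma set3P A x : #|A| = 3 -> x \in A ->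
  exists y z, [/\ x != y, x != z, y != z & A = [set x; y; z]].
Proof.
move=> A3 xA; have : #|A :\ x| == 2 by have := cardsD1 x A; rewrite xA A3 add1n => -[<-].
move=> /cards2P [y [z [nyz Ayz]]].
have : y \in A :\ x by rewrite Ayz !inE eqxx.
have : z \in A :\ x by rewrite Ayz !inE eqxx orbT.
rewrite !inE => /andP [nzx _] /andP [nyx _].
exists y, z; rewrite eq_sym nyx eq_sym nzx; split=> //.
by rewrite -setUA -(setD1K xA) Ayz.
Qed.

Lemma set3_eq A x y z : #|A| = 3 -> x != y -> x != z -> y != z ->
  x \in A -> y \in A -> z \in A -> A = [set x; y; z].
Proof.
move=> A3 nxy nxz nyz xA yA zA; apply/esym/eqP; rewrite eqEcard A3 cards3 // andbT.
by apply/subsetP => u; rewrite !inE => /orP [/orP [] | ] /eqP ->.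
Qed.

Lemma big_set3 (f : T -> nat) x y z : x != y -> x != z -> y != z ->
  \sum_(v in [set x; y; z]) f v = f x + f y + f z.
Proof.
move=> nxy nxz nyz; rewrite setUC big_setU1 ?big_setU1 ?big_set1 ?inE //=.
  by rewrite addnC.
by rewrite negb_or [z == x]eq_sym [z == y]eq_sym nxz.
Qed.

End SetOfThree.

(** Bounding the size of all sunflowers, instead of excluding size 4, lets this apply to collections
    of unknown size. *)
Definition sunflower_free3 (T : finType) (F : {set {set T}}) := forall (S : {set {set T}}) (C : {set T}),
  S \subset F -> (forall A B, A \in S -> B \in S -> A != B -> A :&: B = C) ->
  #|S| <= 3.

(** * Degrees, codegrees and private edges *)

Section Triples.

Variables (T : finType) (F : {set {set T}}).
Hypothesis uF : uniform 3 F.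
Hypothesis sF : sunflower_free3 F.
Implicit Types (A B C W : {set T}) (S M : {set {set T}}) (u v w x y z : T).

Definition star S v := [set B in S | v \in B].
Definition codeg u v := deg (star F u) v.
Definition link S v := [set B :\ v | B in star S v].
Definition hit A := [set B in F | ~~ [disjoint B & A]].
Definition priv v A := [set B in F | B :&: A == [set v]].
Definition meet2 A := [set B in F | #|B :&: A| == 2].

Lemma in_star S v B : (B \in star S v) = (B \in S) && (v \in B).
Proof. by rewrite inE. Qed.

Lemma link_inj S v : {in star S v &, injective (fun B => B :\ v)}.
Proof.
move=> B C; rewrite !inE => /andP [_ vB] /andP [_ vC] e.
by rewrite -(setD1K vB) e setD1K.
Qed.

Lemma card_link S v : #|link S v| = #|star S v|.
Proof. exact: card_in_imset (@link_inj S v). Qed.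

Lemma deg_link S v u : u != v -> deg (link S v) u = deg (star S v) u.
Proof.
move=> nuv; rewrite /deg.
have -> : [set e in link S v | u \in e] = (fun B => B :\ v) @: [set e in star S v | u \in e].
  apply/setP => e; rewrite inE; apply/andP/imsetP.
    case=> /imsetP [B BS ->]; rewrite !inE => /andP [_ uB].
    by exists B => //; rewrite inE BS.
  case=> B; rewrite inE => /andP [BS uB] ->; split; first by apply/imsetP; exists B.
  by rewrite !inE nuv.
rewrite card_in_imset // => B C /[1!inE] /andP [BS _] /[1!inE] /andP [CS _].
exact: link_inj BS CS.
Qed.

Lemma deg_link0 S v : deg (link S v) v = 0.
Proof.
apply/eqP; rewrite cards_eq0; apply/eqP/setP => e; rewrite !inE.
by apply/andP => -[/imsetP [B _ ->]]; rewrite !inE eqxx.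
Qed.

Lemma codegC u v : codeg u v = codeg v u.
Proof. by apply: eq_card => B; rewrite !inE andbAC. Qed.

(** The edges through [u] and [v] form a sunflower with core {u, v}. *)
Lemma codeg_le3 u v : u != v -> codeg u v <= 3.
Proof.
move=> nuv; apply: (sF (C := [set u; v])) => [|A B].
  by apply/subsetP => B; rewrite !inE -andbA => /andP [].
rewrite !inE => /andP [/andP [AF uA] vA] /andP [/andP [BF uB] vB] nAB.
apply/esym/eqP; rewrite eqEcard cards2 nuv; apply/andP; split.
  by apply/subsetP => z; rewrite !inE => /orP [] /eqP ->; rewrite ?uA ?vA ?uB ?vB.
rewrite leqNgt; apply: contraNN nAB => c3; apply/eqP.
have eA : A :&: B = A by apply/eqP; rewrite eqEcard subsetIl uF.
by apply/eqP; rewrite eqEcard !uF // andbT -eA subsetIr.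
Qed.

Lemma deg_star_codeg S v u : S \subset F -> deg (star S v) u <= codeg v u.
Proof.
move=> sSF; apply: degS; apply/subsetP => B; rewrite !inE.
by case/andP => /(subsetP sSF) -> ->.
Qed.

Lemma link_uniform S v : S \subset F -> uniform 2 (link S v).
Proof.
move=> sSF _ /imsetP [B /[!inE] /andP [/(subsetP sSF)/uF B3 vB] ->].
by have := cardsD1 v B; rewrite B3 vB add1n => -[<-].
Qed.

Lemma link_subcubic S v : S \subset F -> subcubic (link S v).
Proof.
move=> sSF u; have [->|nuv] := eqVneq u v; first by rewrite deg_link0.
rewrite deg_link //; apply: leq_trans (deg_star_codeg _ _ sSF) _.
by rewrite codeg_le3 // eq_sym.
Qed.

Lemma mem_link S v B : B \in S -> v \in B -> B :\ v \in link S v.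
Proof. by move=> BS vB; apply/imsetP; exists B; rewrite // inE BS. Qed.

(** Disjoint pairs of the link, extended by [v], form a sunflower with core {v}. *)
Lemma link_matching S v : S \subset F -> matching_le (link S v) 3.
Proof.
move=> sSF; apply/matching_leP => M sM /trivIsetP tM.
have fM e : e \in M -> v \notin e /\ v |: e \in F.
  move=> /(subsetP sM)/imsetP [B /[!inE] /andP [/(subsetP sSF) BF vB] ->].
  by rewrite setD1K // !inE eqxx.
have inj : {in M &, injective (fun e => v |: e)}.
  move=> e f /fM [ve _] /fM [vf _] h.
  by rewrite -(setU1K ve) h setU1K.
rewrite -(card_in_imset inj); apply: (sF (C := [set v])) => [|A B].
  by apply/subsetP => _ /imsetP [e /fM [_ ?] ->].
move=> /imsetP [e eM ->] /imsetP [f fM' ->] nef.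
have /pred0P dis : [disjoint e & f].
  by apply: tM => //; apply: contraNneq nef => ->.
apply/setP => z; rewrite !inE; have [->|nzv] //= := eqVneq z v.
exact: (dis z).
Qed.

Lemma deg_le10 v : deg F v <= 10.
Proof.
rewrite -[deg F v]/#|star F v| -card_link.
by apply: matching3_edges; [apply: link_uniform|apply: link_subcubic|apply: link_matching].
Qed.

Lemma privP v A B : B \in priv v A -> [/\ B \in F, v \in B, v \in A &
  forall u, u != v -> u \in A -> u \notin B].
Proof.
rewrite inE => /andP [BF /eqP e].
have /setIP [vB vA] : v \in B :&: A by rewrite e inE.
split=> // u nuv uA; apply: contra nuv => uB.
have : u \in B :&: A by rewrite inE uB uA.
by rewrite e inE.
Qed.

Lemma mem_priv v A B : B \in F -> v \in B -> v \in A ->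
  (forall u, u != v -> u \in A -> u \notin B) -> B \in priv v A.
Proof.
move=> BF vB vA h; rewrite inE BF; apply/eqP/setP => u; rewrite !inE.
have [->|nuv] := eqVneq u v; first by rewrite vB vA.
by apply/andP => -[uB uA]; move: (h u nuv uA); rewrite uB.
Qed.

Lemma priv_sub v A : priv v A \subset F.
Proof. by apply/subsetP => B; rewrite inE => /andP []. Qed.

Lemma star_priv v A : star (priv v A) v = priv v A.
Proof.
apply/setP => B; rewrite inE; apply: andb_idr => /privP [_ vB _ _]; exact: vB.
Qed.

Lemma priv_matching v A : A \in F -> v \in A -> matching_le (link (priv v A) v) 2.
Proof.
move=> AF vA; apply/matching_leP => M sM tM.
have sM' : A :\ v |: M \subset link F v.
  rewrite subUset sub1set mem_link //=; apply: subset_trans sM _.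
  by apply: imsetS; apply/subsetP => B; rewrite !inE => /andP [/andP [-> _] ->].
have dis : [disjoint A :\ v & cover M].
  apply/pred0P => z /=; apply/negP => /andP [/[!inE] /andP [nzv zA]].
  move=> /bigcupP [_ /(subsetP sM)/imsetP [B + ->]].
  rewrite inE => /andP [/[1!inE] /andP [_ /eqP eB] _]; rewrite !inE => /andP [_ zB].
  have : z \in B :&: A by rewrite inE zB zA.
  by rewrite eB inE (negbTE nzv).
have nM : A :\ v \notin M.
  have [y [z [nvy nvz nyz eA]]] := set3P (uF AF) vA.
  have yA : y \in A :\ v by rewrite !inE eq_sym nvy eA !inE eqxx orbT.
  apply: (notin_cover (x := y)) => //.
  by apply/negP => yM; have /pred0P/(_ y)/= := dis; rewrite yA yM.
have /matching_leP/(_ _ sM') := link_matching v (subxx F).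
by rewrite cardsU1 nM; apply; exact: trivIset_add.
Qed.

Lemma priv_le7 v A : A \in F -> v \in A -> #|priv v A| <= 7.
Proof.
move=> AF vA; rewrite -(star_priv v A) -card_link.
have sP := priv_sub v A.
exact: (proj1 (matching2_edges (link_uniform (v := v) sP) (link_subcubic v sP) (priv_matching AF vA))).
Qed.

(** Away from [v], degrees in the link and in [priv v A] agree, so the shape of the extremal 7-edge
    graph carries over; positive degree says that a vertex belongs to that graph. *)
Lemma priv7_structure v A : A \in F -> v \in A -> #|priv v A| = 7 ->
  [/\ forall u, u != v -> 0 < deg (priv v A) u -> 1 < deg (priv v A) u,
      exists o, [/\ o != v, deg (priv v A) o = 2 &
        forall u, u != v -> 0 < deg (priv v A) u -> u != o -> deg (priv v A) u = 3] &
      exists2 V : {set T}, #|V| = 5 & forall B, B \in priv v A -> B \subset v |: V].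
Proof.
move=> AF vA P7; have sP := priv_sub v A.
have uL := link_uniform (v := v) sP; have sL := link_subcubic v sP.
have L7 : #|link (priv v A) v| = 7 by rewrite card_link star_priv.
have cV := proj2 (matching2_edges uL sL (priv_matching AF vA)) L7.
have [ge2 [o [oL dgo d3]]] := seven_edges_degrees uL sL L7 cV.
have dE u : u != v -> deg (link (priv v A) v) u = deg (priv v A) u.
  by move=> nuv; rewrite deg_link // star_priv.
have nov : o != v by apply: contraTneq oL => ->; rewrite -deg_cover deg_link0.
split.
- by move=> u nuv; rewrite -!dE // deg_cover; exact: ge2.
- exists o; split=> //; first by rewrite -dE.
  by move=> u nuv; rewrite -!dE // deg_cover; exact: d3.
exists (cover (link (priv v A) v)) => // B BP.
have [_ vB _ _] := privP BP.
rewrite -(setD1K vB); apply: setUS; apply: (bigcup_sup (B :\ v)) => //.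
exact: mem_link.
Qed.

(** Edges are sorted by the size of their intersection with [A]; size 3 occurs only for [A]. With
    private families of at most 7 edges and degrees at most 10, the two equations give the bounds 22
    + p and 28 - p. *)
Lemma card_hit A : A \in F ->
  #|hit A| = 1 + #|meet2 A| + \sum_(v in A) #|priv v A| /\
  \sum_(v in A) deg F v = 3 + 2 * #|meet2 A| + \sum_(v in A) #|priv v A|.
Proof.
move=> AF.
have e3 : #|[set B in F | #|B :&: A| == 3]| = 1.
  rewrite (_ : [set B in F | #|B :&: A| == 3] = [set A]) ?cards1 //.
  apply/setP => B; rewrite !inE; apply/andP/eqP => [[BF /eqP c3] | ->].
    have eB : B :&: A = B by apply/eqP; rewrite eqEcard subsetIl uF // c3.
    by apply/eqP; rewrite eqEcard !uF // andbT -eB subsetIr.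
  by rewrite setIid uF.
have e1 : \sum_(v in A) #|priv v A| = #|[set B in F | #|B :&: A| == 1]|.
  transitivity (\sum_(v in A) \sum_(B in F) (B :&: A == [set v] : nat)).
    apply: eq_bigr => v _; rewrite -sum1_card big_mkcond [RHS]big_mkcond /=.
    by apply: eq_bigr => B _; rewrite !inE; case: (B \in F); case: (_ == _).
  rewrite exchange_big -sum1_card big_mkcond [RHS]big_mkcond /=.
  apply: eq_bigr => B _; rewrite inE; case: (B \in F) => //=.
  have [/cards1P [x ex] | n1] := boolP (#|B :&: A| == 1).
    have /setIP [_ xA] : x \in B :&: A by rewrite ex inE.
    rewrite (bigD1 x xA) /= ex eqxx big1 // => y /andP [_ nyx].
    by rewrite (inj_eq set1_inj) eq_sym (negbTE nyx).
  by apply: big1 => x _; case: eqP => // ex; move: n1; rewrite ex cards1.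
have cardS (p : pred {set T}) : #|[set B in F | p B]| = \sum_(B in F) (p B : nat).
  rewrite -sum1_card big_mkcond [RHS]big_mkcond /=.
  by apply: eq_bigr => B _; rewrite inE; case: (B \in F); case: (p B).
have le3 B : B \in F -> #|B :&: A| <= 3.
  by move=> BF; rewrite -(uF BF) subset_leq_card // subsetIl.
rewrite e1 -{1}e3; split.
  rewrite /hit /meet2 !cardS -!big_split /=; apply: eq_bigr => B BF.
  by rewrite -setI_eq0 -cards_eq0; move: (le3 _ BF); case: #|_| => [|[|[|[|]]]].
have -> : 3 = 3 * #|[set B in F | #|B :&: A| == 3]| by rewrite e3.
rewrite sum_deg /meet2 !cardS !big_distrr -!big_split /=.
by apply: eq_bigr => B BF; move: (le3 _ BF); case: #|_| => [|[|[|[|]]]].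
Qed.

(** The two codegrees both count the edge {x, y, z}, whence the successor. *)
Lemma deg_codeg x y z : x != y -> x != z -> y != z -> [set x; y; z] \in F ->
  (deg F x).+1 = codeg x y + codeg x z + #|priv x [set x; y; z]|.
Proof.
move=> nxy nxz nyz AF; rewrite -[deg F x]/#|star F x|.
rewrite (card_edges_off (star F x) y) (card_edges_off (edges_off (star F x) y) z).
have -> : edges_off (edges_off (star F x) y) z = priv x [set x; y; z].
  apply/setP => B; apply/idP/idP.
    do 3!(rewrite inE => /andP []); move=> BF xB yB zB; rewrite inE BF; apply/eqP/setP => u; rewrite !inE.
    have [->|nux] := eqVneq u x; first by rewrite xB.
    have [->|nuy] := eqVneq u y; first by rewrite (negbTE yB).
    by have [->|nuz] := eqVneq u z; rewrite ?(negbTE zB) // andbF.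
  move=> /privP [BF xB _ h]; rewrite !inE BF xB !h ?inE ?eqxx ?orbT //.
    by rewrite eq_sym.
  by rewrite eq_sym.
suff -> : codeg x z = (deg (edges_off (star F x) y) z).+1.
  by rewrite -[deg (star F x) y]/(codeg x y) addnS addSn addnA.
rewrite /codeg (_ : deg _ z = #|star (star F x) z|) //.
rewrite (card_edges_off (star (star F x) z) y) -add1n; congr addn.
  apply/eqP/cards1P; exists [set x; y; z]; apply/setP => B; rewrite !inE.
  apply/andP/eqP => [[/andP [/andP [BF xB] zB] yB] | ->].
    by apply: set3_eq => //; exact: uF.
  by rewrite AF !inE !eqxx !orbT.
by apply: eq_card => B; rewrite !inE -!andbA; congr andb; congr andb; rewrite andbC.
Qed.

End Triples.

(** * The number of edges meeting a given edge *)

Section Local.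

Variables (T : finType) (F : {set {set T}}).
Hypothesis uF : uniform 3 F.
Hypothesis sF : sunflower_free3 F.
Implicit Types (A B C D W : {set T}) (S M I : {set {set T}}) (u v w x y z o : T).

Notation d := (deg F).
Notation cd := (codeg F).
Notation N A := #|hit F A|.
Notation h v A := #|priv F v A|.

Lemma neq_sym (U : eqType) (a b : U) : a != b -> b != a.
Proof. by rewrite eq_sym. Qed.

Lemma codeg_gt0 u v A : A \in F -> u \in A -> v \in A -> 0 < cd u v.
Proof. by move=> AF uA vA; apply/card_gt0P; exists A; rewrite !inE AF uA. Qed.

(** All local information at an edge as one linear system, so that later case distinctions are
    linear arithmetic. Here [p] counts the edges meeting [A] in two points; each of the three
    codegrees also counts [A]. *)
Lemma triple_count x y z : x != y -> x != z -> y != z -> [set x; y; z] \in F ->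
  let A := [set x; y; z] in
  exists p, (((((p + 3 = cd x y + cd x z + cd y z)
    /\ (N A = (p + (h x A + h y A + h z A)).+1))
    /\ ((d x).+1 = cd x y + cd x z + h x A)
    /\ ((d y).+1 = cd x y + cd y z + h y A)
    /\ ((d z).+1 = cd x z + cd y z + h z A))
    /\ ((d x <= 10) /\ (d y <= 10) /\ (d z <= 10)))
    /\ ((h x A <= 7) /\ (h y A <= 7) /\ (h z A <= 7)))
    /\ ((0 < cd x y <= 3) /\ (0 < cd x z <= 3) /\ (0 < cd y z <= 3)).
Proof.
move=> nxy nxz nyz AF A; have xA : x \in A by rewrite !inE eqxx.
have yA : y \in A by rewrite !inE eqxx orbT.
have zA : z \in A by rewrite !inE eqxx orbT.
have [cN cD] := card_hit uF AF; rewrite !big_set3 // in cN cD.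
have dx := deg_codeg uF nxy nxz nyz AF.
have dy : (d y).+1 = cd x y + cd y z + h y A.
  rewrite /A set3C12 (codegC F x).
  by apply: (deg_codeg uF (neq_sym nxy) nyz nxz); rewrite set3C12.
have dz : (d z).+1 = cd x z + cd y z + h z A.
  rewrite /A -set3_rot (codegC F x) (codegC F y).
  by apply: (deg_codeg uF (neq_sym nxz) (neq_sym nyz) nxy); rewrite set3_rot.
rewrite -/A in cN cD dx.
exists #|meet2 F A|; rewrite !deg_le10 // !priv_le7 // !codeg_le3 //.
rewrite !(codeg_gt0 AF) //; repeat split=> //.
  by move: cD dx dy dz; clear; lia.
Qed.

Lemma edge3P A : A \in F -> exists x y z, [/\ x != y, x != z, y != z & A = [set x; y; z]].
Proof.
move=> AF; have /card_gt0P [x xA] : 0 < #|A| by rewrite uF.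
by have [y [z [? ? ? ?]]] := set3P (uF AF) xA; exists x, y, z.
Qed.

Lemma hit_le25 A : A \in F -> N A <= 25.
Proof.
move=> AF; have [x [y [z [nxy nxz nyz eA]]]] := edge3P AF; rewrite eA in AF *.
by have [p] := triple_count nxy nxz nyz AF; clear; lia.
Qed.

(** The bounds 22 + p and 28 - p allow 25 only at p = 3, where the first is attained. *)
Lemma hit25 x y z : x != y -> x != z -> y != z -> [set x; y; z] \in F ->
  let A := [set x; y; z] in N A = 25 ->
  cd x y + cd x z + cd y z = 6 /\ [/\ h x A = 7, h y A = 7 & h z A = 7].
Proof.
move=> nxy nxz nyz AF A NA.
have [p] := triple_count nxy nxz nyz AF; rewrite -/A NA; clear => cnt.
by split; [|split]; lia.
Qed.

Lemma deg_priv_codeg v A u : deg (priv F v A) u <= cd v u.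
Proof. by rewrite -star_priv; apply: deg_star_codeg; exact: priv_sub. Qed.

Lemma deg_priv_gt0 v A C u : C \in priv F v A -> u \in C -> 0 < deg (priv F v A) u.
Proof. by move=> CP uC; apply/card_gt0P; exists C; rewrite inE CP. Qed.

Lemma meet1_priv v A C : C \in F -> C :&: A = [set v] -> C \in priv F v A.
Proof. by move=> CF e; rewrite inE CF e eqxx. Qed.

(** The pair {u, w} lies in the 7-edge graph at [v] in [B], so at least one of [cd v u], [cd v w] is
    3 and the other is at least 2. As the codegrees of [C] sum to 6 and [cd u w] is positive, they
    are 3, 2 and 1. *)
Lemma hit25_pattern B v u w : v != u -> v != w -> u != w ->
  let C := [set v; u; w] in
  B \in F -> C \in F -> N B = 25 -> N C = 25 -> C :&: B = [set v] ->
  [/\ 1 < cd v u, 1 < cd v w & cd u w = 1].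
Proof.
move=> nvu nvw nuw C BF CF NB NC eCB.
have vB : v \in B by have /setIP [] : v \in C :&: B by rewrite eCB inE.
have [y [z [nvy nvz nyz eB]]] := set3P (uF BF) vB.
have [_ [hv _ _]] := hit25 nvy nvz nyz (eq_ind _ (fun B => B \in F) BF _ eB)
  (eq_ind _ (fun B => N B = 25) NB _ eB).
rewrite -eB in hv; have CP := meet1_priv CF eCB.
have [ge2 [o [nov _ d3]] _] := priv7_structure uF sF BF vB hv.
have nuv : u != v by rewrite eq_sym.
have nwv : w != v by rewrite eq_sym.
have uP : 0 < deg (priv F v B) u by apply: (deg_priv_gt0 CP); rewrite !inE eqxx orbT.
have wP : 0 < deg (priv F v B) w by apply: (deg_priv_gt0 CP); rewrite !inE eqxx orbT.
have := ge2 u nuv uP; have := ge2 w nwv wP; have := d3 u nuv uP; have := d3 w nwv wP.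
have := deg_priv_codeg v B u; have := deg_priv_codeg v B w.
have [sum _] := hit25 nvu nvw nuw CF NC.
have : 0 < cd u w by apply: (codeg_gt0 CF); rewrite !inE eqxx ?orbT.
have nuwo : (u != o) || (w != o) by have [<-|] := eqVneq u o; rewrite //= eq_sym.
move: sum nuwo; case: (u != o); case: (w != o) => //= sum _ cuw lw lu.
- by move=> /(_ isT) e1 /(_ isT) e2; move: sum cuw lw lu e1 e2; clear => *; exfalso; lia.
- by move=> _ /(_ isT) e2 g1 g2; move: sum cuw lw lu e2 g1 g2; clear => *; split; lia.
- by move=> /(_ isT) e2 _ g1 g2; move: sum cuw lw lu e2 g1 g2; clear => *; split; lia.
Qed.

Definition intersecting I := forall A B, A \in I -> B \in I -> ~~ [disjoint A & B].

(* An edge C that meets another edge of I exactly in v is {v, o, b} with      *)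
(* codegrees (2, 3, 1), the pair {o, b} having codegree 1. So v depends only  *)
(* on C, and at most two edges of I meet C in one vertex.                     *)
Lemma intersecting_hit25 I : I \subset F -> intersecting I ->
  (forall A, A \in I -> N A = 25) -> #|I| <= 6.
Proof.
move=> /subsetP sIF iI N25.
have [->|/set0Pn [C CI]] := eqVneq I set0; first by rewrite cards0.
have CF := sIF _ CI.
pose one := [set B in I | #|B :&: C| == 1].
(* If m edges meet [C] twice, N = 25 makes the degree sum 27 + m. *)
have m3 : #|meet2 F C| <= 3.
  have [cN cD] := card_hit uF CF; rewrite N25 // in cN.
  have : \sum_(v in C) d v <= 30.
    apply: (@leq_trans (\sum_(v in C) 10)); last by rewrite sum_nat_const uF.
    by apply: leq_sum => v _; exact: deg_le10.
  by move: cN cD; clear; lia.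
have sub : I \subset C |: (meet2 F C :|: one).
  apply/subsetP => B BI; rewrite !inE BI sIF //=.
  have le3 : #|B :&: C| <= 3 by rewrite -(uF CF) subset_leq_card // subsetIr.
  have := iI _ _ BI CI; rewrite -setI_eq0 -cards_eq0 => g0.
  have [//|nBC] /= := eqVneq B C.
  suff : #|B :&: C| != 3 by move: le3 g0; case: #|_| => [|[|[|[|]]]].
  apply: contraNneq nBC => c3.
  have e1 : B :&: C = C by apply/eqP; rewrite eqEcard subsetIr uF // c3.
  have e2 : B :&: C = B by apply/eqP; rewrite eqEcard subsetIl (uF (sIF _ BI)) c3.
  by rewrite -e2 e1.
apply: leq_trans (subset_leq_card sub) _; rewrite -[6]/(1 + (3 + 2)).
apply: leq_trans (leq_card_setU _ _) _; rewrite cards1 leq_add2l.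
apply: leq_trans (leq_card_setU _ _) _; apply: leq_add m3 _.
have [->|/set0Pn [B0]] := eqVneq one set0; first by rewrite cards0.
rewrite inE => /andP [B0I /cards1P [v eB0]].
have vC : v \in C by have /setIP [] : v \in B0 :&: C by rewrite eB0 inE.
have [u [w [nvu nvw nuw eC]]] := set3P (uF CF) vC.
have pat B x y z : B \in I -> x != y -> x != z -> y != z -> C = [set x; y; z] ->
    B :&: C = [set x] -> [/\ 1 < cd x y, 1 < cd x z & cd y z = 1].
  move=> BI nxy nxz nyz eC' eBC; apply: (hit25_pattern (B := B)) => //.
  - exact: sIF.
  - by rewrite -eC'.
  - exact: N25.
  - by rewrite -eC' N25.
  - by rewrite -eC' setIC.
have [cvu cvw cuw] := pat _ _ _ _ B0I nvu nvw nuw eC eB0.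
have same B : B \in one -> B :&: C = [set v].
  rewrite inE => /andP [BI /cards1P [x eB]].
  have xC : x \in C by have /setIP [] : x \in B :&: C by rewrite eB inE.
  have : x \in [set v; u; w] by rewrite -eC.
  rewrite !inE => /orP [/orP [] | ] /eqP ex; rewrite ex in eB.
  - by [].
  - have eC' : C = [set u; v; w] by rewrite eC set3C12.
    have [_ _ c1] := pat _ _ _ _ BI (neq_sym nvu) nuw nvw eC' eB.
    by rewrite c1 in cvw.
  - have eC' : C = [set w; v; u] by rewrite eC -set3_rot.
    have [_ _ c1] := pat _ _ _ _ BI (neq_sym nvw) (neq_sym nuw) nvu eC' eB.
    by rewrite c1 in cvu.
have [_ [hv _ _]] := hit25 nvu nvw nuw (eq_ind _ (fun B => B \in F) CF _ eC)
  (eq_ind _ (fun B => N B = 25) (N25 _ CI) _ eC).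
rewrite -eC in hv.
have [_ [o [nov do2 d3]] _] := priv7_structure uF sF CF vC hv.
rewrite -do2; apply/subset_leq_card/subsetP => B Bone.
have eB := same _ Bone; move: Bone; rewrite inE => /andP [BI _].
have BF := sIF _ BI; have BP := meet1_priv BF eB; rewrite inE BP /=.
have vB : v \in B by have /setIP [] : v \in B :&: C by rewrite eB inE.
have [x [y [nvx nvy nxy eBv]]] := set3P (uF BF) vB.
have xB : x \in B by rewrite eBv !inE eqxx orbT.
have yB : y \in B by rewrite eBv !inE eqxx orbT.
have [sum _] := hit25 nvx nvy nxy (eq_ind _ (fun B => B \in F) BF _ eBv)
  (eq_ind _ (fun B => N B = 25) (N25 _ BI) _ eBv).
(* If [B] avoided [o], both its other vertices would have codegree 3 with [v], and the codegree sum
   would be at least 7. So only the two edges of [priv F v C] at [o] remain. *)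
apply/negPn/negP => oB.
have nxo : x != o by apply: contraNneq oB => <-.
have nyo : y != o by apply: contraNneq oB => <-.
have nxv : x != v by rewrite eq_sym.
have nyv : y != v by rewrite eq_sym.
have := d3 x nxv (deg_priv_gt0 BP xB) nxo; have := d3 y nyv (deg_priv_gt0 BP yB) nyo.
have := deg_priv_codeg v C x; have := deg_priv_codeg v C y.
by have := codeg_gt0 BF xB yB; move: sum; clear; lia.
Qed.

End Local.

(** * Intersecting families without a common vertex *)

(* Cardinals of the same set may carry different, convertible instances. *)
Ltac card_lia := clear; try unfold reverse_coercion; lia.

(** With [W] the union of two members of a disjoint triple, this is the intersecting family counted
    by n_i. *)
Definition off (T : finType) (F : {set {set T}}) (W : {set T}) : {set {set T}} :=
  [set B in F | [disjoint B & W]].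

Section NonStar.

Variables (T : finType) (F : {set {set T}}) (W : {set T}).
Hypothesis uF : uniform 3 F.
Hypothesis sF : sunflower_free3 F.
Implicit Types (A B C D : {set T}) (S M : {set {set T}}) (u v w x y z o t s : T).

Notation d := (deg F).
Notation cd := (codeg F).
Notation N A := #|hit F A|.
Notation h v A := #|priv F v A|.

Notation I := (off F W).
Notation cI := (codeg I).

Hypothesis iI : intersecting I.

Let IF A : A \in I -> A \in F.
Proof. by rewrite inE => /andP []. Qed.

Let sIF : I \subset F.
Proof. by apply/subsetP. Qed.

(** If p edges meet [A] twice, 24 <= N <= 28 - p gives p <= 4, so the codegree sum p + 3 is at most
    7 and N - 1 - p at least 19. At p = 4 the bound 28 - p is attained, which makes all degrees
    10. *)
Lemma hit24 x y z : x != y -> x != z -> y != z -> [set x; y; z] \in F ->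
  let A := [set x; y; z] in 23 < N A ->
  [/\ cd x y + cd x z + cd y z <= 7, 18 < h x A + h y A + h z A &
     cd x y + cd x z + cd y z = 7 -> [/\ d x = 10, d y = 10 & d z = 10]].
Proof.
move=> nxy nxz nyz AF A.
have [p] := triple_count uF sF nxy nxz nyz AF; rewrite -/A; clear => cnt NA.
by split; [lia | lia | move=> c7; split; lia].
Qed.

(** Three private families of at most 6 edges would have only 18 in all. *)
Lemma hit24_max A : A \in F -> 23 < N A -> exists2 v, v \in A & h v A = 7.
Proof.
move=> AF NA; have [x [y [z [nxy nxz nyz eA]]]] := edge3P uF AF.
rewrite eA in AF NA *; have [_ h19 _] := hit24 nxy nxz nyz AF NA.
have xA : x \in [set x; y; z] by rewrite !inE eqxx.
have yA : y \in [set x; y; z] by rewrite !inE eqxx orbT.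
have zA : z \in [set x; y; z] by rewrite !inE eqxx orbT.
have hx := priv_le7 uF sF AF xA; have hy := priv_le7 uF sF AF yA.
have hz := priv_le7 uF sF AF zA.
have [ex|nx] := eqVneq (h x [set x; y; z]) 7; first by exists x.
have [ey|ny] := eqVneq (h y [set x; y; z]) 7; first by exists y.
exists z => //; move: h19 hx hy hz nx ny; clear; lia.
Qed.

(** Excluding [y] makes [side x y] and [side y x] cross-intersecting: a member through [x] only and
    one through [y] only must meet elsewhere. *)
Definition side x y := link (edges_off I y) x.

Lemma side_sub y : edges_off I y \subset F.
Proof. exact: subset_trans (edges_off_sub I y) sIF. Qed.

Lemma sideP x y e : reflect (exists2 B, B \in I & [/\ x \in B, y \notin B & e = B :\ x])
  (e \in side x y).
Proof.
apply: (iffP imsetP) => [[B + ->] | [B BI [xB yB ->]]].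
  by rewrite !inE => /andP [/andP [? ?] ?]; exists B; rewrite // inE.
by exists B => //; rewrite !inE -/I in BI *; rewrite BI yB xB.
Qed.

Lemma side_uniform x y : uniform 2 (side x y).
Proof. exact: link_uniform (side_sub y). Qed.

Lemma side_subcubic x y : subcubic (side x y).
Proof. exact: link_subcubic (side_sub y). Qed.

Lemma pair_count x y : x != y ->
  #|I| = cI x y + #|side x y| + #|side y x| + #|edges_off (edges_off I x) y|.
Proof.
move=> nxy; rewrite !card_link (card_edges_off I x) (card_edges_off (edges_off I x) y).
rewrite -[deg I x]/#|star I x| (card_edges_off (star I x) y) -[deg (star I x) y]/(cI x y).
rewrite -[deg (edges_off I x) y]/#|star (edges_off I x) y|.
have -> : #|edges_off (star I x) y| = #|star (edges_off I y) x|.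
  by apply: eq_card => B; rewrite !inE -!andbA; do 2!congr andb; rewrite andbC.
by rewrite !addnA.
Qed.

Lemma side_cross x y : x != y -> cross (side x y) (side y x).
Proof.
move=> nxy _ _ /sideP [B BI [xB yB ->]] /sideP [C CI [yC xC ->]].
have /pred0Pn [z /= /andP [zB zC]] := iI BI CI.
apply/pred0Pn; exists z; rewrite /= !inE zB zC !andbT.
by apply/andP; split; [apply: contraNneq xC => <- | apply: contraNneq yB => <-].
Qed.

Lemma deg_side_le x y z : z != x -> deg (side x y) z <= cI x z.
Proof.
move=> nzx; rewrite deg_link //; apply: degS; apply/subsetP => B.
by rewrite !inE => /andP [/andP [-> _] ->].
Qed.

Lemma deg_side_lt x y z : z != x -> z != y -> [set x; y; z] \in I ->
  deg (side x y) z < cI x z.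
Proof.
move=> nzx nzy BI; rewrite deg_link //; apply: proper_card; apply/properP; split.
  by apply/subsetP => B; rewrite !inE => /andP [/andP [/andP [-> _] ->] ->].
exists [set x; y; z]; first by rewrite inE inE BI !inE !eqxx !orbT.
by rewrite inE inE inE !inE eqxx !orbT /= !andbF.
Qed.

Lemma codegI_le x y : cI x y <= cd x y.
Proof.
apply: degS; apply/subsetP => B; rewrite !inE => /andP [/andP [-> _] ->] //.
Qed.

Lemma codegI_lt x y B : B \in F -> B \notin I -> x \in B -> y \in B -> cI x y < cd x y.
Proof.
move=> BF BI xB yB; apply: proper_card; apply/properP; split.
  by apply/subsetP => C; rewrite !inE => /andP [/andP [/andP [-> _] ->] ->].
exists B; first by rewrite !inE BF xB yB.
by rewrite inE inE (negbTE BI).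
Qed.

Lemma star2_uniq x v z B C : x != v -> x != z -> v != z ->
  B \in I -> C \in I -> x \in B -> v \in B -> z \in B ->
  x \in C -> v \in C -> z \in C -> B = C.
Proof.
move=> nxv nxz nvz BI CI xB vB zB xC vC zC.
rewrite (set3_eq (uF (IF BI)) nxv nxz nvz) //.
by rewrite -(set3_eq (uF (IF CI)) nxv nxz nvz).
Qed.

(** * Nine members through a vertex, three for each vertex of a member *)

Section Triangle.

Variables (x : T) (D : {set T}).
Hypothesis I10 : #|I| = 10.
Hypothesis N24 : forall A, A \in I -> 23 < N A.
Hypothesis DI : D \in I.
Hypothesis xD : x \notin D.
Hypothesis D3 : forall v, v \in D -> cI x v = 3.
Hypothesis D1 : forall B, B \in I -> x \in B -> #|B :&: D| = 1.

Let D1' B u v : B \in I -> x \in B -> u \in B -> v \in B -> u \in D -> v \in D -> u = v.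
Proof.
move=> BI xB uB vB uD vD; have /eqP/cards1P [z ez] := D1 BI xB.
have uz : u \in B :&: D by rewrite inE uB.
have vz : v \in B :&: D by rewrite inE vB.
by move: uz vz; rewrite ez !inE => /eqP -> /eqP ->.
Qed.

(** Each further vertex lies on at most one of the three members through [x] and [v], so one of them
    avoids any two given vertices. *)
Lemma pick_edge v z1 z2 : v \in D -> z1 != x -> z1 != v -> z2 != x -> z2 != v ->
  exists B, [/\ B \in I, x \in B, v \in B, z1 \notin B & z2 \notin B].
Proof.
move=> vD n1x n1v n2x n2v; have nxv : x != v by apply: contraNneq xD => ->.
pose S := star (star I x) v.
have S3 : #|S| = 3 by exact: D3.
have le1 z : z != x -> z != v -> #|star S z| <= 1.
  move=> nzx nzv; apply/card_le1_eqP => B C.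
  rewrite /S !in_star => /andP [/andP [/andP [BI xB] vB] zB].
  move=> /andP [/andP [/andP [CI xC] vC] zC].
  by apply: (star2_uniq nxv (neq_sym nzx) (neq_sym nzv)).
have : 0 < #|edges_off (edges_off S z1) z2|.
  have := le1 _ n1x n1v; have := le1 _ n2x n2v.
  have := card_edges_off S z1; have := card_edges_off (edges_off S z1) z2.
  have := degS z2 (edges_off_sub S z1).
  rewrite S3 -[deg S z2]/#|star S z2| -[deg S z1]/#|star S z1|; clear; lia.
move=> /card_gt0P [B]; rewrite !in_edges_off /S !in_star.
by move=> /andP [/andP [/andP [/andP [? ?] ?] ?] ?]; exists B.
Qed.

(* A vertex of D that lies on 7 edges private to it forces d x = 10; the      *)
(* tenth edge at x is outside I and completes a sunflower with core {x}.      *)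
Lemma triangle_absurd : False.
Proof.
have DF := IF DI.
have [v vD hv] := hit24_max DF (N24 DI).
have nxv : x != v by apply: contraNneq xD => ->.
have nvx := neq_sym nxv.
have [_ [o [nov dgo d3]] _] := priv7_structure uF sF DF vD hv.
have privI B : B \in I -> x \in B -> v \in B -> B \in priv F v D.
  move=> BI xB vB; apply: mem_priv => //; first exact: IF.
  by move=> u nuv uD; apply: contra nuv => uB; rewrite (D1' BI xB uB vB uD vD).
have px : deg (priv F v D) x = 3.
  apply/eqP; rewrite eqn_leq; apply/andP; split.
    by apply: leq_trans (deg_priv_codeg F v D x) _; rewrite codeg_le3.
  rewrite -(D3 vD) codegC; apply: subset_leq_card; apply/subsetP => B.
  rewrite -[_ \in _]/(B \in star (star I v) x) !in_star => /andP [/andP [BI vB] xB].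
  by rewrite xB andbT; exact: privI.
have nxo : x != o by apply: contra_eqN px => /eqP ->; rewrite dgo.
(* As [B] avoids [o], both its codegrees at [v] are 3; the sum is then 7 and [hit24] yields degree
   10 at [x]. *)
have [B [BI xB vB oB _]] := pick_edge vD (neq_sym nxo) nov (neq_sym nxo) nov.
have [l [nxl nvl eB]] : exists l, [/\ x != l, v != l & B = [set x; v; l]].
  have [p [q [n1 n2 n3 eB]]] := set3P (uF (IF BI)) xB.
  have : v \in [set x; p; q] by rewrite -eB.
  rewrite !inE eq_sym (negbTE nxv) /= => /orP [] /eqP ev; rewrite -ev in n1 n2 n3 eB.
    by exists q.
  by exists p; rewrite eq_sym in n3; split=> //; rewrite set3C23.
have lB : l \in B by rewrite eB !inE eqxx orbT.
have nlo : l != o by apply: contraNneq oB => <-.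
have dl : deg (priv F v D) l = 3.
  apply: d3 => //; first by rewrite eq_sym.
  by apply: (deg_priv_gt0 _ lB); exact: privI.
have BF := IF BI; have NB := N24 BI; rewrite eB in BF NB.
have [c7 _ d10] := hit24 nxv nxl nvl BF NB.
have dx : d x = 10.
  have := d10; have := deg_priv_codeg F v D l; have := deg_priv_codeg F v D x.
  rewrite dl px (codegC F v x).
  have : 0 < cd x l by apply: (codeg_gt0 BF); rewrite !inE eqxx ?orbT.
  move: c7; clear => c7 g l1 l2 d10; case: d10 => //; lia.
have dIx : #|star I x| = 9.
  have : \sum_(u in D) deg (star I x) u = 9.
    rewrite (eq_bigr (fun=> 3)) => [|u uD]; last exact: D3.
    by rewrite sum_nat_const uF.
  rewrite sum_deg (eq_bigr (fun=> 1)) ?sum1_card // => C.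
  by rewrite in_star => /andP [CI xC]; exact: D1.
have [f [fF xf fI]] : exists f, [/\ f \in F, x \in f & f \notin I].
  have [/existsP [f /and3P [? ? ?]] | ] := boolP [exists f : {set T}, [&& f \in F, x \in f & f \notin I]].
    by exists f.
  rewrite negb_exists => /forallP all; exfalso.
  have : #|star F x| <= #|star I x|.
    apply/subset_leq_card/subsetP => f; rewrite !in_star => /andP [fF xf].
    by move: (all f); rewrite fF xf /= negbK => ->.
  by rewrite dIx -[#|star F x|]/(d x) dx.
have fD u : u \in D -> u \notin f.
  move=> uD; apply/negP => uf; have nxu : x != u by apply: contraNneq xD => ->.
  have := codegI_lt fF fI xf uf; rewrite D3 // => lt3.
  by have := codeg_le3 uF sF nxu; rewrite leqNgt lt3.
have /pred0Pn [s /= /andP [sf sW]] : ~~ [disjoint f & W].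
  by apply: contra fI => dfW; rewrite inE fF.
have offW C u : C \in I -> u \in C -> u \notin W.
  by rewrite inE => /andP [_ /pred0P/(_ u)/=] + uC; rewrite uC => /negbT.
have nxs : x != s by apply: contraTneq sW => <-; exact: offW BI xB.
have [t [nxt nst ef]] : exists t, [/\ x != t, s != t & f = [set x; s; t]].
  have [y [z [n1 n2 n3 ef]]] := set3P (uF fF) xf.
  have : s \in [set x; y; z] by rewrite -ef.
  rewrite !inE eq_sym (negbTE nxs) /= => /orP [] /eqP es; rewrite -es in n1 n2 n3 ef.
    by exists z.
  by exists y; rewrite eq_sym in n3; split=> //; rewrite set3C23.
have tf : t \in f by rewrite ef !inE eqxx orbT.
have tD u : u \in D -> t != u by move=> /fD; apply: contraNneq => <-.
(* Otherwise each vertex of [D] lies on a member through [x] and [t], and [f] would be a fourth edge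
   through that pair. *)
have [c cD tc] : exists2 c, c \in D & forall B, B \in I -> x \in B -> c \in B -> t \notin B.
  have [/existsP [c /andP [cD /forallP all]] | ] := boolP [exists c, (c \in D) &&
      [forall C : {set T}, [&& C \in I, x \in C & c \in C] ==> (t \notin C)]].
    by exists c => // C CI xC cC; move: (all C); rewrite CI xC cC.
  rewrite negb_exists => /forallP none; exfalso.
  have all c : c \in D -> 0 < #|star (star (star I x) t) c|.
    move=> cD; move: (none c); rewrite cD /= negb_forall => /existsP [C].
    rewrite negb_imply negbK => /andP [/and3P [CI xC cC] tC].
    by apply/card_gt0P; exists C; rewrite !in_star CI xC tC.
  have : #|D| <= \sum_(c in D) deg (star (star I x) t) c.
    by rewrite -sum1_card; apply: leq_sum.
  rewrite sum_deg (eq_bigr (fun=> 1)) ?sum1_card => [|C]; last first.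
    by rewrite !in_star => /andP [/andP [CI xC] _]; exact: D1.
  rewrite uF // -[#|_|]/(cI x t) => g3.
  have := codegI_lt fF fI xf tf; have := codeg_le3 uF sF nxt.
  by move: g3; clear; lia.
have [a [b [nca ncb nab eD]]] := set3P (uF DF) cD.
have aD : a \in D by rewrite eD !inE eqxx orbT.
have bD : b \in D by rewrite eD !inE eqxx orbT.
have nDx u : u \in D -> u != x by move=> uD; apply: contraNneq xD => <-.
have leaf C u : C \in I -> x \in C -> u \in C -> u \in D ->
   exists m, [/\ m \in C, m != x, m \notin D & forall z, z \in C -> [|| z == x, z == u | z == m]].
  move=> CI xC uC uD.
  have [p [q [n1 n2 n3 eC]]] := set3P (uF (IF CI)) xC.
  have pq : [|| u == p | u == q].
    have : u \in [set x; p; q] by rewrite -eC.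
    by rewrite !inE (negbTE (nDx _ uD)).
  have pC : p \in C by rewrite eC !inE eqxx orbT.
  have qC : q \in C by rewrite eC !inE eqxx orbT.
  case/orP: pq => /eqP eu.
    exists q; rewrite qC eq_sym; split=> //.
      by apply/negP => qD; move: n3; rewrite -eu (D1' CI xC uC qC uD qD) eqxx.
    by move=> z; rewrite eC !inE eu orbA.
  exists p; rewrite pC eq_sym; split=> //.
    by apply/negP => pD; move: n3; rewrite -eu (D1' CI xC uC pC uD pD) eqxx.
  by move=> z; rewrite eC !inE eu orbA orbAC.
(* [pick_edge] avoids only two vertices, but [Bc] has to avoid [t], [la] and [lb]; the choice of [c]
   takes care of [t]. *)
have [Ba [BaI xBa aBa tBa _]] :=
  pick_edge aD (neq_sym nxt) (tD _ aD) (neq_sym nxt) (tD _ aD).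
have [la [laB nlax laD allBa]] := leaf _ _ BaI xBa aBa aD.
have lD l0 u : l0 \notin D -> u \in D -> l0 != u by move=> + uD; apply: contraNneq => ->.
have [Bb [BbI xBb bBb tBb laBb]] :=
  pick_edge bD (neq_sym nxt) (tD _ bD) nlax (lD _ _ laD bD).
have [lb [lbB nlbx lbD allBb]] := leaf _ _ BbI xBb bBb bD.
have [Bc [BcI xBc cBc laBc lbBc]] :=
  pick_edge cD nlax (lD _ _ laD cD) nlbx (lD _ _ lbD cD).
have tBc := tc _ BcI xBc cBc.
have capI C u C' : C \in I -> x \in C -> u \in C -> u \in D -> x \in C' ->
    u \notin C' -> (forall m, m \in C -> m != x -> m \notin D -> m \notin C') ->
    C :&: C' = [set x].
  move=> CI xC uC uD xC' uC' hm; have [m [mC nmx mD all]] := leaf _ _ CI xC uC uD.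
  apply/setP => z; rewrite !inE; apply/andP/eqP => [[zC zC'] | -> //].
  case/or3P: (all _ zC) => /eqP ez //; rewrite ez in zC'.
    by rewrite zC' in uC'.
  by move: (hm m mC nmx mD); rewrite zC'.
have only C u v0 : C \in I -> x \in C -> u \in C -> u \in D -> v0 \in D -> u != v0 -> v0 \notin C.
  by move=> CI xC uC uD vD' nuv; apply: contra nuv => vC; rewrite (D1' CI xC uC vC uD vD').
have nbc := neq_sym ncb; have nac := neq_sym nca; have nba := neq_sym nab.
have lfa m : m \in Ba -> m != x -> m \notin D -> m = la.
  move=> /allBa /or3P [/eqP -> | /eqP -> | /eqP -> //]; rewrite ?eqxx //.
  by rewrite aD.
have lfb m : m \in Bb -> m != x -> m \notin D -> m = lb.
  move=> /allBb /or3P [/eqP -> | /eqP -> | /eqP -> //]; rewrite ?eqxx //.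
  by rewrite bD.
have ab : Ba :&: Bb = [set x].
  apply: (capI _ a) => //; first exact: (only Bb b).
  by move=> m m1 m2 m3; rewrite (lfa m).
have ac : Ba :&: Bc = [set x].
  apply: (capI _ a) => //; first exact: (only Bc c).
  by move=> m m1 m2 m3; rewrite (lfa m).
have bc : Bb :&: Bc = [set x].
  apply: (capI _ b) => //; first exact: (only Bc c).
  by move=> m m1 m2 m3; rewrite (lfb m).
have xf' C u : C \in I -> x \in C -> u \in C -> u \in D -> t \notin C -> C :&: f = [set x].
  move=> CI xC uC uD tC; apply: (capI _ u) => //; first exact: fD.
  move=> m mC nmx _; rewrite ef !inE negb_or negb_or nmx /=; apply/andP; split.
    by apply: contraTneq sW => <-; exact: offW CI mC.
  by apply: contraNneq tC => <-.
have af := xf' _ _ BaI xBa aBa aD tBa.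
have bf := xf' _ _ BbI xBb bBb bD tBb.
have cf := xf' _ _ BcI xBc cBc cD tBc.
have neq C C' : C \in I -> C :&: C' = [set x] -> C != C'.
  move=> CI e; apply/eqP => eC; rewrite -eC setIid in e.
  by have := uF (IF CI); rewrite e cards1.
have us : uniq [:: Ba; Bb; Bc; f].
  by rewrite /= !inE !negb_or (neq _ _ BaI ab) (neq _ _ BaI ac) (neq _ _ BaI af)
    (neq _ _ BbI bc) (neq _ _ BbI bf) (neq _ _ BcI cf).
have : #|[set C in [:: Ba; Bb; Bc; f]]| <= 3.
  apply: (sF (C := [set x])).
    by apply/subsetP => C; rewrite !inE => /or4P [] /eqP ->; first [exact: fF | by apply: IF].
  have sym (P Q : {set T}) : P :&: Q = [set x] -> Q :&: P = [set x] by rewrite setIC.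
  move=> P Q; rewrite !inE => /or4P [] /eqP -> /or4P [] /eqP ->; rewrite ?eqxx // => _;
    first [by [] | by apply: sym].
by rewrite cardsE (card_uniqP us).
Qed.

End Triangle.

Definition nocover := forall x y, x != y -> exists D, [/\ D \in I, x \notin D & y \notin D].
Definition nonstar := forall x, exists2 D, D \in I & x \notin D.

Lemma mem_side x y B : B \in I -> x \in B -> y \notin B -> B :\ x \in side x y.
Proof. by move=> BI xB yB; apply/sideP; exists B. Qed.

(** Every edge of [side x y] meets {u, w}; the extra summand records that {u, w} itself is counted
    at both ends. *)
Lemma cover_edge_card x y u w : x != y -> [set u; w] \in side y x ->
  #|side x y| + ([set u; w] \in side x y) <= deg (side x y) u + deg (side x y) w.
Proof.
move=> nxy uwY; rewrite -[deg _ u + _]cardsUI; apply: leq_add.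
  apply/subset_leq_card/subsetP => e eX; rewrite !inE -/I eX /=.
  have /pred0Pn [z /= /andP [ze]] := side_cross nxy eX uwY.
  by rewrite !inE => /orP [] /eqP <-; rewrite ze ?orbT.
have [uwX|//] := boolP ([set u; w] \in side x y).
by apply/card_gt0P; exists [set u; w]; rewrite !inE -/I uwX !eqxx orbT.
Qed.

(** The single edge {u, w} of [side y x] must have two ends of degree 3 in [side x y] and not belong
    to it. With D = {y, u, w} this is the configuration of [triangle_absurd]: a member {x, y, u}
    would raise the codegree of [x] and [u] to 4. *)
Lemma triangle_config x y : x != y -> cI x y = 3 -> #|side x y| = 6 ->
  #|side y x| = 1 -> #|I| = 10 -> (forall A, A \in I -> 23 < N A) -> False.
Proof.
move=> nxy cxy X6 /eqP/cards1P [f ef] I10 N24.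
have fY : f \in side y x by rewrite ef inE.
have /sideP [D DI [yD xD efD]] := fY.
have [u [w [nyu nyw nuw eD]]] := set3P (uF (IF DI)) yD.
have efuw : f = [set u; w].
  rewrite efD eD; apply/setP => z; rewrite !inE.
  by have [->|] := eqVneq z y; rewrite //= (negbTE nyu) (negbTE nyw).
rewrite efuw in fY; have := cover_edge_card nxy fY.
rewrite X6 => le6.
have su := side_subcubic x y u; have sw := side_subcubic x y w.
have uwX : [set u; w] \notin side x y.
  by apply: contraL le6 => ->; rewrite -ltnNge; move: su sw; card_lia.
have du : deg (side x y) u = 3 by move: su sw le6; card_lia.
have dw : deg (side x y) w = 3 by move: su sw le6; card_lia.
have uD : u \in D by rewrite eD !inE eqxx orbT.
have wD : w \in D by rewrite eD !inE eqxx orbT.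
have nDx z : z \in D -> z != x by move=> zD; apply: contraNneq xD => <-.
have cI3 z : z \in D -> cI x z <= 3.
  by move=> /nDx nzx; apply: leq_trans (codegI_le _ _) _; apply: codeg_le3; rewrite // eq_sym.
have cu : cI x u = 3.
  by apply/eqP; rewrite eqn_leq cI3 //= -du deg_side_le // nDx.
have cw : cI x w = 3.
  by apply/eqP; rewrite eqn_leq cI3 //= -dw deg_side_le // nDx.
have noy z : z \in D -> z != y -> deg (side x y) z = 3 -> [set x; y; z] \notin I.
  move=> zD nzy dz; apply/negP => BI.
  by have := deg_side_lt (nDx z zD) nzy BI; rewrite dz ltnNge cI3.
apply: (triangle_absurd (x := x) (D := D)) => //.
  by move=> v; rewrite eD !inE => /orP [/orP [] | ] /eqP ->.
move=> B BI xB; apply/eqP; rewrite eqn_leq; apply/andP; split; last first.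
  by rewrite card_gt0 setI_eq0; exact: iI.
apply/card_le1_eqP => a b /setIP [aB aD] /setIP [bB bD].
apply/eqP/negPn/negP => nba; have nab := neq_sym nba.
have eB := set3_eq (uF (IF BI)) (neq_sym (nDx _ aD)) (neq_sym (nDx _ bD)) nab xB aB bB.
have nuy := neq_sym nyu; have nwy := neq_sym nyw.
have uwn p q : p \in D -> q \in D -> p != y -> q != y -> p != q -> B = [set x; p; q] -> False.
  move=> pD qD npy nqy npq eBpq.
  have ePQ : [set p; q] = [set u; w].
    move: pD qD; rewrite eD !inE (negbTE npy) (negbTE nqy) /=.
    move=> /orP [] /eqP ep /orP [] /eqP eq'; move: npq; rewrite ep eq' ?eqxx //.
    by rewrite setUC.
  move: uwX; rewrite -ePQ; apply/negP/negPn/sideP; exists B => //; split=> //.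
    by rewrite eBpq !inE !negb_or (neq_sym nxy) [y == p]eq_sym npy [y == q]eq_sym.
  rewrite eBpq; apply/setP => z; rewrite !inE.
  by have [->|] := eqVneq z x; rewrite //= ![x == _]eq_sym (negbTE (nDx _ pD)) (negbTE (nDx _ qD)).
have yn p : p \in D -> p != y -> B = [set x; y; p] -> False.
  move=> pD npy eBp.
  have : p \in [set y; u; w] by rewrite -eD.
  rewrite !inE (negbTE npy) /= => /orP [] /eqP ep; rewrite {}ep in pD npy eBp.
    by move: (noy u uD nuy du); rewrite -eBp BI.
  by move: (noy w wD nwy dw); rewrite -eBp BI.
have [eay|nay] := eqVneq a y.
  by apply: (yn b) => //; rewrite -?eay // eq_sym.
have [eby|nby] := eqVneq b y.
  by apply: (yn a) => //; rewrite -eby set3C23.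
exact: (uwn a b).
Qed.

(** At most 3 members contain both vertices, and the two sides have at most 7 edges. A total of 10
    needs 7, hence a side with a single edge. *)
Lemma covered_pair x y : x != y -> nonstar ->
  edges_off (edges_off I x) y = set0 ->
  #|I| <= 10 /\ (#|I| = 10 -> (forall A, A \in I -> 23 < N A) -> False).
Proof.
move=> nxy ns off0; have := pair_count nxy; rewrite off0 cards0 addn0 => cnt.
have offF B : B \in I -> (x \in B) || (y \in B).
  move=> BI; apply/negPn/negP; rewrite negb_or => /andP [xB yB].
  by have := in_set0 B; rewrite -off0 !in_edges_off BI xB yB.
have X1 : 0 < #|side x y|.
  have [B BI yB] := ns y; have := offF B BI; rewrite (negbTE yB) orbF => xB.
  by apply/card_gt0P; exists (B :\ x); exact: mem_side.
have Y1 : 0 < #|side y x|.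
  have [B BI xB] := ns x; have := offF B BI; rewrite (negbTE xB) /= => yB.
  by apply/card_gt0P; exists (B :\ y); exact: mem_side.
have c3 : cI x y <= 3 by apply: leq_trans (codegI_le _ _) (codeg_le3 uF sF nxy).
have le7 := cross_le7 (@side_uniform x y) (@side_uniform y x) (side_subcubic x y)
  (side_subcubic y x) (side_cross nxy) X1 Y1.
split=> [|I10 N24]; first by rewrite cnt; move: c3 le7; card_lia.
have c3' : cI x y = 3 by move: c3 le7 cnt; rewrite I10; card_lia.
have s7 : #|side x y| + #|side y x| = 7 by move: c3' le7 cnt; rewrite I10; card_lia.
have [X2|X2] := ltnP 1 #|side x y|; last first.
  apply: (triangle_config (neq_sym nxy)) => //; first by rewrite codegC.
    by move: s7 X2 X1; card_lia.
  by apply/eqP; rewrite eqn_leq X2.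
have [Y2|Y2] := ltnP 1 #|side y x|; last first.
  apply: (triangle_config nxy) => //; last by apply/eqP; rewrite eqn_leq Y2.
  by move: s7 Y2 Y1; card_lia.
have := cross_le6 (@side_uniform x y) (@side_uniform y x) (side_subcubic x y)
  (side_subcubic y x) (side_cross nxy) X2 Y2.
by rewrite s7.
Qed.

(** Members through [v] meet a member avoiding [v] in different vertices, so degrees in [I] are at
    most 3. The degree sum over a member [A] is then at most 9, with 3 coming from [A] and at least
    1 from each other member. *)
Lemma small_codegrees : nonstar -> (forall u v, u != v -> cI u v <= 1) -> #|I| <= 7.
Proof.
move=> ns c1.
have [->|/set0Pn [A AI]] := eqVneq I set0; first by rewrite cards0.
have d3 v : deg I v <= 3.
  have [D DI vD] := ns v.
  have : \sum_(u in D) deg (star I v) u <= \sum_(u in D) 1.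
    by apply: leq_sum => u uD; apply: c1; apply: contraNneq vD => ->.
  rewrite sum1_card (uF (IF DI)) sum_deg; apply: leq_trans.
  rewrite -[deg I v]/#|star I v| -sum1_card; apply: leq_sum => B.
  rewrite in_star => /andP [BI vB]; rewrite card_gt0 setI_eq0; exact: iI.
have : \sum_(v in A) deg I v <= \sum_(v in A) 3 by apply: leq_sum.
rewrite sum_nat_const (uF (IF AI)) sum_deg (bigD1 A) //= setIid (uF (IF AI)).
have : #|I :\ A| <= \sum_(B in I | B != A) #|B :&: A|.
  rewrite -sum1_card (eq_bigl (fun B => (B \in I) && (B != A))) => [|B]; last first.
    by rewrite in_setD1 andbC.
  by apply: leq_sum => B /andP [BI _]; rewrite card_gt0 setI_eq0; exact: iI.
move=> le1 le9; rewrite (cardsD1 A I) AI add1n -(leq_add2l 2).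
exact: leq_trans (leq_add (leqnn 3) le1) le9.
Qed.

Lemma side_nonempty x y t : nocover -> t != y ->
  (forall D, D \in I -> x \notin D -> y \notin D -> t \in D) -> 0 < #|side x y|.
Proof.
move=> nc nty all; have [D [DI yD tD]] := nc y t (neq_sym nty).
have [xD|xD] := boolP (x \in D); last by rewrite (all D) in tD.
by apply/card_gt0P; exists (D :\ x); exact: mem_side.
Qed.

Lemma thirdP x y B : x != y -> B \in I -> x \in B -> y \in B ->
  exists t, [/\ x != t, y != t & B = [set x; y; t]].
Proof.
move=> nxy BI xB yB; have [p [q [n1 n2 n3 eB]]] := set3P (uF (IF BI)) xB.
have : y \in [set x; p; q] by rewrite -eB.
rewrite !inE eq_sym (negbTE nxy) /= => /orP [] /eqP ey; rewrite -ey in n1 n2 n3 eB.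
  by exists q.
by exists p; rewrite eq_sym in n3; split=> //; rewrite set3C23.
Qed.

Lemma meet_third x y t B : [set x; y; t] \in I -> B \in I -> x \notin B -> y \notin B ->
  t \in B.
Proof.
move=> AI BI xB yB; have /pred0Pn [z /= /andP [+ zB]] := iI AI BI.
rewrite !inE => /orP [/orP [] | ] /eqP ez; rewrite ez in zB => //.
  by rewrite zB in xB.
by rewrite zB in yB.
Qed.

Lemma sum_meet_ge (X : {set {set T}}) (Q : {set T}) : (forall e, e \in X -> 0 < #|e :&: Q|) ->
  #|X| <= \sum_(e in X) #|e :&: Q|.
Proof. by move=> pos; rewrite -sum1_card; apply: leq_sum. Qed.

Lemma sum_meet_eq (X : {set {set T}}) (Q : {set T}) : (forall e, e \in X -> 0 < #|e :&: Q|) ->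
  \sum_(e in X) #|e :&: Q| = #|X| -> forall e, e \in X -> #|e :&: Q| = 1.
Proof.
move=> pos sum e eX; apply/eqP; rewrite eqn_leq pos // andbT leqNgt; apply/negP => g1.
have : \sum_(f in X | f != e) 1 <= \sum_(f in X | f != e) #|f :&: Q|.
  by apply: leq_sum => f /andP [fX _]; exact: pos.
have : \sum_(f in X) 1 = #|X| by rewrite sum1_card.
rewrite -sum (bigD1 e) // [in RHS](bigD1 e) //=.
by move: g1; card_lia.
Qed.

(* For |I| = 10 the incidences between Q and the edges through exactly one of *)
(* x and y are counted with equality, so that each t in Q lies on 7 edges     *)
(* private to it in {x, y, t}. This makes the codegrees inside Q too large.   *)
Lemma codegree3_pair x y : x != y -> nocover -> cI x y = 3 ->
  #|I| <= 10 /\ (#|I| = 10 -> (forall A, A \in I -> 23 < N A) -> False).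
Proof.
move=> nxy nc c3; have [Q [QI xQ yQ]] := nc x y nxy.
have Q3 := uF (IF QI).
(* The third vertex of a member through [x] and [y] lies in [Q]; as there are three such members,
   all of [Q] is used. *)
have imS : star (star I x) y = [set [set x; y; t] | t in Q].
  apply/eqP; rewrite eqEcard; apply/andP; split; last first.
    by rewrite -[#|star _ y|]/(cI x y) c3 -Q3 leq_imset_card.
  apply/subsetP => B; rewrite !in_star => /andP [/andP [BI xB] yB].
  have [t [nxt nyt eB]] := thirdP nxy BI xB yB.
  by apply/imsetP; exists t => //; apply: (@meet_third x y) => //; rewrite -eB.
have triI t : t \in Q -> [set x; y; t] \in I.
  move=> tQ; have : [set x; y; t] \in star (star I x) y.
    by rewrite imS; apply/imsetP; exists t.
  by rewrite !in_star => /andP [/andP []].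
have offQ : edges_off (edges_off I x) y = [set Q].
  apply/setP => D; rewrite !in_edges_off in_set1.
  apply/andP/eqP => [[/andP [DI xD] yD] | ->]; last by rewrite QI xQ yQ.
  apply/esym/eqP; rewrite eqEcard Q3 uF ?IF // andbT; apply/subsetP => t tQ.
  exact: meet_third (triI t tQ) DI xD yD.
have := pair_count nxy; rewrite c3 offQ cards1 => cnt.
have [t0 t0Q] : exists t, t \in Q by apply/set0Pn; rewrite -card_gt0 Q3.
have nQx t : t \in Q -> t != x by apply: contraTneq => ->.
have nQy t : t \in Q -> t != y by apply: contraTneq => ->.
have X1 : 0 < #|side x y|.
  by apply: (side_nonempty nc (nQy _ t0Q)) => D DI xD yD; exact: meet_third (triI _ t0Q) DI xD yD.
have Y1 : 0 < #|side y x|.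
  by apply: (side_nonempty nc (nQx _ t0Q)) => D DI yD xD; exact: meet_third (triI _ t0Q) DI xD yD.
have dX t : t \in Q -> deg (side x y) t < cI x t.
  by move=> tQ; apply: deg_side_lt; [exact: nQx | exact: nQy | exact: triI].
have dY t : t \in Q -> deg (side y x) t < cI y t.
  by move=> tQ; apply: deg_side_lt; [exact: nQy | exact: nQx | rewrite set3C12 triI].
have cI3 u v : u != v -> cI u v <= 3.
  by move=> nuv; apply: leq_trans (codegI_le u v) _; exact: codeg_le3.
have meetX e : e \in side x y -> 0 < #|e :&: Q|.
  move=> /sideP [B BI [xB yB ->]]; have /pred0Pn [z /= /andP [zB zQ]] := iI BI QI.
  by apply/card_gt0P; exists z; rewrite !inE zB zQ nQx.
have meetY e : e \in side y x -> 0 < #|e :&: Q|.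
  move=> /sideP [B BI [yB xB ->]]; have /pred0Pn [z /= /andP [zB zQ]] := iI BI QI.
  by apply/card_gt0P; exists z; rewrite !inE zB zQ nQy.
(* The total 7 is lost here: the single edge on one side has an end in [Q], where the other side has
   degree below 3. *)
have six a b : a != b -> (forall t, t \in Q -> deg (side a b) t < 3) ->
    (forall e, e \in side b a -> 0 < #|e :&: Q|) ->
    #|side b a| = 1 -> #|side a b| <= 5.
  move=> nab da mb /eqP/cards1P [f ef]; have fY : f \in side b a by rewrite ef inE.
  have /eqP/cards2P [u [w [_ euw]]] := side_uniform fY.
  have /card_gt0P [z] := mb _ fY; rewrite euw in fY *.
  have := leq_trans (leq_addr _ _) (cover_edge_card nab fY).
  have := side_subcubic a b u; have := side_subcubic a b w.
  rewrite !inE => sw su le /andP [/orP [] /eqP ez zQ]; have := da _ zQ;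
  by rewrite ez; move: sw su le; card_lia.
have dX3 t : t \in Q -> deg (side x y) t < 3.
  by move=> tQ; apply: leq_trans (dX t tQ) (cI3 _ _ _); rewrite eq_sym nQx.
have dY3 t : t \in Q -> deg (side y x) t < 3.
  by move=> tQ; apply: leq_trans (dY t tQ) (cI3 _ _ _); rewrite eq_sym nQy.
have le6 : #|side x y| + #|side y x| <= 6.
  have [X2|X2] := ltnP 1 #|side x y|; last first.
    have eX : #|side x y| = 1 by apply/eqP; rewrite eqn_leq X2.
    by have := six _ _ (neq_sym nxy) dY3 meetX eX; rewrite eX; card_lia.
  have [Y2|Y2] := ltnP 1 #|side y x|; last first.
    have eY : #|side y x| = 1 by apply/eqP; rewrite eqn_leq Y2.
    by have := six _ _ nxy dX3 meetY eY; rewrite eY; card_lia.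
  exact: (cross_le6 (@side_uniform x y) (@side_uniform y x) (side_subcubic x y)
    (side_subcubic y x) (side_cross nxy) X2 Y2).
split=> [|I10 N24]; first by move: cnt le6; card_lia.
have {cnt le6} XY6 : #|side x y| + #|side y x| = 6 by move: cnt I10; card_lia.
have c3F : cd x y = 3.
  by apply/eqP; rewrite eqn_leq codeg_le3 // -c3 codegI_le.
have dXc t : t \in Q -> deg (side x y) t < cd x t.
  by move=> tQ; apply: leq_trans (dX t tQ) (codegI_le x t).
have dYc t : t \in Q -> deg (side y x) t < cd y t.
  by move=> tQ; apply: leq_trans (dY t tQ) (codegI_le y t).
(* In {x, y, t} the codegrees sum to at most 7, with 3 for {x, y}; the other two each exceed the
   degree of [t] in a side. *)
have le2 t : t \in Q -> deg (side x y) t + deg (side y x) t <= 2.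
  move=> tQ; have [c7 _ _] := hit24 nxy (neq_sym (nQx _ tQ)) (neq_sym (nQy _ tQ))
    (IF (triI _ tQ)) (N24 _ (triI _ tQ)).
  by have := dXc _ tQ; have := dYc _ tQ; move: c7 c3F; card_lia.
have gX := sum_meet_ge meetX; have gY := sum_meet_ge meetY.
rewrite -!sum_deg in gX gY.
have le6 : \sum_(t in Q) deg (side x y) t + \sum_(t in Q) deg (side y x) t <= 6.
  rewrite -big_split /=; apply: leq_trans (_ : \sum_(t in Q) 2 <= _).
    exact: leq_sum.
  by rewrite sum_nat_const Q3.
have eX : \sum_(t in Q) deg (side x y) t = #|side x y|.
  by move: gX gY le6 XY6; card_lia.
have eY : \sum_(t in Q) deg (side y x) t = #|side y x|.
  by move: gX gY le6 XY6; card_lia.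
have e2 t : t \in Q -> deg (side x y) t + deg (side y x) t = 2.
  move=> tQ; apply/eqP; rewrite eqn_leq le2 //= leqNgt; apply/negP => lt2.
  have : \sum_(u in Q | u != t) (deg (side x y) u + deg (side y x) u) <=
         \sum_(u in Q | u != t) 2.
    by apply: leq_sum => u /andP [uQ _]; exact: le2.
  have : \sum_(u in Q) (deg (side x y) u + deg (side y x) u) = 6.
    by rewrite big_split /= eX eY.
  have : \sum_(u in Q) 2 = 6 by rewrite sum_nat_const Q3.
  rewrite (bigD1 t) // [in X in _ -> X -> _](bigD1 t) //=.
  by move: lt2; card_lia.
rewrite sum_deg in eX; rewrite sum_deg in eY.
have mX := sum_meet_eq meetX eX; have mY := sum_meet_eq meetY eY.
(* Two edges {t, s} and {t, s'} on one side force an edge of the other side that avoids [t] to be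
   {s, s'}. It meets [Q], say in [s], and then {t, s} meets [Q] twice. *)
have no2 a b t : a != b -> t \in Q -> 0 < #|side b a| -> deg (side b a) t = 0 ->
    (forall e, e \in side a b -> #|e :&: Q| = 1) ->
    (forall e, e \in side b a -> #|e :&: Q| = 1) -> deg (side a b) t <= 1.
  move=> nab tQ /card_gt0P [f fY] dt0 ma mb; rewrite leqNgt; apply/negP.
  case/card_gt1P => e1 [e2' [/setIdP [e1X te1] /setIdP [e2X te2] ne12]].
  have tf : t \notin f.
    by apply: contra_eqN dt0 => tf; rewrite -lt0n deg_cover; exact: mem_cover tf.
  have [s nst es] := edge_split (@side_uniform a b) e1X te1.
  have [s' nst' es'] := edge_split (@side_uniform a b) e2X te2.
  have nss : s != s' by apply: contraNneq ne12 => ss; rewrite es es' ss.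
  have inf e z : e \in side a b -> e = [set t; z] -> z \in f.
    move=> eX' ez; have /pred0Pn [q /= /andP [+ qf]] := side_cross nab eX' fY.
    rewrite ez !inE => /orP [] /eqP eq'; rewrite eq' in qf => //.
    by rewrite qf in tf.
  have sf := inf _ _ e1X es; have sf' := inf _ _ e2X es'.
  have ef : f = [set s; s'].
    apply/esym/eqP; rewrite eqEcard cards2 nss (side_uniform fY) andbT.
    by apply/subsetP => z; rewrite !inE => /orP [] /eqP ->.
  have : 0 < #|f :&: Q| by rewrite mb.
  case/card_gt0P => z /setIP [+ zQ].
  have bad e w : e \in side a b -> e = [set t; w] -> w != t -> w \in Q -> False.
    move=> eX' ew nwt wQ; have /eqP/cards1P [q eq'] := ma _ eX'.
    have : t \in e :&: Q by rewrite inE ew !inE eqxx.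
    have : w \in e :&: Q by rewrite inE ew !inE eqxx orbT.
    by rewrite eq' !inE => /eqP ewq /eqP etq; rewrite ewq etq eqxx in nwt.
  rewrite ef !inE => /orP [] /eqP ez; rewrite ez in zQ.
    exact: (bad e1 s).
  exact: (bad e2' s').
have d1 t : t \in Q -> deg (side x y) t = 1 /\ deg (side y x) t = 1.
  move=> tQ; have := e2 _ tQ.
  have hx := fun e0 => no2 _ _ _ nxy tQ Y1 e0 mX mY.
  have hy := fun e0 => no2 _ _ _ (neq_sym nxy) tQ X1 e0 mY mX.
  move: hx hy; case: (deg (side x y) t) => [|[|[|m]]]; case: (deg (side y x) t) => [|[|[|m']]] //.
    by move=> _ /(_ erefl).
  by move=> /(_ erefl).
have cd2 t : t \in Q -> [/\ cd x t = 2, cd y t = 2 & h t [set x; y; t] = 7].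
  move=> tQ; have [dx1 dy1] := d1 _ tQ.
  have [c7 _ d10] := hit24 nxy (neq_sym (nQx _ tQ)) (neq_sym (nQy _ tQ))
    (IF (triI _ tQ)) (N24 _ (triI _ tQ)).
  have := dXc _ tQ; have := dYc _ tQ; rewrite dx1 dy1 => gy gx.
  have cx : cd x t = 2 by move: c7 c3F gx gy; card_lia.
  have cy : cd y t = 2 by move: c7 c3F gx gy; card_lia.
  split=> //; have [|_ _ dt] := d10; first by rewrite cx cy c3F.
  have [p cnt] := triple_count uF sF nxy (neq_sym (nQx _ tQ)) (neq_sym (nQy _ tQ)) (IF (triI _ tQ)).
  by move: cnt; rewrite cx cy c3F dt; card_lia.
have pairs t a b : t != a -> t != b -> a != b -> Q = [set t; a; b] ->
    [/\ 1 < cd t a, 1 < cd t b & (2 < cd t a) || (2 < cd t b)].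
  move=> nta ntb nab eQ; have tQ : t \in Q by rewrite eQ !inE eqxx.
  have aQ : a \in Q by rewrite eQ !inE eqxx orbT.
  have bQ : b \in Q by rewrite eQ !inE eqxx orbT.
  have [_ _ h7] := cd2 _ tQ.
  have tA : t \in [set x; y; t] by rewrite !inE eqxx orbT.
  have QP : Q \in priv F t [set x; y; t].
    apply: mem_priv => //; first exact: IF.
    by move=> u nut; rewrite !inE (negbTE nut) orbF => /orP [] /eqP ->.
  have [ge2 [o [nov dgo d3]] _] := priv7_structure uF sF (IF (triI _ tQ)) tA h7.
  have pa := deg_priv_gt0 QP aQ; have pb := deg_priv_gt0 QP bQ.
  have la := deg_priv_codeg F t [set x; y; t] a.
  have lb := deg_priv_codeg F t [set x; y; t] b.
  have nat' := neq_sym nta; have nbt := neq_sym ntb.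
  split; first exact: leq_trans (ge2 _ nat' pa) la.
    exact: leq_trans (ge2 _ nbt pb) lb.
  have [eao|nao] := eqVneq a o.
    have nbo : b != o by rewrite -eao eq_sym.
    by apply/orP; right; rewrite -(d3 _ nbt pb nbo).
  by apply/orP; left; rewrite -(d3 _ nat' pa nao).
have [a [b [c [nab nac nbc eQ]]]] := edge3P uF (IF QI).
have [ab ac ob1] := pairs _ _ _ nab nac nbc eQ.
have [ba bc ob2] := pairs _ _ _ (neq_sym nab) nbc nac (etrans eQ (set3C12 _ _ _)).
have [ca cb ob3] := pairs _ _ _ (neq_sym nac) (neq_sym nbc) nab (etrans eQ (esym (set3_rot _ _ _))).
have QF := IF QI; have NQ := N24 _ QI; rewrite eQ in QF NQ.
have [c7 _ _] := hit24 nab nac nbc QF NQ.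
(* Every vertex of [Q] is on a pair of codegree 3, so two of the three pairs are; the sum is at
   least 3 + 3 + 2. *)
move: ab ac bc ob1 ob2 ob3 c7; rewrite (codegC F b a) (codegC F c a) (codegC F c b).
by card_lia.
Qed.

(** * Codegree two and five-cycles *)

(** The points a, b, c, e, f form a 5-cycle in the link of [x]. *)
Definition pentagon x a b c e f :=
  [/\ uniq [:: x; a; b; c; e; f], [set x; a; b] \in F, [set x; b; c] \in F,
      [set x; c; e] \in F & [set x; e; f] \in F /\ [set x; f; a] \in F].

Lemma pentagon_rot x a b c e f : pentagon x a b c e f -> pentagon x b c e f a.
Proof.
case=> us ab bc ce [ef fa]; split=> //.
by move: us; rewrite !(cons_uniq x) -(rot_uniq 1 [:: a; b; c; e; f]) -(mem_rot 1 [:: a; b; c; e; f]).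
Qed.

(** The pairs {c, e} and {e, f} are private, while {b, c} and {f, a} are not. So [c] and [f] each
    lie on at most two private edges, although only one vertex of the 7-edge graph may. *)
Lemma pentagon_priv x a b c e f : pentagon x a b c e f -> h x [set x; a; b] != 7.
Proof.
move=> [us abF bcF ceF [efF faF]]; apply/eqP => h7.
move: us; rewrite /= !inE !negb_or -!andbA.
move=> /and5P [nxa nxb nxc nxe /and5P [nxf nab nac nae /and5P [naf nbc nbe nbf /and4P [nce ncf nef _]]]].
have xA : x \in [set x; a; b] by rewrite !inE eqxx.
have [_ [o [nov dgo d3]] _] := priv7_structure uF sF abF xA h7.
have ceP : [set x; c; e] \in priv F x [set x; a; b].
  apply: mem_priv => //; first by rewrite !inE eqxx.
  move=> u nux; rewrite !inE (negbTE nux) /= => /orP [] /eqP ->;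
  by rewrite ?(eq_sym a x) ?(eq_sym b x) ?(negbTE nxa) ?(negbTE nxb) ?(negbTE nac)
    ?(negbTE nae) ?(negbTE nbc) ?(negbTE nbe).
have efP : [set x; e; f] \in priv F x [set x; a; b].
  apply: mem_priv => //; first by rewrite !inE eqxx.
  move=> u nux; rewrite !inE (negbTE nux) /= => /orP [] /eqP ->;
  by rewrite ?(eq_sym a x) ?(eq_sym b x) ?(negbTE nxa) ?(negbTE nxb) ?(negbTE naf)
    ?(negbTE nae) ?(negbTE nbf) ?(negbTE nbe).
have full z B : x != z -> B \in F -> x \in B -> z \in B -> B \notin priv F x [set x; a; b] ->
    deg (priv F x [set x; a; b]) z != 3.
  move=> nxz BF xB zB BP; apply/eqP => dz; have := codeg_le3 uF sF nxz.
  rewrite leqNgt -dz => /negP; apply; apply: proper_card; apply/properP; split.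
    apply/subsetP => C /setIdP [CP zC]; have [CF xC _ _] := privP CP.
    by rewrite inE in_star CF xC.
  exists B; first by rewrite inE in_star BF xB.
  by rewrite inE (negbTE BP).
have bcP : [set x; b; c] \notin priv F x [set x; a; b].
  by apply/negP => /privP [_ _ _ /(_ b)]; rewrite !inE !eqxx !orbT eq_sym nxb => /(_ isT isT).
have faP : [set x; f; a] \notin priv F x [set x; a; b].
  by apply/negP => /privP [_ _ _ /(_ a)]; rewrite !inE !eqxx !orbT eq_sym nxa => /(_ isT isT).
have cC : c \in [set x; c; e] by rewrite !inE eqxx orbT.
have fC : f \in [set x; e; f] by rewrite !inE eqxx orbT.
have co : c = o.
  apply/eqP/negPn/negP => nco.
  have := full c _ nxc bcF _ _ bcP; rewrite !inE !eqxx !orbT => /(_ isT isT) /eqP; apply.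
  by apply: d3 => //; [rewrite eq_sym | exact: deg_priv_gt0 ceP cC].
have fo : f = o.
  apply/eqP/negPn/negP => nfo.
  have := full f _ nxf faF _ _ faP; rewrite !inE !eqxx !orbT => /(_ isT isT) /eqP; apply.
  by apply: d3 => //; [rewrite eq_sym | exact: deg_priv_gt0 efP fC].
by rewrite co fo eqxx in ncf.
Qed.

Lemma pentagon_all x a b c e f B : pentagon x a b c e f ->
  B \in [:: [set x; a; b]; [set x; b; c]; [set x; c; e]; [set x; e; f]; [set x; f; a]] ->
  h x B != 7.
Proof.
move=> p1; have p2 := pentagon_rot p1; have p3 := pentagon_rot p2.
have p4 := pentagon_rot p3; have p5 := pentagon_rot p4.
rewrite !inE => /orP [/eqP -> | /or4P [] /eqP ->].
- exact: pentagon_priv p1.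
- exact: pentagon_priv p2.
- exact: pentagon_priv p3.
- exact: pentagon_priv p4.
- exact: pentagon_priv p5.
Qed.

Section Codegree2.

Hypothesis nc : nocover.
Hypothesis cI2 : forall u v, u != v -> cI u v <= 2.

Lemma deg_side_le2 x y v : deg (side x y) v <= 2.
Proof.
have [->|nvx] := eqVneq v x; first by rewrite deg_link0.
by apply: leq_trans (deg_side_le y nvx) _; rewrite cI2 // eq_sym.
Qed.

(** Members avoiding [x] and [y] contain [t1] and [t2]. Degrees in the sides are at most 2, so a
    side with one edge leaves at most 4 for the other and [cross_le6] covers the rest. *)
Lemma codegree2_data x y : x != y -> cI x y = 2 ->
  exists t1 t2, [/\ t1 != t2, [/\ x != t1, y != t1, x != t2 & y != t2],
    [set x; y; t1] \in I, [set x; y; t2] \in I &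
    [/\ forall B, B \in I -> x \in B -> y \in B -> B = [set x; y; t1] \/ B = [set x; y; t2],
      #|edges_off (edges_off I x) y| <= cI t1 t2,
      #|side x y| + #|side y x| <= 6 &
      #|I| = 2 + #|side x y| + #|side y x| + #|edges_off (edges_off I x) y|]].
Proof.
move=> nxy c2; have cnt := pair_count nxy; rewrite c2 in cnt.
have /eqP/cards2P [B1 [B2 [nB eS]]] : #|star (star I x) y| = 2 by exact: c2.
have inS B : (B \in star (star I x) y) = (B == B1) || (B == B2) by rewrite eS !inE.
have := inS B1; rewrite eqxx !in_star => /andP [/andP [B1I xB1] yB1].
have := inS B2; rewrite eqxx orbT !in_star => /andP [/andP [B2I xB2] yB2].
have [t1 [nxt1 nyt1 eB1]] := thirdP nxy B1I xB1 yB1.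
have [t2 [nxt2 nyt2 eB2]] := thirdP nxy B2I xB2 yB2.
have n12 : t1 != t2 by apply: contraNneq nB => e12; rewrite eB1 eB2 e12.
rewrite eB1 in B1I; rewrite eB2 in B2I.
exists t1, t2; split=> //; split=> //.
- move=> B BI xB yB; have := inS B; rewrite !in_star BI xB yB -eB1 -eB2.
  by case/esym/orP => /eqP ->; [left | right].
- apply/subset_leq_card/subsetP => D; rewrite !in_edges_off => /andP [/andP [DI xD] yD].
  by rewrite inE in_star DI (meet_third B1I DI xD yD) (meet_third B2I DI xD yD).
have X1 : 0 < #|side x y|.
  by apply: (side_nonempty nc (neq_sym nyt1)) => D DI xD yD; exact: meet_third B1I DI xD yD.
have Y1 : 0 < #|side y x|.
  by apply: (side_nonempty nc (neq_sym nxt1)) => D DI yD xD; exact: meet_third B1I DI xD yD.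
have five a b : a != b -> #|side b a| = 1 -> #|side a b| <= 4.
  move=> nab /eqP/cards1P [f ef]; have fY : f \in side b a by rewrite ef inE.
  have /eqP/cards2P [u [w [_ euw]]] := side_uniform fY; rewrite euw in fY.
  have := leq_trans (leq_addr _ _) (cover_edge_card nab fY).
  by have := deg_side_le2 a b u; have := deg_side_le2 a b w; card_lia.
have [X2|X2] := ltnP 1 #|side x y|; last first.
  have eX : #|side x y| = 1 by apply/eqP; rewrite eqn_leq X2.
  by have := five _ _ (neq_sym nxy) eX; rewrite eX; card_lia.
have [Y2|Y2] := ltnP 1 #|side y x|; last first.
  have eY : #|side y x| = 1 by apply/eqP; rewrite eqn_leq Y2.
  by have := five _ _ nxy eY; rewrite eY; card_lia.
exact: (cross_le6 (@side_uniform x y) (@side_uniform y x) (side_subcubic x y)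
    (side_subcubic y x) (side_cross nxy) X2 Y2).
Qed.

Lemma codegree2_le10 x y : x != y -> cI x y = 2 -> #|I| <= 10.
Proof.
move=> nxy c2; have [t1 [t2 [n12 _ _ _ [_ le1 le6 ->]]]] := codegree2_data nxy c2.
by have := leq_trans le1 (cI2 n12); move: le6; card_lia.
Qed.

(* The link of x in I is a 5-cycle. *)
Lemma codegree2_pentagon x y B : #|I| = 10 -> x != y -> cI x y = 2 ->
  B \in I -> x \in B -> h x B != 7.
Proof.
move=> I10 nxy c2; have [t1 [t2 [n12 [nxt1 nyt1 nxt2 nyt2] T1I T2I [onlyS le1 le6 cnt]]]] :=
  codegree2_data nxy c2.
have c12 : cI t1 t2 = 2.
  by apply/eqP; rewrite eqn_leq cI2 //=; move: le1 le6 cnt; rewrite I10; card_lia.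
have /eqP/cards2P [D1 [D2 [nD eO]]] : #|edges_off (edges_off I x) y| = 2.
  by move: le1 le6 cnt; rewrite I10 c12; card_lia.
have XY6 : #|side x y| + #|side y x| = 6.
  by move: le1 le6 cnt; rewrite I10 c12; card_lia.
have inO D : (D \in edges_off (edges_off I x) y) = (D == D1) || (D == D2) by rewrite eO !inE.
have := inO D1; rewrite eqxx !in_edges_off => /andP [/andP [D1I xD1] yD1].
have := inO D2; rewrite eqxx orbT !in_edges_off => /andP [/andP [D2I xD2] yD2].
have t1D1 := meet_third T1I D1I xD1 yD1; have t2D1 := meet_third T2I D1I xD1 yD1.
have t1D2 := meet_third T1I D2I xD2 yD2; have t2D2 := meet_third T2I D2I xD2 yD2.
have [s [n1s n2s eD1]] := thirdP n12 D1I t1D1 t2D1.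
have [s' [n1s' n2s' eD2]] := thirdP n12 D2I t1D2 t2D2.
have nss : s != s' by apply: contraNneq nD => ess; rewrite eD1 eD2 ess.
have sD1 : s \in D1 by rewrite eD1 !inE eqxx orbT.
have sD2 : s' \in D2 by rewrite eD2 !inE eqxx orbT.
have nxs : x != s by apply: contraNneq xD1 => ->.
have nxs' : x != s' by apply: contraNneq xD2 => ->.
have nys : y != s by apply: contraNneq yD1 => ->.
have nys' : y != s' by apply: contraNneq yD2 => ->.
(* A side edge avoiding [t1] and [t2] meets D1 = {t1, t2, s} and D2 = {t1, t2, s'} only in [s] and
   [s']. *)
have hitD a b e : (a == x) || (a == y) -> e \in side a b -> [|| t1 \in e, t2 \in e | e == [set s; s']].
  move=> axy eX; have /sideP [C CI [aC bC eC]] := eX.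
  have naD1 : a \notin D1 by case/orP: axy => /eqP ->.
  have naD2 : a \notin D2 by case/orP: axy => /eqP ->.
  have off z D : a \notin D -> z \in D -> z \in C -> z \in e.
    by move=> aD zD zC; rewrite eC !inE zC andbT; apply: contraNneq aD => <-.
  have [t1e|t1e] //= := boolP (t1 \in e); have [t2e|t2e] //= := boolP (t2 \in e).
  have se : s \in e.
    have /pred0Pn [z /= /andP [zC zD]] := iI CI D1I; have := off z D1 naD1 zD zC.
    move: zD; rewrite eD1 !inE => /orP [/orP [] | ] /eqP -> // ze.
      by rewrite ze in t1e.
    by rewrite ze in t2e.
  have se' : s' \in e.
    have /pred0Pn [z /= /andP [zC zD]] := iI CI D2I; have := off z D2 naD2 zD zC.
    move: zD; rewrite eD2 !inE => /orP [/orP [] | ] /eqP -> // ze.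
      by rewrite ze in t1e.
    by rewrite ze in t2e.
  rewrite eq_sym eqEcard cards2 nss (side_uniform eX) andbT.
  by apply/subsetP => z; rewrite !inE => /orP [] /eqP ->.
have le3 a b : (a == x) || (a == y) ->
    #|side a b| <= deg (side a b) t1 + deg (side a b) t2 + ([set s; s'] \in side a b).
  move=> axy; apply: leq_trans (_ : #|star (side a b) t1 :|: star (side a b) t2 :|:
     (side a b :&: [set [set s; s']])| <= _).
    apply/subset_leq_card/subsetP => e eX; move: (hitD a b e axy eX).
    by rewrite !in_setU !in_star in_setI eX !inE /= orbA.
  apply: leq_trans (leq_card_setU _ _) _; apply: leq_add; first exact: leq_card_setU.
  have [ssX|ssX] := boolP (_ \in _).
    by rewrite (leq_trans (subset_leq_card (subsetIr _ _))) ?cards1.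
  rewrite leqn0 cards_eq0; apply/eqP/setP => e; rewrite !inE.
  by apply/negP => /andP [eX /eqP ee]; rewrite -ee eX in ssX.
have nt1x := neq_sym nxt1; have nt1y := neq_sym nyt1.
have nt2x := neq_sym nxt2; have nt2y := neq_sym nyt2.
(* The member {x, y, t1} uses up one of the two members through [x] and [t1]. Each side thus has at
   most 1 + 1 + 1 edges, and the total 6 forces equality. *)
have dx1 : deg (side x y) t1 <= 1.
  by rewrite -ltnS (leq_trans (deg_side_lt nt1x nt1y T1I)) ?cI2.
have dx2 : deg (side x y) t2 <= 1.
  by rewrite -ltnS (leq_trans (deg_side_lt nt2x nt2y T2I)) ?cI2.
have dy1 : deg (side y x) t1 <= 1.
  by rewrite -ltnS (leq_trans (deg_side_lt nt1y nt1x _)) ?cI2 // set3C12.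
have dy2 : deg (side y x) t2 <= 1.
  by rewrite -ltnS (leq_trans (deg_side_lt nt2y nt2x _)) ?cI2 // set3C12.
have lex := le3 x y; have ley := le3 y x; rewrite !eqxx ?orbT in lex ley.
move: (lex isT) (ley isT) => {lex ley}.
have [ssX|_] := boolP ([set s; s'] \in side x y); last by move: dx1 dx2 dy1 dy2 XY6;
  case: (_ \in _); card_lia.
have [ssY|_] := boolP ([set s; s'] \in side y x); last by move: dx1 dx2 dy1 dy2 XY6; card_lia.
move=> lex ley.
have X3 : #|side x y| = 3 by move: lex ley dx1 dx2 dy1 dy2 XY6; card_lia.
have {dx1}dx1 : deg (side x y) t1 = 1 by move: lex ley dx1 dx2 dy1 dy2 XY6; card_lia.
have {dx2}dx2 : deg (side x y) t2 = 1 by move: lex ley dx1 dx2 dy1 dy2 XY6; card_lia.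
have one t : t \in [set t1; t2] -> deg (side x y) t = 1 -> exists p, [/\ (p == s) || (p == s'),
    [set t; p] \in side x y & forall e, e \in side x y -> t \in e -> e = [set t; p]].
  move=> tT /eqP/cards1P [e ee].
  have : e \in [set e in side x y | t \in e] by rewrite ee inE.
  move=> /setIdP [eX te]; have [p npt ep] := edge_split (@side_uniform x y) eX te.
  exists p; split; rewrite -?ep //.
    have /pred0Pn [z /= /andP [ze]] := side_cross nxy eX ssY.
    rewrite ep !inE in ze *; case/orP: ze => /eqP -> //.
    by move: tT; rewrite !inE => /orP [] /eqP ->;
       rewrite ?(negbTE n1s) ?(negbTE n1s') ?(negbTE n2s) ?(negbTE n2s').
  move=> f fX tf; have : f \in [set e in side x y | t \in e] by apply/setIdP.
  by rewrite ee inE => /eqP.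
have [p [ps pX onlyp]] := one t1 (set21 _ _) dx1.
have [q [qs qX onlyq]] := one t2 (set22 _ _) dx2.
have nt1p : t1 != p by case/orP: ps => /eqP ->.
have nt2p : t2 != p by case/orP: ps => /eqP ->.
have nt1q : t1 != q by case/orP: qs => /eqP ->.
have nt2q : t2 != q by case/orP: qs => /eqP ->.
have nxp : x != p by case/orP: ps => /eqP ->.
have nxq : x != q by case/orP: qs => /eqP ->.
have nyp : y != p by case/orP: ps => /eqP ->.
have nyq : y != q by case/orP: qs => /eqP ->.
(* A common end would have degree 3 in [side x y]. The 5-cycle is y, t1, p, q, t2. *)
have npq : p != q.
  apply/eqP => epq; have := deg_side_le2 x y p; rewrite leqNgt => /negP; apply.
  have us : uniq [:: [set t1; p]; [set t2; p]; [set s; s']].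
    rewrite /= !inE !negb_or !andbT -andbA; apply/and3P; split; apply/eqP => /setP.
    - by move/(_ t1); rewrite !inE eqxx (negbTE n12) (negbTE nt1p).
    - by move/(_ t1); rewrite !inE eqxx (negbTE n1s) (negbTE n1s').
    - by move/(_ t2); rewrite !inE eqxx (negbTE n2s) (negbTE n2s').
  rewrite -[3]/(size [:: [set t1; p]; [set t2; p]; [set s; s']]) -(card_uniqP us).
  apply/subset_leq_card/subsetP => e.
  rewrite !inE => /or3P [] /eqP ->; apply/andP; split=> //.
  - by rewrite !inE eqxx orbT.
  - by rewrite epq.
  - by rewrite !inE eqxx orbT.
  - by rewrite !inE.
have ess : [set s; s'] = [set p; q].
  move: npq; case/orP: ps => /eqP ->; case/orP: qs => /eqP ->; rewrite ?eqxx //.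
  by rewrite setUC.
have liftE e a b : e = [set a; b] -> e \in side x y -> x |: e = [set x; a; b] /\ [set x; a; b] \in I.
  move=> -> /sideP [C CI [xC yC eC]].
  have -> : x |: [set a; b] = [set x; a; b] by rewrite setUA.
  by split=> //; rewrite -setUA eC setD1K.
have [_ t1pI] := liftE _ _ _ erefl pX.
have [_ t2qI] := liftE _ _ _ erefl qX.
have [_ pqI] := liftE _ _ _ ess ssX.
have pent : pentagon x y t1 p q t2.
  split; [|exact: IF..|].
    rewrite /= !inE !negb_or nxy nxt1 nxp nxq nxt2 nyt1 nyp nyq nyt2 nt1p nt1q n12 npq /=.
    by rewrite (eq_sym p) nt2p (eq_sym q) nt2q.
  by split; rewrite set3C23; exact: IF.
move=> BI xB; apply: (pentagon_all pent); rewrite !inE.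
have [yB|yB] := boolP (y \in B).
  case: (onlyS _ BI xB yB) => ->; first by rewrite eqxx.
  by rewrite (set3C23 x t2) eqxx !orbT.
have eX := mem_side BI xB yB; have eB : B = x |: B :\ x by rewrite setD1K.
have := hitD x y (B :\ x) _ eX; rewrite eqxx => /(_ isT) /or3P [].
- move=> t1e; have := onlyp _ eX t1e => e1; rewrite eB e1.
  by rewrite (setUA [set x]) eqxx !orbT.
- move=> t2e; have := onlyq _ eX t2e => e1; rewrite eB e1.
  by rewrite (setUC [set t2]) (setUA [set x]) eqxx !orbT.
- move=> /eqP e1; rewrite eB e1 ess.
  by rewrite (setUA [set x]) eqxx !orbT.
Qed.

(** Some vertex of {x, y, t1} has 7 private edges, yet each of the three belongs to a pair of
    codegree 2: {x, y} or {t1, t2}. *)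
Lemma codegree2_pair x y : x != y -> cI x y = 2 -> #|I| = 10 ->
  (forall A, A \in I -> 23 < N A) -> False.
Proof.
move=> nxy c2 I10 N24.
have [t1 [t2 [n12 [nxt1 nyt1 nxt2 nyt2] T1I T2I [onlyS le1 le6 cnt]]]] :=
  codegree2_data nxy c2.
have c12 : cI t1 t2 = 2.
  by apply/eqP; rewrite eqn_leq cI2 //=; move: le1 le6 cnt; rewrite I10; card_lia.
have [v vA hv] := hit24_max (IF T1I) (N24 _ T1I).
have c2' : cI y x = 2 by rewrite codegC.
move: hv; apply/eqP; move: (vA); rewrite !inE => /orP [/orP [] | ] /eqP ev; rewrite ev in vA *.
- exact: (codegree2_pentagon I10 nxy c2).
- exact: (codegree2_pentagon I10 (neq_sym nxy) c2').
- exact: (codegree2_pentagon I10 n12 c12).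
Qed.

End Codegree2.

Lemma nonstar_intersecting : nonstar ->
  #|I| <= 10 /\ (#|I| = 10 -> (forall A, A \in I -> 23 < N A) -> False).
Proof.
move=> ns.
have [/existsP [x /existsP [y /andP [nxy /eqP off0]]] | noc] :=
  boolP [exists x, exists y, (x != y) && (edges_off (edges_off I x) y == set0)].
  exact: covered_pair nxy ns off0.
have nc : nocover.
  move=> x y nxy; move: noc; rewrite negb_exists => /forallP /(_ x).
  rewrite negb_exists => /forallP /(_ y); rewrite nxy => /set0Pn [D].
  by rewrite !in_edges_off => /andP [/andP [? ?] ?]; exists D.
have [/existsP [x /existsP [y /andP [nxy /eqP c3]]] | no3] :=
  boolP [exists x, exists y, (x != y) && (cI x y == 3)].
  exact: codegree3_pair nxy nc c3.
have cI2 u v : u != v -> cI u v <= 2.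
  move=> nuv; have := leq_trans (codegI_le u v) (codeg_le3 uF sF nuv).
  move: no3; rewrite negb_exists => /forallP /(_ u).
  rewrite negb_exists => /forallP /(_ v); rewrite nuv /=.
  by rewrite (leq_eqVlt _ 3) => /negbTE ->.
have [/existsP [x /existsP [y /andP [nxy /eqP c2]]] | no2] :=
  boolP [exists x, exists y, (x != y) && (cI x y == 2)].
  split; first exact: (codegree2_le10 nc cI2 nxy c2).
  by move=> I10; exact: (codegree2_pair nc cI2 nxy c2 I10).
have c1 u v : u != v -> cI u v <= 1.
  move=> nuv; have := cI2 _ _ nuv.
  move: no2; rewrite negb_exists => /forallP /(_ u).
  rewrite negb_exists => /forallP /(_ v); rewrite nuv /=.
  by rewrite (leq_eqVlt _ 2) => /negbTE ->.
have le7 := small_codegrees ns c1.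
by split=> [|I10]; [exact: leq_trans le7 _ | rewrite I10 in le7].
Qed.

End NonStar.

(** * Minimal disjoint triples *)

Section Main.

Variables (T : finType) (F : {set {set T}}).
Hypothesis uF : uniform 3 F.
Hypothesis sF : sunflower_free3 F.
Implicit Types (A B C D W X Y : {set T}) (u v w x y z : T).

Notation d := (deg F).
Notation cd := (codeg F).
Notation N A := #|hit F A|.
Notation h v A := #|priv F v A|.


Lemma offP W B : reflect (B \in F /\ [disjoint B & W]) (B \in off F W).
Proof. by rewrite inE; apply: andP. Qed.

Lemma disjointU B A C : [disjoint B & A :|: C] = [disjoint B & A] && [disjoint B & C].
Proof. by rewrite -!setI_eq0 setIUr setU_eq0. Qed.

Lemma edge_self A : A \in F -> ~~ [disjoint A & A].
Proof. by move=> AF; rewrite -setI_eq0 setIid -card_gt0 uF. Qed.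

Lemma no_4_disjoint A B C D : A \in F -> B \in F -> C \in F -> D \in F ->
  [disjoint A & B] -> [disjoint A & C] -> [disjoint A & D] ->
  [disjoint B & C] -> [disjoint B & D] -> [disjoint C & D] -> False.
Proof.
move=> AF BF CF DF AB AC AD BC BD CD.
have neq X Y : X \in F -> [disjoint X & Y] -> X != Y.
  by move=> XF; apply: contraTneq => <-; exact: edge_self.
have us : uniq [:: A; B; C; D] by rewrite /= !inE !negb_or !neq.
have : #|[set X in [:: A; B; C; D]]| <= 3; last by rewrite cardsE (card_uniqP us).
apply: (sF (C := set0)) => [|X Y].
  by apply/subsetP => X; rewrite !inE => /or4P [] /eqP ->.
rewrite !inE => /or4P [] /eqP -> /or4P [] /eqP ->; rewrite ?eqxx // => _;
  apply/eqP; rewrite setI_eq0 //; by rewrite disjoint_sym.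
Qed.

Lemma off_intersecting A B : A \in F -> B \in F -> [disjoint A & B] ->
  intersecting (off F (A :|: B)).
Proof.
move=> AF BF dAB C D /offP [CF +] /offP [DF]; rewrite !disjointU.
move=> /andP [CA CB] /andP [DA DB]; apply/negP => CD.
exact: (no_4_disjoint CF DF AF BF).
Qed.

Lemma deg_star_off W x : (forall D, D \in off F W -> x \in D) -> #|off F W| <= d x.
Proof.
move=> all; apply/subset_leq_card/subsetP => D DI; rewrite in_star all // andbT.
by case/offP: DI.
Qed.

Lemma star_or_nonstar W : (exists x, forall D, D \in off F W -> x \in D) \/
  nonstar F W.
Proof.
have [/existsP [x /forallP all] | no] :=
  boolP [exists x, [forall D : {set T}, (D \in off F W) ==> (x \in D)]].
  by left; exists x => D DI; move: (all D); rewrite DI.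
right=> x; move: no; rewrite negb_exists => /forallP /(_ x).
by rewrite negb_forall => /existsP [D]; rewrite negb_imply => /andP [DI xD]; exists D.
Qed.

Lemma off_le10 W : intersecting (off F W) -> #|off F W| <= 10.
Proof.
move=> iI; have [[x all]|ns] := star_or_nonstar W; last first.
  exact: (proj1 (nonstar_intersecting uF sF iI ns)).
exact: leq_trans (deg_star_off all) (deg_le10 uF sF x).
Qed.

(** By minimality, N(A) = 25 makes N equal to 25 on the whole family, and N(A) = 24 gives the lower
    bound under which a family of 10 members must have a common vertex. *)
Lemma off_local W A : intersecting (off F W) -> A \in off F W ->
  (forall B, B \in off F W -> N A <= N B) ->
  [/\ N A <= 25, #|off F W| <= 10, N A = 25 -> #|off F W| <= 6 &
     N A = 24 -> #|off F W| = 10 -> exists x, forall D, D \in off F W -> x \in D].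
Proof.
move=> iI AI minA; have sub : off F W \subset F by apply/subsetP => B /offP [].
split.
- by apply: hit_le25 => //; case/offP: AI.
- exact: off_le10.
- move=> NA; apply: (intersecting_hit25 uF sF sub iI) => B BI.
  apply/eqP; rewrite eqn_leq -{2}NA minA // andbT; apply: hit_le25 => //.
  exact: (subsetP sub).
- move=> NA n10; have [//|ns] := star_or_nonstar W; exfalso.
  apply: (proj2 (nonstar_intersecting uF sF iI ns)) => // B BI.
  by rewrite -NA minA.
Qed.

Definition disjoint3 A B C := [&& A \in F, B \in F, C \in F,
  [disjoint A & B], [disjoint A & C] & [disjoint B & C]].

Definition minimal3 A B C := disjoint3 A B C /\
  forall A' B' C', disjoint3 A' B' C' -> N A + N B + N C <= N A' + N B' + N C'.

Lemma disjoint3C12 A B C : disjoint3 A B C -> disjoint3 B A C.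
Proof.
move=> /and5P [AF BF CF AB /andP [AC BC]].
by rewrite /disjoint3 AF BF CF AC BC [[disjoint B & A]]disjoint_sym AB.
Qed.

Lemma disjoint3C23 A B C : disjoint3 A B C -> disjoint3 A C B.
Proof.
move=> /and5P [AF BF CF AB /andP [AC BC]].
by rewrite /disjoint3 AF BF CF AC AB [[disjoint C & B]]disjoint_sym BC.
Qed.

Lemma minimal3C12 A B C : minimal3 A B C -> minimal3 B A C.
Proof.
by case=> d3 m; split=> [|A' B' C']; [exact: disjoint3C12 | rewrite (addnC (N B)); exact: m].
Qed.

Lemma minimal3C23 A B C : minimal3 A B C -> minimal3 A C B.
Proof.
by case=> d3 m; split=> [|A' B' C']; [exact: disjoint3C23 | rewrite addnAC; exact: m].
Qed.

(** Replacing [A] by an edge disjoint from [B] and [C] gives another disjoint triple. *)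
Lemma minimal3_local A B C : minimal3 A B C ->
  [/\ N A <= 25, #|off F (B :|: C)| <= 10, N A = 25 -> #|off F (B :|: C)| <= 6 &
     N A = 24 -> #|off F (B :|: C)| = 10 ->
     exists x, forall D, D \in off F (B :|: C) -> x \in D].
Proof.
case=> /and5P [AF BF CF AB /andP [AC BC]] m; apply: off_local.
- exact: off_intersecting.
- by apply/offP; rewrite disjointU AB AC.
move=> D /offP [DF]; rewrite disjointU => /andP [DB DC].
have := m D B C; rewrite /disjoint3 DF BF CF DB DC BC => /(_ isT).
by rewrite -!addnA leq_add2r.
Qed.

Lemma card_sum (p : pred {set T}) : #|[set B in F | p B]| = \sum_(B in F) (p B : nat).
Proof.
rewrite -sum1_card big_mkcond [RHS]big_mkcond /=.
by apply: eq_bigr => B _; rewrite inE; case: (B \in F); case: (p B).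
Qed.

Definition hit3 A B C := [set D in F | [&& ~~ [disjoint D & A], ~~ [disjoint D & B] & ~~ [disjoint D & C]]].

Lemma meets_one A B C D : disjoint3 A B C -> D \in F ->
  [&& [disjoint D & A], [disjoint D & B] & [disjoint D & C]] = false.
Proof.
move=> /and5P [AF BF CF AB /andP [AC BC]] DF; apply/negP => /and3P [DA DB DC].
exact: (no_4_disjoint DF AF BF CF).
Qed.

(** An edge meets j = 1, 2 or 3 of the three; it contributes j to the N terms, one more on the right
    if j = 1, and one more on the left if j = 3. *)
Lemma double_count A B C : disjoint3 A B C ->
  2 * #|F| + #|hit3 A B C| = N A + N B + N C +
    (#|off F (B :|: C)| + #|off F (A :|: C)| + #|off F (A :|: B)|).
Proof.
move=> d3; rewrite /off /hit /hit3 !card_sum -[X in 2 * X]sum1_card big_distrr -!big_split /=.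
apply: eq_bigr => D DF; have := meets_one d3 DF; rewrite !disjointU.
by do 3!case: [disjoint D & _].
Qed.

Definition hit2 A B C := [set D in F | [&& ~~ [disjoint D & A], ~~ [disjoint D & B] & [disjoint D & C]]].

Lemma hit2_count A B C : disjoint3 A B C ->
  #|F| = N C + #|off F (B :|: C)| + #|off F (A :|: C)| + #|hit2 A B C|.
Proof.
move=> d3; rewrite /off /hit /hit2 !card_sum -sum1_card -!big_split /=.
apply: eq_bigr => D DF; have := meets_one d3 DF; rewrite !disjointU.
by do 3!case: [disjoint D & _].
Qed.

Lemma star_off W x : (forall D, D \in off F W -> x \in D) -> #|off F W| = 10 ->
  d x = 10 /\ forall D, D \in F -> x \in D -> D \in off F W.
Proof.
move=> all n10; have dx : d x = 10.
  by apply/eqP; rewrite eqn_leq deg_le10 // -n10 deg_star_off.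
split=> // D DF xD; have -> : off F W = star F x.
  apply/eqP; rewrite eqEcard n10 -dx leqnn andbT; apply/subsetP => B BI.
  by rewrite in_star all // andbT; case/offP: BI.
by rewrite in_star DF.
Qed.

(* r has at most two vertices outside W, each on at most 3 of the 10 edges. *)
Lemma star_avoid W x r : (forall D, D \in off F W -> x \in D) -> #|off F W| = 10 ->
  r \in F -> x \notin r -> ~~ [disjoint r & W] ->
  3 < #|link [set D in off F W | [disjoint D & r]] x|.
Proof.
move=> all n10 rF xr /pred0Pn [a /= /andP [ar aW]].
have [b [c [nab nac nbc er]]] := set3P (uF rF) ar.
have xb : x != b by apply: contraNneq xr => ->; rewrite er !inE eqxx orbT.
have xc : x != c by apply: contraNneq xr => ->; rewrite er !inE eqxx orbT.
have le3 z : x != z -> #|[set D in off F W | z \in D]| <= 3.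
  move=> nxz; apply: leq_trans (codeg_le3 uF sF nxz).
  apply/subset_leq_card/subsetP => D /setIdP [DI zD].
  by rewrite inE in_star all // zD !andbT; case/offP: DI.
rewrite card_link.
have -> : star [set D in off F W | [disjoint D & r]] x = [set D in off F W | [disjoint D & r]].
  by apply/setP => D; rewrite in_star; apply: andb_idr => /setIdP [/all].
have sub : off F W \subset [set D in off F W | [disjoint D & r]] :|:
   ([set D in off F W | b \in D] :|: [set D in off F W | c \in D]).
  apply/subsetP => D DI; rewrite !in_setU !in_set -/(off F W).
  have [DF dDW] := offP _ _ DI; rewrite DF dDW /=.
  have [//|/pred0Pn [z /= /andP [zD]]] := boolP [disjoint D & r].
  rewrite er !inE => /orP [/orP [] | ] /eqP ez; rewrite ez in zD; rewrite ?zD ?orbT //.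
  by have /pred0P/(_ a)/= := dDW; rewrite zD aW.
have := subset_leq_card sub; rewrite n10 => le10.
have := leq_trans le10 (leq_card_setU _ _).
have := (leq_card_setU [set D in off F W | b \in D] [set D in off F W | c \in D]).1.
have := le3 _ xb; have := le3 _ xc; card_lia.
Qed.

(** Members of the two stars that avoid [r] must meet, or with [r] and [C] they would be four
    disjoint edges. Their links at [x] and [y] are thus cross-intersecting, with at least 4 edges
    each by [star_avoid], against [cross_le6]. *)
Lemma two_stars A B C x y r : disjoint3 A B C ->
  (forall D, D \in off F (B :|: C) -> x \in D) -> #|off F (B :|: C)| = 10 ->
  (forall D, D \in off F (A :|: C) -> y \in D) -> #|off F (A :|: C)| = 10 ->
  r \in hit2 A B C -> False.
Proof.
move=> d3 allx nx ally ny /setIdP [rF /and3P [rA rB rC]].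
have /and5P [AF BF CF AB /andP [AC BC]] := d3.
have [_ fx] := star_off allx nx; have [_ fy] := star_off ally ny.
have xr : x \notin r.
  by apply/negP => /(fx _ rF)/offP [_]; rewrite disjointU (negbTE rB).
have yr : y \notin r.
  by apply/negP => /(fy _ rF)/offP [_]; rewrite disjointU (negbTE rA).
have xA : x \in A by apply: allx; apply/offP; rewrite disjointU AB AC.
have X4 := star_avoid allx nx rF xr.
have Y4 := star_avoid ally ny rF yr.
rewrite !disjointU (negbTE rB) /= in X4; rewrite !disjointU (negbTE rA) /= in Y4.
set X := link _ x in X4; set Y := link _ y in Y4.
have sub W : [set D in off F W | [disjoint D & r]] \subset F.
  by apply/subsetP => D /setIdP [/offP []].
have cXY : cross X Y.
  move=> e f /imsetP [D + ->] /imsetP [E + ->]; rewrite !in_star.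
  move=> /andP [/setIdP [DI Dr] xD] /andP [/setIdP [EI Er] yE].
  have [DF dD] := offP _ _ DI; have [EF dE] := offP _ _ EI.
  move: dD dE; rewrite !disjointU => /andP [DB DC] /andP [EA EC].
  have : ~~ [disjoint D & E].
    by apply/negP => DE; apply: (no_4_disjoint DF EF rF CF).
  move=> /pred0Pn [z /= /andP [zD zE]]; apply/pred0Pn; exists z; rewrite /= !inE zD zE !andbT.
  apply/andP; split; apply/eqP => ez; rewrite ez in zD zE.
    by have /pred0P/(_ x)/= := EA; rewrite zE xA.
  have := fy _ DF zD => /offP [_]; rewrite disjointU => /andP [DA _].
  by have /pred0P/(_ x)/= := DA; rewrite xD xA.
have {}X4 := X4 isT; have {}Y4 := Y4 isT.
have : #|X| + #|Y| <= 6.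
  apply: cross_le6 cXY (ltnW (ltnW X4)) (ltnW (ltnW Y4)).
  - exact: (link_uniform uF (v := x) (sub _)).
  - exact: (link_uniform uF (v := y) (sub _)).
  - exact: (link_subcubic uF sF x (sub _)).
  - exact: (link_subcubic uF sF y (sub _)).
by rewrite leqNgt (leq_trans _ (leq_add X4 Y4)).
Qed.

Definition only_hit v A B := [set D in F | [&& v \in D, ~~ [disjoint D & A] & [disjoint D & B]]].

(* This counts 7 pairs on 5 points that are split into parts of sizes o,      *)
(* a - o and b - o: no pair lies in the first part or joins the other two,    *)
(* and r2 (r3) of the pairs meet the second (third) part.                     *)
Lemma pairs_on_five o a b r2 r3 : a + b = 5 + o -> o <= a -> o <= b -> r2 + r3 = 7 ->
  r2 + 'C(o, 2) <= 'C(a, 2) -> r3 + 'C(o, 2) <= 'C(b, 2) ->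
  (r2 <= 2) || (r3 <= 2).
Proof.
move=> ab oa ob.
have [b0 b1 b2 b3] : [/\ 'C(0, 2) = 0, 'C(1, 2) = 0, 'C(2, 2) = 1 & 'C(3, 2) = 3] by [].
have [b4 b5] : 'C(4, 2) = 6 /\ 'C(5, 2) = 10 by [].
have la : a <= 5 by move: ab ob; clear; lia.
have lb : b <= 5 by move: ab oa; clear; lia.
move: a la b lb o ab oa ob => [|[|[|[|[|[|//]]]]]] _ [|[|[|[|[|[|//]]]]]] _ [|[|[|[|[|[|o]]]]]] //;
by rewrite ?b0 ?b1 ?b2 ?b3 ?b4 ?b5; clear; lia.
Qed.

(** In the 7-edge graph on [V], the pairs missing [Y] lie in V minus [Y], and none lies in the part
    [O] outside both sets, since it would miss both. The same holds for [X], and [pairs_on_five]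
    applies. *)
Lemma priv7_split v B X Y : B \in F -> v \in B -> h v B = 7 -> [disjoint X & Y] ->
  v \notin X -> v \notin Y ->
  (forall C, C \in priv F v B -> [disjoint C & X] = ~~ [disjoint C & Y]) ->
  (#|[set C in priv F v B | [disjoint C & Y]]| <= 2) ||
  (#|[set C in priv F v B | [disjoint C & X]]| <= 2).
Proof.
move=> BF vB h7 dXY vX vY alt.
have [_ _ [V V5 subV]] := priv7_structure uF sF BF vB h7.
pose O := V :\: (X :|: Y).
have half X' Y' : v \notin X' -> V :\: (X' :|: Y') = O ->
    (forall C, C \in priv F v B -> [disjoint C & X'] = ~~ [disjoint C & Y']) ->
    #|[set C in priv F v B | [disjoint C & Y']]| + 'C(#|O|, 2) <= 'C(#|V :\: Y'|, 2).
  move=> vX' eO alt'; pose S := [set C in priv F v B | [disjoint C & Y']].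
  have inj : {in S &, injective (fun C => C :\ v)}.
    move=> C D /setIdP [/privP [_ vC _ _] _] /setIdP [/privP [_ vD _ _] _] e.
    by rewrite -(setD1K vC) e setD1K.
  rewrite -/S -(card_in_imset inj) -!cards_draws.
  have I0 : [set C :\ v | C in S] :&: [set e : {set T} | (e \subset O) && (#|e| == 2)] = set0.
    apply/eqP; rewrite setI_eq0; apply/pred0P => e /=; apply/negP.
    move=> /andP [/imsetP [C /setIdP [CP CY] ->] /[!inE] /andP [/subsetP sO _]].
    have := alt' _ CP; rewrite CY => /negP; apply; apply/pred0P => z /=.
    apply/negP => /andP [zC zX]; have zv : z != v by apply: contraNneq vX' => <-.
    have : z \in O by apply: sO; rewrite !inE zv.
    by rewrite -eO !inE zX.
  rewrite -cardsUI I0 cards0 addn0.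
  apply/subset_leq_card/subsetP => e; rewrite !inE.
  case/orP => [/imsetP [C /setIdP [CP /pred0P CY] ->] | /andP [/subsetP sO ->]]; last first.
    by rewrite andbT; apply/subsetP => z /sO; rewrite -eO !inE negb_or -andbA => /and3P [_ -> ->].
  have [CF vC _ _] := privP CP; have := cardsD1 v C; rewrite vC (uF CF) add1n => -[<-].
  rewrite eqxx andbT; apply/subsetP => z; rewrite !inE => /andP [nzv zC].
  have /(subsetP (subV _ CP)) := zC; rewrite !inE (negbTE nzv) /= => ->; rewrite andbT.
  by apply/negP => zY; have := CY z; rewrite /= zC zY.
have hX := half _ _ vX erefl alt.
have hY : #|[set C in priv F v B | [disjoint C & X]]| + 'C(#|O|, 2) <= 'C(#|V :\: X|, 2).
  apply: (half Y X) => //; first by rewrite setUC.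
  by move=> C CP; rewrite alt // negbK.
apply: pairs_on_five hX hY.
- have := cardsUI (V :\: Y) (V :\: X).
  have -> : (V :\: Y) :|: (V :\: X) = V.
    apply/setP => z; rewrite !inE; have [zV|] := boolP (z \in V); rewrite ?andbF // !andbT.
    by have := pred0P dXY z; rewrite /=; case: (z \in X); case: (z \in Y).
  have -> : (V :\: Y) :&: (V :\: X) = O.
    apply/setP => z; rewrite !inE negb_or.
    by case: (z \in X); case: (z \in Y); case: (z \in V).
  by rewrite V5.
- by apply/subset_leq_card/subsetP => z; rewrite !inE negb_or -andbA => /and3P [_ -> ->].
- by apply/subset_leq_card/subsetP => z; rewrite !inE negb_or -andbA => /and3P [-> _ ->].
rewrite -h7 -(cardsID [set C : {set T} | [disjoint C & Y]] (priv F v B)); congr addn.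
  by apply: eq_card => C; rewrite !inE.
apply: eq_card => C; apply/setIdP/setDP => [[CP CX] | [CP CY]]; split=> //.
  by rewrite inE -alt.
by rewrite alt //; move: CY; rewrite inE.
Qed.

(** * The exceptional star *)

Section BadStar.

Variables (A1 A2 A3 : {set T}) (x : T).
Hypothesis F50 : #|F| = 50.
Hypothesis min : minimal3 A1 A2 A3.
Hypothesis N24 : N A1 = 24.
Hypothesis I10 : #|off F (A2 :|: A3)| = 10.
Hypothesis allx : forall D, D \in off F (A2 :|: A3) -> x \in D.

Notation I := (off F (A2 :|: A3)).

Let dx : d x = 10. Proof. by have [] := star_off allx I10. Qed.

Let starI D : D \in F -> x \in D -> D \in I.
Proof. by have [_] := star_off allx I10; apply. Qed.

Let ge24 B : B \in I -> 23 < N B.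
Proof.
move=> /offP [BF]; rewrite disjointU => /andP [B2 B3].
have [/and5P [_ F2 F3 _ /andP [_ d23]] m] := min.
have d3 : disjoint3 B A2 A3 by rewrite /disjoint3 BF F2 F3 B2 B3 d23.
by have := m _ _ _ d3; rewrite -!addnA leq_add2r N24.
Qed.

Let minI B : B \in I -> N B = 24 -> minimal3 B A2 A3.
Proof.
move=> /offP [BF]; rewrite disjointU => /andP [B2 B3] NB.
have [/and5P [_ F2 F3 _ /andP [_ d23]] m] := min.
by split=> [|A' B' C' d']; [rewrite /disjoint3 BF F2 F3 B2 B3 d23 | rewrite NB -N24; exact: m].
Qed.

Let offx D : D \in F -> x \in D -> [disjoint D & A2] && [disjoint D & A3].
Proof. by move=> DF /(starI DF)/offP [_]; rewrite disjointU. Qed.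

(** The linear system with N >= 24 and d x = 10 settles everything except [cd x p] = 2 with [cd p q]
    > 1. *)
Lemma star_edge_codegrees p q : x != p -> x != q -> p != q ->
  [set x; p; q] \in F -> cd x q = 3 ->
  cd x p = 3 \/ (cd x p = 2 /\
    forall z, z != p -> z != x -> [set x; p; z] \in F -> cd x z = 3) ->
  [/\ cd p q = 1, N [set x; p; q] = 24, h p [set x; p; q] = 7 & h q [set x; p; q] = 7].
Proof.
move=> nxp nxq npq BF cq.
have xB z w : x \in [set x; z; w] by rewrite !inE eqxx.
have NB := ge24 (starI BF (xB p q)).
have [p0 cnt] := triple_count uF sF nxp nxq npq BF.
case=> [cp | [cp c3]].
  by move: cnt NB; rewrite dx cp cq; clear; split; lia.
have [c1|nc1] := eqVneq (cd p q) 1.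
  by move: cnt NB; rewrite dx cp cq c1; clear; split; lia.
have [dp hp] : d p = 10 /\ h p [set x; p; q] = 7.
  by move: cnt NB nc1; rewrite dx cp cq; clear; split; lia.
(* For the second edge {x, p, r} through [x] and [p], the bound 24 forces [cd p r] = 2, so another
   edge [B2] contains [p] and [r]. It avoids [q], since {p, q, r} would be disjoint from [A2] and
   [A3] and so contain [x]. Hence [B2] is private to [p] in {x, p, q}, and [r] needs a second
   private edge there; but {x, p, r}, the only other edge through [p] and [r], is not private. *)
exfalso.
have pB : p \in [set x; p; q] by rewrite !inE eqxx orbT.
have qB : q \in [set x; p; q] by rewrite !inE eqxx orbT.
have [B1 [B1F xB1 pB1 nB1]] : exists B1, [/\ B1 \in F, x \in B1, p \in B1 & B1 != [set x; p; q]].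
  have : 0 < #|star (star F x) p :\ [set x; p; q]|.
    have := cardsD1 [set x; p; q] (star (star F x) p).
    by rewrite !in_star BF xB pB -[#|star _ p|]/(cd x p) cp add1n => -[<-].
  case/card_gt0P => B1; rewrite in_setD1 !in_star => /andP [? /andP [/andP [? ?] ?]].
  by exists B1.
have [r [nxr npr eB1]] : exists r, [/\ x != r, p != r & B1 = [set x; p; r]].
  have [a [b [n1 n2 n3 eB]]] := set3P (uF B1F) xB1.
  have : p \in [set x; a; b] by rewrite -eB.
  rewrite !inE eq_sym (negbTE nxp) /= => /orP [] /eqP ep; rewrite -ep in n1 n2 n3 eB.
    by exists b.
  by exists a; rewrite eq_sym in n3; split=> //; rewrite set3C23.
rewrite eB1 in B1F nB1 xB1 pB1.
have nqr : q != r by apply: contraNneq nB1 => ->.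
have cr : cd x r = 3 by apply: c3; rewrite // eq_sym.
have NB1 := ge24 (starI B1F xB1).
have [p1 cnt1] := triple_count uF sF nxp nxr npr B1F.
have cpr : cd p r = 2 by move: cnt1 NB1; rewrite dx dp cp cr; clear; lia.
have rB1 : r \in [set x; p; r] by rewrite !inE eqxx orbT.
have [B2 [B2F pB2 rB2 nB2]] : exists B2, [/\ B2 \in F, p \in B2, r \in B2 & B2 != [set x; p; r]].
  have : 0 < #|star (star F p) r :\ [set x; p; r]|.
    have := cardsD1 [set x; p; r] (star (star F p) r).
    by rewrite !in_star B1F pB1 rB1 -[#|star _ r|]/(cd p r) cpr add1n => -[<-].
  case/card_gt0P => B2; rewrite in_setD1 !in_star => /andP [? /andP [/andP [? ?] ?]].
  by exists B2.
have off3 D : x \notin D -> D \in F -> p \in D -> q \in D -> r \in D -> False.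
  move=> xD DF pD qD rD; apply: (negP xD); apply: allx.
  apply/offP; split=> //; rewrite (set3_eq (uF DF) npq npr nqr pD qD rD) disjointU.
  have /andP [d2 d3] := offx BF (xB p q); have /andP [e2 e3] := offx B1F xB1.
  have nin W : [disjoint [set x; p; q] & W] -> [disjoint [set x; p; r] & W] ->
     [disjoint [set p; q; r] & W].
    move=> /pred0P dq /pred0P dr; apply/pred0P => z' /=; apply/negP => /andP [].
    rewrite !inE => /orP [/orP [] | ] /eqP -> zW.
    - by have := dq p; rewrite /= zW pB.
    - by have := dq q; rewrite /= zW qB.
    - by have := dr r; rewrite /= zW rB1.
  by rewrite !nin.
have xB2 : x \notin B2.
  apply/negP => xB2; move: nB2; rewrite (set3_eq (uF B2F) nxp nxr npr xB2 pB2 rB2).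
  by rewrite eqxx.
have qB2 : q \notin B2.
  by apply/negP => qB2; exact: (off3 B2).
have B2P : B2 \in priv F p [set x; p; q].
  apply: mem_priv => // u nup; rewrite !inE (negbTE nup) orbF.
  by case/orP => /eqP ->.
have [ge2 _ _] := priv7_structure uF sF BF pB hp.
have := ge2 r (neq_sym npr) (deg_priv_gt0 B2P rB2); rewrite ltnNge -ltnS -cpr => /negP; apply.
apply: proper_card; apply/properP; split.
  apply/subsetP => C /setIdP [CP rC]; have [CF pC _ _] := privP CP.
  by rewrite inE in_star CF pC.
exists [set x; p; r]; first by rewrite inE in_star B1F pB1.
rewrite inE; apply/negP => /andP [/privP [_ _ _ /(_ x)]].
by rewrite !inE !eqxx nxp => /(_ isT isT).
Qed.

(** An edge at [v] meeting [A2] or [A3] avoids [x], and also the other one of [p], [q], as only {x,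
    p, q} contains both. So it is private, and with [hit3] empty each private edge misses exactly
    one of [A2], [A3]. *)
Lemma only_hit_priv p q v : v \in [set p; q] -> x != p -> x != q -> p != q ->
  [set x; p; q] \in F -> cd p q = 1 -> h v [set x; p; q] = 7 ->
  hit3 [set x; p; q] A2 A3 = set0 ->
  (#|only_hit v A2 A3| <= 2) || (#|only_hit v A3 A2| <= 2).
Proof.
move=> vpq nxp nxq npq BF c1 h7 r0; set B := [set x; p; q] in BF h7 r0 *.
have xB : x \in B by rewrite !inE eqxx.
have vB : v \in B by move: vpq; rewrite !inE => /orP [] ->; rewrite !orbT.
have nvx : v != x by move: vpq; rewrite !inE => /orP [] /eqP ->; rewrite eq_sym.
have /andP [B2 B3] := offx BF xB.
have [/and5P [_ F2 F3 _ /andP [_ d23]] _] := min.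
have noW W : [disjoint B & W] -> v \notin W.
  by move=> /pred0P/(_ v)/=; rewrite vB => /negbT.
have notx C : C \in F -> (~~ [disjoint C & A2]) || (~~ [disjoint C & A3]) -> x \notin C.
  move=> CF; rewrite -negb_and; apply: contra => xC; exact: offx.
have toP C : C \in F -> v \in C -> (~~ [disjoint C & A2]) || (~~ [disjoint C & A3]) ->
    C \in priv F v B.
  move=> CF vC /(notx _ CF) xC; apply: mem_priv => // u nuv.
  rewrite !inE => /orP [/orP [] | ] /eqP eu; first by rewrite eu.
  - apply/negP => uC; move: vpq nuv; rewrite eu !inE => /orP [] /eqP ev; rewrite ev ?eqxx // => _.
    have pC : p \in C by rewrite -eu. have qC : q \in C by rewrite -ev.
    have : #|star (star F p) q| <= 1 by rewrite -[#|_|]/(cd p q) c1.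
    move=> /card_le1_eqP /(_ B C); rewrite !in_star BF CF pC qC !inE !eqxx !orbT => /(_ isT isT) e.
    by rewrite e xB in xC.
  - apply/negP => uC; move: vpq nuv; rewrite eu !inE => /orP [] /eqP ev; rewrite ev ?eqxx // => _.
    have qC : q \in C by rewrite -eu. have pC : p \in C by rewrite -ev.
    have : #|star (star F p) q| <= 1 by rewrite -[#|_|]/(cd p q) c1.
    move=> /card_le1_eqP /(_ B C); rewrite !in_star BF CF pC qC !inE !eqxx !orbT => /(_ isT isT) e.
    by rewrite e xB in xC.
have alt C : C \in priv F v B -> [disjoint C & A2] = ~~ [disjoint C & A3].
  move=> CP; have [CF vC _ off] := privP CP.
  have xC : x \notin C by apply: off; rewrite // eq_sym.
  have : C \notin hit3 B A2 A3 by rewrite r0 inE.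
  have mB : ~~ [disjoint C & B] by apply/pred0Pn; exists v; rewrite /= vC.
  have : ~~ ([disjoint C & A2] && [disjoint C & A3]).
    apply: contra xC => dC; apply: allx; apply/offP; by rewrite disjointU.
  by rewrite inE CF mB /=; case: [disjoint C & A2]; case: [disjoint C & A3].
have := priv7_split BF vB h7 d23 (noW _ B2) (noW _ B3) alt.
have sub2 : only_hit v A2 A3 \subset [set C in priv F v B | [disjoint C & A3]].
  apply/subsetP => C; rewrite inE => /and4P [CF vC m2 d3].
  by apply/setIdP; split=> //; apply: toP; rewrite ?m2.
have sub3 : only_hit v A3 A2 \subset [set C in priv F v B | [disjoint C & A2]].
  apply/subsetP => C; rewrite inE => /and4P [CF vC m3 d2].
  by apply/setIdP; split=> //; apply: toP; rewrite ?m3 ?orbT.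
case/orP => le2; apply/orP; [left | right]; apply: leq_trans le2; exact: subset_leq_card.
Qed.

Lemma star_absurd : False.
Proof.
pose c v := #|only_hit v A3 A2| <= 2.
have uG := link_uniform uF (v := x) (subxx F).
have sG := link_subcubic uF sF x (subxx F).
have mG := link_matching sF x (subxx F).
have G10 : #|link F x| = 10 by rewrite card_link -[#|_|]/(d x) dx.
have degG u : u != x -> deg (link F x) u = cd x u by move=> nux; rewrite deg_link.
have GF u w : [set u; w] \in link F x -> u != w ->
    [/\ x != u, x != w & [set x; u; w] \in F].
  move=> /imsetP [B + e] nuw; rewrite in_star => /andP [BF xB].
  have uB : u \in B :\ x by rewrite -e !inE eqxx.
  have wB : w \in B :\ x by rewrite -e !inE eqxx orbT.
  move: uB wB; rewrite !in_setD1 => /andP [nux uB] /andP [nwx wB].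
  by rewrite ![x == _]eq_sym nux nwx -setUA e setD1K.
have FG u w : [set x; u; w] \in F -> x != u -> x != w -> [set u; w] \in link F x.
  move=> BF nxu nxw; apply/imsetP; exists [set x; u; w]; first by rewrite in_star BF !inE eqxx.
  apply/setP => z; rewrite !inE; have [->|] := eqVneq z x; last by [].
  by rewrite (negbTE nxu) (negbTE nxw).
have [p [q [npq pqG cpq dq dp]]] := monochromatic_edge10 c uG sG mG G10.
have [nxp nxq BF] := GF _ _ pqG npq.
have npx := neq_sym nxp; have nqx := neq_sym nxq.
rewrite !degG // in dq dp.
have [c1 NB hp hq] : [/\ cd p q = 1, N [set x; p; q] = 24, h p [set x; p; q] = 7 &
    h q [set x; p; q] = 7].
  apply: star_edge_codegrees => //; case: dp => [dp|[dp all3]]; [by left | right].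
  split=> // z nzp nzx zF; rewrite -degG //; apply: all3 => //.
  by apply: FG; rewrite // eq_sym.
set B := [set x; p; q] in BF NB hp hq.
have xB : x \in B by rewrite !inE eqxx.
have m := minI (starI BF xB) NB; have [d3 _] := m.
have m2 := minimal3C12 m; have m3 := minimal3C12 (minimal3C23 m).
have [l2 n2 a2 s2] := minimal3_local m2; have [l3 n3 a3 s3] := minimal3_local m3.
have d3' := disjoint3C23 d3.
have dc := double_count d3; rewrite F50 NB I10 in dc.
have h2 := hit2_count d3; rewrite F50 I10 in h2.
have h3 := hit2_count d3'; rewrite F50 (setUC A3) I10 in h3.
(* A second star is excluded by [two_stars]: [hit2_count] leaves at least 50 - 25 - 10 - 10 = 5
   candidates for [r]. *)
have no2 : ~ (N A2 = 24 /\ #|off F (B :|: A3)| = 10).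
  move=> [NA2 n10]; have [y ally] := s2 NA2 n10.
  have /card_gt0P [r rH] : 0 < #|hit2 B A2 A3|.
    by move: h2 l3; rewrite n10; card_lia.
  exact: (two_stars d3 allx I10 ally n10 rH).
have no3 : ~ (N A3 = 24 /\ #|off F (B :|: A2)| = 10).
  move=> [NA3 n10]; have [y ally] := s3 NA3 n10.
  have /card_gt0P [r rH] : 0 < #|hit2 B A3 A2|.
    by move: h3 l2; rewrite n10; card_lia.
  apply: (two_stars d3' _ _ ally n10 rH); rewrite (setUC A3).
    exact: allx.
  exact: I10.
(* [B] contributes 24 + 10 and the other two at most 33 each, so 100 + r <= 100: r is 0 and both
   equal 33. Then N(A2) and N(A3) are at most 24, and each [hit2] family keeps at least 50 - 10 - 24
   - 10 = 6 edges. *)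
have [r0 g2 g3] :
    [/\ #|hit3 B A2 A3| = 0, 5 < #|hit2 B A2 A3| & 5 < #|hit2 B A3 A2|].
  move: no2 no3 a2 a3 l2 l3 n2 n3 dc h2 h3.
  move: #|off F (B :|: A3)| #|off F (B :|: A2)| #|hit3 B A2 A3| #|hit2 B A2 A3| #|hit2 B A3 A2|.
  move: (N A2) (N A3); clear => N2 N3 n2 n3 r0 g2 g3 no2 no3 a2 a3 l2 l3 b2 b3 dc h2 h3.
  have e2 : N2 + n2 <= 33 by lia.
  have e3 : N3 + n3 <= 33 by lia.
  by split; lia.
have {}r0 : hit3 B A2 A3 = set0 by apply/eqP; rewrite -cards_eq0 r0.
have ep := only_hit_priv (set21 p q) nxp nxq npq BF c1 hp r0.
have eq' := only_hit_priv (set22 p q) nxp nxq npq BF c1 hq r0.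
have cov X Y : (X == A2) || (X == A3) -> #|hit2 B X Y| <= #|only_hit p X Y| + #|only_hit q X Y|.
  move=> XA; apply: leq_trans (leq_card_setU _ _).
  apply/subset_leq_card/subsetP => C; rewrite !inE => /and4P [CF /pred0Pn [z /= /andP [zC zB]] mX dY].
  have xC : x \notin C.
    apply/negP => xC; have /andP [C2 C3] := offx CF xC.
    by case/orP: XA mX => /eqP ->; rewrite ?C2 ?C3.
  rewrite CF mX dY /= !andbT; move: zB; rewrite !inE => /orP [/orP [] | ] /eqP ez; rewrite ez in zC.
  - by rewrite zC in xC.
  - by rewrite zC.
  - by rewrite zC orbT.
(* The colours of [p] and [q] agree, so in [hit2 B A3 A2] or in [hit2 B A2 A3] both vertices
   contribute at most 2 edges, against the 6 needed. *)
have k2 := leq_trans g2 (cov A2 A3 _); have k3 := leq_trans g3 (cov A3 A2 _).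
rewrite !eqxx ?orbT in k2 k3; move: (k2 isT) (k3 isT) ep eq' cpq; rewrite /c.
by clear; lia.
Qed.

End BadStar.

(** Otherwise the edges disjoint from a given edge are intersecting, and there are at most 25 + 10
    edges. *)
Lemma disjoint_triple : 35 < #|F| -> exists A B C, disjoint3 A B C.
Proof.
move=> F36; have /card_gt0P [A AF] : 0 < #|F| by apply: leq_trans F36.
have cnt : #|F| = N A + #|off F A|.
  rewrite /off /hit !card_sum -sum1_card -!big_split /=.
  by apply: eq_bigr => D _; case: [disjoint D & A].
have [/existsP [B /existsP [C /and3P [/offP [BF BA] /offP [CF CA] BC]]] | no] :=
  boolP [exists B : {set T}, exists C : {set T}, [&& B \in off F A, C \in off F A & [disjoint B & C]]].
  by exists A, B, C; rewrite /disjoint3 AF BF CF BC ![[disjoint A & _]]disjoint_sym BA CA.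
have iI : intersecting (off F A).
  move=> B C BI CI; move: no; rewrite negb_exists => /forallP /(_ B).
  by rewrite negb_exists => /forallP /(_ C); rewrite BI CI.
have := off_le10 iI; have := hit_le25 uF sF AF; move: cnt F36; card_lia.
Qed.

Lemma minimal_triple : 35 < #|F| -> exists A B C, minimal3 A B C.
Proof.
move=> /disjoint_triple [A0 [B0 [C0 d0]]].
pose P (t : {set T} * {set T} * {set T}) := disjoint3 t.1.1 t.1.2 t.2.
have P0 : P (A0, B0, C0) by [].
case: (arg_minnP (fun t => N t.1.1 + N t.1.2 + N t.2) P0) => -[[A B] C] d3 m.
by exists A, B, C; split=> // A' B' C' d'; exact: (m (A', B', C')).
Qed.

Lemma sunflower_free_card : #|F| <> 50.
Proof.
move=> F50; have [|A [B [C m]]] := minimal_triple; first by rewrite F50.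
have m2 := minimal3C12 m; have m3 := minimal3C12 (minimal3C23 m).
have [l1 n1 a1 s1] := minimal3_local m; have [l2 n2 a2 s2] := minimal3_local m2.
have [l3 n3 a3 s3] := minimal3_local m3.
have no X Y Z : minimal3 X Y Z ->
   (N X = 24 -> #|off F (Y :|: Z)| = 10 -> exists x, forall D, D \in off F (Y :|: Z) -> x \in D) ->
   ~ (N X = 24 /\ #|off F (Y :|: Z)| = 10).
  move=> mX sX [NX n10]; have [x allx] := sX NX n10.
  exact: (star_absurd F50 mX NX n10 allx).
have no1 := no _ _ _ m s1; have no2 := no _ _ _ m2 s2; have no3 := no _ _ _ m3 s3.
have [d3 _] := m; have := double_count d3; rewrite F50.
move: no1 no2 no3 a1 a2 a3 l1 l2 l3 n1 n2 n3.
move: #|off F (B :|: C)| #|off F (A :|: C)| #|off F (A :|: B)| #|hit3 A B C|.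
move: (N A) (N B) (N C); clear => N1 N2 N3 n1 n2 n3 r no1 no2 no3 a1 a2 a3 l1 l2 l3 b1 b2 b3 dc.
(* The extreme cases are 25 + 6, 24 + 9 and 23 + 10. *)
have e1 : N1 + n1 <= 33 by lia.
have e2 : N2 + n2 <= 33 by lia.
have e3 : N3 + n3 <= 33 by lia.
by lia.
Qed.

End Main.

(** * Sunflowers in families of 50 triples *)

Lemma no_sunflower4 (T : finType) (F : {set {set T}}) :
  ~ has_sunflower 4 F -> sunflower_free3 F.
Proof.
move=> nF S C SF core; rewrite leqNgt; apply/negP => /card_geqP [s [us ss sS]].
apply: nF; exists [set A in s]; split.
  by apply/subsetP => A; rewrite inE => /sS; exact: (subsetP SF).
split; first by rewrite cardsE (card_uniqP us).
by exists C => A B; rewrite !inE => /sS AS /sS BS; exact: core.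
Qed.

Lemma sunflower4_of_card50 (T : finType) (F : {set {set T}}) :
  uniform 3 F -> #|F| = 50 -> has_sunflower 4 F.
Proof.
move=> uF F50; apply: NNPP => nF.
exact: (sunflower_free_card uF (no_sunflower4 nF)).
Qed.

Theorem theorem5p10 :
  (forall (T : finType) (F : {set {set T}}),
     uniform 3 F -> #|F| = 50 -> has_sunflower 4 F) /\
  sunflower_f 3 4 <= 49.
Proof.
split; first exact: sunflower4_of_card50.
have [[T [F [uF nF <-]]] _] := sunflower_fP 3 (isT : 0 < 4).
(* [s] lists 50 members of a family attaining the maximum; a 4-sunflower among them lies in the
   whole family. *)
rewrite leqNgt; apply/negP => /card_geqP [s [us ss sF]].
have sub : [set A in s] \subset F by apply/subsetP => A; rewrite inE => /sF.
apply: nF; have [|S [SG sunS]] := sunflower4_of_card50 (uniformS sub uF).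
  by rewrite cardsE (card_uniqP us).
by exists S; split=> //; exact: subset_trans SG sub.
Qed.
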